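(* Let $\zeta^{in}\ge 0$ a.e. with $\zeta^{in}\in L^1_{0,1}$, and let $\varphi\in L^1_{0,1}$. Let $\mathcal{A}:\mathbb{R}_{>0}^3\to[0,\infty)$, $(x,y,z)\mapsto\mathcal{A}(x,y;z)$, be a measurable function with $\mathcal{A}(x,y;z)=0$ whenever $z>x$. Let $\eta:(0,\infty)\to[1,\infty)$ satisfy $$\sup_{x\ge1}\frac{\eta(x)}{1+x}<\infty\quad\text{and}\quad \lim_{x\to\infty}\frac{\eta(x)}{x}=0.$$ Suppose that for some constant $A\ge0$: (1) $\mathcal{A}(x,y;z)\le A\varphi(z)$ if $(x,y)\in(0,1)^2$; $\mathcal{A}(x,y;z)\le A\,\eta(y)\varphi(z)$ if $(x,y)\in(0,1)\times(1,\infty)$; $\mathcal{A}(x,y;z)\le A\,\eta(x)\varphi(z)$ if $(x,y)\in(1,\infty)\times(0,1)$; $\mathcal{A}(x,y;z)\le A\,\eta(x)\eta(y)\varphi(z)$ if $(x,y)\in(1,\infty)^2$; (2) $\mathcal{A}\in W^{1,\infty}_{loc}(\mathbb{R}_{>0}\times\mathbb{R}_{>0}\times\mathbb{R}_{>0})$; (3) $\dfrac{\partial}{\partial x}\mathcal{A}(x,y;z)\le A(1+y)\varphi(z)$ and $\dfrac{\partial}{\partial y}\mathcal{A}(x,y;z)\le A(1+x)\varphi(z)$. Then there exists a weak solution $\zeta$ (in the sense defined in the context) to the continuous generalized exchange-driven growth equation with kernel $\mathcal{A}$ and initial condition $\zeta^{in}$, such that $$\zeta\in \mathcal{C}([0,\infty);L^1_{0,1})\cap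 L^\infty(0,T;L^1_{0,1})\quad\text{for each } T>0.$$
   Context: $\mathbb{R}_{>0}=(0,\infty)$, and $L^1_{0,1}=L^1(\mathbb{R}_{>0},(1+x)\,dx)$ with its standard norm. $\mathcal{C}([0,\infty),w\text{-}L^1(\mathbb{R}_{>0}))$ is the set of functions from $[0,\infty)$ to $L^1(\mathbb{R}_{>0})$ that are continuous for the weak topology of $L^1(\mathbb{R}_{>0})$. The continuous generalized exchange-driven growth equation is, for $x>0$, $t\ge0$, $$\begin{aligned}\partial_t\zeta(t,x)=&\int_0^\infty\!\!\int_0^\infty \mathcal{A}(x+z,y;z)\zeta(t,x+z)\zeta(t,y)\,dy\,dz-\int_0^\infty\!\!\int_z^\infty \mathcal{A}(y,x;z)\zeta(t,y)\zeta(t,x)\,dy\,dz\\&+\int_0^x\!\!\int_z^\infty \mathcal{A}(y,x-z;z)\zeta(t,y)\zeta(t,x-z)\,dy\,dz-\int_0^x\!\!\int_0^\infty \mathcal{A}(x,y;z)\zeta(t,x)\zeta(t,y)\,dy\,dz,\end{aligned}$$ with $\zeta(0,x)=\zeta^{in}(x)\ge 0$ a.e. Weak solution: given $0\le\zeta^{in}\in L^1_{0,1}$, a function $\zeta$ is a weak solution if (a) $0\le\zeta\in\mathcal{C}([0,\infty),w\text{-}L^1(\mathbb{R}_{>0}))\cap L^\infty(0,T;L^1_{0,1})$ for every $T>0$; and (b) for every $t\ge0$ and every smooth $\omega\in L^\infty(\mathbb{R}_{>0})$, $$\int_0^\infty\omega(x)[\zeta(t,x)-\zeta^{in}(x)]\,dx=\int_0^t\int_0^\infty\int_0^\infty\int_0^x\tilde\omega(x,y,z)\,\mathcal{A}(x,y;z)\,\zeta(s,x)\,\zeta(s,y)\,dz\,dy\,dx\,ds,$$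 where $\tilde\omega(x,y,z)=\omega(y+z)+\omega(x-z)-\omega(x)-\omega(y)$. *)

(* Defs.v *)
From HB Require Import structures.
From mathcomp Require Import all_boot all_order all_algebra.
From mathcomp Require Import all_classical all_reals all_analysis.

Set Implicit Arguments.
Unset Strict Implicit.
Unset Printing Implicit Defensive.

Import Order.TTheory GRing.Theory Num.Theory.
Import numFieldNormedType.Exports.

Local Open Scope classical_set_scope.
Local Open Scope ring_scope.

Notation mu3 :=
  ((@lebesgue_measure _ \x @lebesgue_measure _) \x @lebesgue_measure _)%E.

Section Defs.
Context {R : realType}.
Implicit Types (f g w : R -> R) (u : R -> R -> R) (a psi : R * R * R -> R).

Local Notation mu := (@lebesgue_measure R).

(* Elements of Lebesgue spaces are represented by functions on the whole line
   (or on R * R * R) whose values outside (0, oo) (or outside the octant) are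
   never used, and pointwise relations between them are stated almost
   everywhere. *)

Definition posR : set R := `]0, +oo[.

Definition nnegR : set R := `[0, +oo[.

Definition L1 f := mu.-integrable posR (EFin \o f).

Definition norm_L1 f : \bar R := (\int[mu]_(x in posR) `|f x|%:E)%E.

Definition L1_01 f := mu.-integrable posR (fun x => ((1 + x) * f x)%:E).

Definition norm_L1_01 f : \bar R :=
  (\int[mu]_(x in posR) ((1 + x) * `|f x|)%:E)%E.

Definition Linfty f :=
  measurable_fun posR f /\
  exists M : R, {ae mu, forall x, posR x -> `|f x| <= M}.

(* Boundedness makes l well defined on classes modulo a.e. equality. *)
Definition L1_dual (l : (R -> R) -> R) :=
  (forall (c : R) f g, L1 f -> L1 g ->
     l (fun x => c * f x + g x) = c * l f + l g) /\
  exists C : R, forall f, L1 f -> (`|l f|%:E <= C%:E * norm_L1 f)%E.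

(* Continuity for the weak topology, which is the initial topology of the
   family of all continuous linear functionals. *)
Definition C_weak_L1 u :=
  (forall t, nnegR t -> L1 (u t)) /\
  forall l, L1_dual l -> {within nnegR, continuous (fun t => l (u t))}.

Definition C_L1_01 u :=
  (forall t, nnegR t -> L1_01 (u t)) /\
  forall s, nnegR s ->
    norm_L1_01 (fun x => u t x - u s x) @[t --> within nnegR (nbhs s)] --> 0%E.

(* Bochner measurability: u is a.e. on (0, T) the limit of simple functions. *)
Definition strongly_measurable_L1_01 (T : R) u :=
  exists (n : nat -> nat) (E : nat -> nat -> set R) (f : nat -> nat -> R -> R),
    [/\ forall k i, measurable (E k i),
        forall k i, L1_01 (f k i) &
        {ae mu, forall t, t \in `]0, T[ ->
          norm_L1_01 (fun x => u t x - \sum_(i < n k) \1_(E k i) t * f k i x)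
            @[k --> \oo] --> 0%E}].

Definition Linfty_L1_01 (T : R) u :=
  strongly_measurable_L1_01 T u /\
  exists M : R, {ae mu, forall t, t \in `]0, T[ ->
    L1_01 (u t) /\ (norm_L1_01 (u t) <= M%:E)%E}.

Definition smooth_pos w := forall n x, posR x -> derivable (derive1n n w) x 1.

Definition octant : set (R * R * R) := posR `*` posR `*` posR.

(* Every iterated directional derivative is differentiable. *)
Definition smooth3 psi :=
  forall (s : seq (R * R * R)) p,
    differentiable (foldr (fun v h => 'D_v h) psi s) p.

Definition test_function psi :=
  smooth3 psi /\
  exists C : set (R * R * R), [/\ compact C, C `<=` octant &
    forall p, ~ C p -> psi p = 0].

Definition L1_loc a :=
  forall C : set (R * R * R), compact C -> C `<=` octant ->
    mu3.-integrable C (EFin \o a).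

Definition Linfty_loc a :=
  measurable_fun octant a /\
  forall C : set (R * R * R), compact C -> C `<=` octant ->
    exists M : R, {ae mu3, forall p, C p -> `|a p| <= M}.

Definition dir_x : R * R * R := (1, 0, 0).
Definition dir_y : R * R * R := (0, 1, 0).
Definition dir_z : R * R * R := (0, 0, 1).

(* b is the distributional derivative of a in the direction v. *)
Definition weak_derivative (v : R * R * R) a (b : R * R * R -> R) :=
  [/\ L1_loc a, L1_loc b &
   forall psi, test_function psi ->
     \int[mu3]_(p in octant) (a p * 'D_v psi p) =
     - \int[mu3]_(p in octant) (b p * psi p)].

Definition W1infty_loc a :=
  Linfty_loc a /\
  forall v, v \in [:: dir_x; dir_y; dir_z] ->
    exists2 b, Linfty_loc b & weak_derivative v a b.

Definition tilde w (x y z : R) := w (y + z) + w (x - z) - w x - w y.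

Definition exchange_integrand a w f (x y z : R) : R :=
  tilde w x y z * a (x, y, z) * f x * f y.

Definition exchange a w f : R :=
  \int[mu]_(x in posR) \int[mu]_(y in posR) \int[mu]_(z in `]0, x[)
    exchange_integrand a w f x y z.

(* The paper leaves implicit that the right-hand side of the weak formulation
   converges; the integral on R is total, so this is required explicitly. *)
Definition exchange_integrable a w u (t : R) :=
  {ae mu, forall s, s \in `]0, t[ ->
    mu3.-integrable (octant `&` [set p | p.2 < p.1.1])
      (fun p => (exchange_integrand a w (u s) p.1.1 p.1.2 p.2)%:E)} /\
  mu.-integrable `]0, t[ (fun s => (exchange a w (u s))%:E).

Definition weak_solution a (uin : R -> R) u :=
  [/\ forall t, nnegR t -> {ae mu, forall x, posR x -> 0 <= u t x},
      C_weak_L1 u,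
      forall T : R, 0 < T -> Linfty_L1_01 T u &
      forall (t : R) w, 0 <= t -> smooth_pos w -> Linfty w ->
        exchange_integrable a w u t /\
        \int[mu]_(x in posR) (w x * (u t x - uin x)) =
        \int[mu]_(s in `]0, t[) exchange a w (u s)].

End Defs.

(* Main.v *)
Require Import Defs.
From HB Require Import structures.
From mathcomp Require Import all_boot all_order all_algebra.
From mathcomp Require Import all_classical all_reals all_analysis.
From mathcomp Require Import measurable_realfun.
From mathcomp Require Import ring lra.

Set Implicit Arguments.
Unset Strict Implicit.
Unset Printing Implicit Defensive.

Import Order.TTheory GRing.Theory Num.Theory.
Import numFieldNormedType.Exports.

Local Open Scope classical_set_scope.
Local Open Scope ring_scope.

(** The growth hypothesis says that almost everywhere
[a (x, y, z) <= g x * g y * |phi z|], for a measurable [g >= 1] with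
[g x = o(1 + x)]. Writing [a = k * |phi|] and
[theta = |phi| dz], a finite measure, every estimate uses only
[0 <= k (x, y, z) <= g x * g y] and [k (x, y, z) != 0 -> 0 < z < x /\ 0 < y].
The weak formulation for a curve [t |-> rho t] of finite measures then reads
d/dt \int f d(rho t) = \int J_f d(rho t \x rho t \x theta), where [J_f] ([jump])
is the effect on [f] of moving a mass [z] to or from a cluster.

_Approximation._ The kernel is truncated to |x|, |y| <= n and time is
discretized by an explicit Euler scheme whose step [h_n] makes the total jump
rate of each point at most [1 / h_n]. A step is then the action of a positive
operator, so it maps finite measures to finite measures ([step_exists]).
Exchanging mass between clusters preserves the number of clusters and the total mass, hence
\int (1 + |x|) is constant along the scheme ([step_moment]).

_Uniform estimates._ For bounded [f] the quantities \int f are Lipschitz in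
time ([euler_lipschitz]). The tail \int (|x| - r)+ grows in a time [t] by at
most [t * e], with [e] small for large [r], because only clusters of size at
least r / 2, where [g x <= e * (1 + |x|)], and jumps of size at least r / 2,
whose first moment under [theta] is at most [e], contribute ([step_excess]). Uniform absolute continuity is the delicate
point, since the rate of a large cluster is not bounded. The scheme is compared
from below with the one that discards, after each step, the mass outside
[-r, r]. Inside the ball the density created at a point comes from
translations, which preserve Lebesgue measure, at a rate bounded by
[cut_rate r]; and the discarded mass is O(1 / r) since it carries a first
moment ([cut_step], [euler_uac]).

_Limit._ Bounded real sequences converge along an ultrafilter finer than the
neighbourhoods of infinity. So the masses of all Borel sets converge
simultaneously, for all times, and no subsequence has to be extracted.
Uniform absolute continuity and tightness make the limit countably additive
([ulim_measure]) and make the product measures converge as well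
([ultra_fprod]), which takes care of the quadratic term. What the scheme
satisfies over a small time interval survives in the limit ([rho_local]):
the increment of \int f d(rho t) is the length of the interval times the rate
at its left end, up to an arbitrarily small relative error. The rate is
therefore continuous, and the fundamental theorem of calculus yields the
integrated equation ([rho_weak]).

_Densities._ [rho t] is absolutely continuous and supported on (0, oo), and
[zeta t] is its Radon-Nikodym derivative. Testing against the sign of
[zeta t - zeta s] turns the Lipschitz estimate into one for the L^1 norm, and
the uniform smallness of the tails turns this into continuity for the norm of
L^1((1 + x) dx) ([norm_L1_01_uniform]). The weak formulation for the densities
follows from Fubini's theorem and from exchanging the roles of the two
clusters ([jump_symmetrize], [exchange_jump]). *)

(** * Finite product measures, densities, bounded functions *)

Section fprod.
Context d1 d2 (T1 : measurableType d1) (T2 : measurableType d2) (R : realType).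
Variables (m1 : {finite_measure set T1 -> \bar R})
  (m2 : {finite_measure set T2 -> \bar R}).

(** An alias of the library product, made so that finiteness of the factors
gives it a structure of finite measure. *)
Definition fprod : set (T1 * T2) -> \bar R := (m1 \x m2)%E.

HB.instance Definition _ := Measure.on fprod.

Let fprod_fin : fin_num_fun fprod.
Proof.
suff fT : (fprod setT < +oo)%E.
  move=> A mA; rewrite ge0_fin_numE//; apply: le_lt_trans fT.
  by apply: le_measure; rewrite ?inE.
rewrite /fprod -setXTT product_measure1E//.
by rewrite lte_mul_pinfty// ?ltey_eq fin_num_measure.
Qed.

HB.instance Definition _ := Measure_isFinite.Build _ _ _ fprod fprod_fin.
End fprod.

Lemma tonelli2 d1 d2 (T1 : measurableType d1) (T2 : measurableType d2) (R : realType)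
    (m1 : {finite_measure set T1 -> \bar R}) (m2 : {finite_measure set T2 -> \bar R})
    (f : T1 * T2 -> \bar R) : measurable_fun setT f -> (forall p, (0 <= f p)%E) ->
  (\int[fprod m1 m2]_p f p = \int[m1]_x \int[m2]_y f (x, y))%E.
Proof. exact: fubini_tonelli1. Qed.

Ltac mea1 := first
  [ match goal with
    | |- measurable_fun _ (EFin \o _) => apply/measurable_EFinP
    | |- measurable_fun _ (fun x => (@?a x)%:E) =>
        apply: (iffRL (measurable_EFinP _ a))
    | |- measurable_fun _ (fun x => x) => apply: measurable_id
    | |- measurable_fun _ fst => apply: measurable_fst
    | |- measurable_fun _ snd => apply: measurable_snd
    | |- measurable_fun _ (fun x => (@?a x + @?b x)%R) => apply: (measurable_funD (f := a) (g := b))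
    | |- measurable_fun _ (fun x => (@?a x * @?b x)%R) => apply: (measurable_funM (f := a) (g := b))
    | |- measurable_fun _ (fun x => (- @?a x)%R) => apply: (measurable_funN (f := a))
    | |- measurable_fun _ (fun x => (`|@?a x|)%R) => apply: (measurableT_comp (@normr_measurable _ setT) (g := a))
    | |- measurable_fun _ (fun x => Num.max (@?a x) (@?b x)) => apply: (measurable_maxr (f := a) (g := b))
    | |- measurable_fun _ (fun x => Num.min (@?a x) (@?b x)) => apply: (measurable_minr (f := a) (g := b))
    | |- measurable_fun _ (fun x => (@?a x + @?b x)%E) => apply: (emeasurable_funD (f := a) (g := b))
    | |- measurable_fun _ (fun x => (@?a x * @?b x)%E) => apply: (emeasurable_funM (f := a) (g := b))
    | |- measurable_fun _ (fun x => (@?a x, @?b x)) => apply: (measurable_fun_pair (f := a) (g := b))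
    | |- measurable_fun _ (fun x => fst (@?a x)) => apply: (measurableT_comp (@measurable_fst _ _ _ _) (g := a))
    | |- measurable_fun _ (fun x => snd (@?a x)) => apply: (measurableT_comp (@measurable_snd _ _ _ _) (g := a))
    | |- measurable_fun _ (fun x => \1_?D (@?a x)) => apply: (measurableT_comp (measurable_indic (U := D) _) (g := a))
    | H : measurable_fun _ ?f |- measurable_fun _ ?f => exact: H
    | H : measurable_fun _ ?f |- measurable_fun _ (fun x => ?f (@?a x)) => apply: (measurableT_comp H (g := a))
    | |- measurable_fun _ (fun _ => ?c) => apply: measurable_cst
    end ].

(** Measurability of an expression built from projections, algebraic
operations and functions whose measurability is in the context. *)
Ltac mea := repeat mea1.

Section density.
Context d (T : measurableType d) (R : realType).
Variables (m : {sigma_finite_measure set T -> \bar R}) (F : T -> R).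
Hypothesis F0 : forall x, 0 <= F x.
Hypothesis intF : m.-integrable setT (EFin \o F).
Local Open Scope ereal_scope.

(** The two proofs are arguments so that the measure structure can be
attached to [density F0 intF]. *)
Definition density of (forall x, (0 <= F x)%R) & m.-integrable setT (EFin \o F) :=
  fun A : set T => \int[m]_(x in A) (F x)%:E.
Local Notation nu := (density F0 intF).

Let mF : measurable_fun setT (EFin \o F).
Proof. exact: measurable_int intF. Qed.

Let nu0 : nu set0 = 0. Proof. by rewrite /nu /density integral_set0. Qed.

Let nu_ge0 A : 0 <= nu A.
Proof. by apply: integral_ge0 => x _; rewrite lee_fin. Qed.

Let nu_sigma : semi_sigma_additive nu.
Proof. by apply: semi_sigma_additive_nng_induced => // x; rewrite lee_fin. Qed.

HB.instance Definition _ := isMeasure.Build _ _ _ nu nu0 nu_ge0 nu_sigma.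

Let nu_fin : fin_num_fun nu.
Proof.
by move=> A mA; apply: integrable_fin_num => //=; apply: integrableS intF.
Qed.

HB.instance Definition _ := Measure_isFinite.Build _ _ _ nu nu_fin.

Lemma density_dominates : nu `<< m.
Proof.
apply/null_content_dominatesP => A mA mA0.
by rewrite /nu /density; apply: null_set_integral => //; exact: measurable_funTS.
Qed.

(** Both [F] and the Radon-Nikodym derivative of the measure with density [F]
have the same integral over every set, so they agree almost everywhere. *)
Lemma integral_density f : measurable_fun setT f -> (forall x, 0 <= f x) ->
  \int[nu]_x f x = \int[m]_x (f x * (F x)%:E).
Proof.
move=> mf f0; pose g := Radon_Nikodym_SigmaFinite.f nu m.
have gi : m.-integrable setT g := Radon_Nikodym_SigmaFinite.f_integrable density_dominates.
rewrite -(@Radon_Nikodym_SigmaFinite.change_of_variables _ _ _ nu m density_dominates)//.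
apply: ae_eq_integral => //.
- by apply: emeasurable_funM => //; exact: measurable_int gi.
- exact: emeasurable_funM.
apply: ae_eqe_mul2l; apply: integral_ae_eq => // A _ mA.
by rewrite /g -Radon_Nikodym_SigmaFinite.f_integral//; exact: density_dominates.
Qed.

End density.

Section bounded.
Context d (T : measurableType d) (R : realType).
Implicit Types (nu : {finite_measure set T -> \bar R}) (f g : T -> R).

(** The bound is explicit because the Lipschitz constants in time of
\int f d(rho t) must be linear in it. *)
Definition bdd (M : R) f := measurable_fun setT f /\ forall x, `|f x| <= M.

Definition mass nu : R := fine (nu setT).

Lemma mass_ge0 nu : 0 <= mass nu.
Proof. by rewrite fine_ge0. Qed.

Lemma massE nu : nu setT = (mass nu)%:E.
Proof. by rewrite fineK// fin_num_measure. Qed.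

Lemma bdd_ge0 M f : bdd M f -> 0 <= M.
Proof. by move=> [_ /(_ point)]; exact: le_trans. Qed.

Lemma bdd_integrable M nu f : bdd M f -> nu.-integrable setT (EFin \o f).
Proof.
move=> [mf fM]; apply: measurable_bounded_integrable => //.
  by rewrite ltey_eq fin_num_measure.
by exists M; split; [exact: num_real|move=> y My x _; exact: le_trans (fM x) (ltW My)].
Qed.

Lemma Rintegral_cstT nu (c : R) : \int[nu]_x c = c * mass nu.
Proof. by rewrite Rintegral_cst. Qed.

Lemma Rintegral_indicT nu A : measurable A -> \int[nu]_x \1_A x = fine (nu A).
Proof. by move=> mA; rewrite /Rintegral integral_indic// setIT. Qed.

Lemma bdd_EFin_Rintegral M nu f : bdd M f -> (\int[nu]_x f x)%:E = (\int[nu]_x (f x)%:E)%E.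
Proof.
move=> bf; rewrite /Rintegral fineK//; apply: integrable_fin_num => //.
exact: bdd_integrable bf.
Qed.

Lemma bdd_Rintegral_le M nu f : bdd M f -> `|\int[nu]_x f x| <= M * mass nu.
Proof.
move=> bf; have [mf fM] := bf.
apply: (le_trans (le_normr_Rintegral _ _)) => //; first exact: bdd_integrable bf.
rewrite -Rintegral_cstT; apply: le_Rintegral => //.
- by apply: (@bdd_integrable M); split; [mea|move=> x; rewrite normr_id].
- by apply: (@bdd_integrable `|M|); split; [mea|].
Qed.

Lemma bddD M1 M2 f g : bdd M1 f -> bdd M2 g -> bdd (M1 + M2) (fun x => f x + g x).
Proof.
move=> [mf fM] [mg gM]; split; first by mea.
by move=> x; rewrite (le_trans (ler_normD _ _))// lerD.
Qed.

Lemma bddN M f : bdd M f -> bdd M (fun x => - f x).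
Proof. by move=> [mf fM]; split; [mea|move=> x; rewrite normrN]. Qed.

Lemma bddB M1 M2 f g : bdd M1 f -> bdd M2 g -> bdd (M1 + M2) (fun x => f x - g x).
Proof. by move=> bf /bddN; exact: bddD. Qed.

Lemma bddM M1 M2 f g : bdd M1 f -> bdd M2 g -> bdd (M1 * M2) (fun x => f x * g x).
Proof.
move=> [mf fM] [mg gM]; split; first by mea.
by move=> x; rewrite normrM ler_pM.
Qed.

Lemma bdd_cst (c : R) : bdd `|c| (fun=> c).
Proof. by split; [mea|]. Qed.

Lemma bdd_indic A : measurable A -> bdd 1 (\1_A : T -> R).
Proof.
move=> mA; split; first exact: measurable_indic.
by move=> x; rewrite indicE; case: (_ \in _); rewrite ?normr1// normr0.
Qed.

Lemma bddW M M' f : M <= M' -> bdd M f -> bdd M' f.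
Proof. by move=> MM [mf fM]; split => // x; exact: le_trans (fM x) MM. Qed.

Lemma bdd_sum M (I : Type) (r : seq I) (P : pred I) (f : I -> T -> R) :
  (forall i, bdd M (f i)) -> bdd (M *+ size r) (fun x => \sum_(i <- r | P i) f i x).
Proof.
move=> bf; elim: r => [|i r IH].
  rewrite (_ : (fun x => _) = fun=> 0); last by apply/funext => x; rewrite big_nil.
  by apply: bddW (bdd_cst 0); rewrite normr0.
rewrite /= mulrS (_ : (fun x => _) = fun x => (if P i then f i x else 0) +
  \sum_(j <- r | P j) f j x); last first.
  by apply/funext => x; rewrite big_cons; case: (P i); rewrite ?add0r.
apply: bddD IH; case: (P i) => //.
by apply: bddW (bdd_cst 0); rewrite normr0; exact: bdd_ge0 (bf i).
Qed.

(** The sum is the floor of [y]. *)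
Lemma count_le_approx (L : nat) (y : R) : 0 <= y <= L%:R ->
  0 <= y - \sum_(i < L) ((i.+1%:R <= y :> R)%:R : R) <= 1.
Proof.
elim: L y => [|L IH] y.
  by move=> /andP[y0 y1]; rewrite big_ord0 subr0 y0 (le_trans y1).
move=> /andP[y0 y1]; rewrite big_ord_recr/=.
have [yL|Ly] := leP y L%:R.
  have -> : (L.+1%:R <= y :> R) = false.
    by apply/negbTE; rewrite -ltNge (le_lt_trans yL)// ltr_nat.
  by rewrite addr0; apply: IH; rewrite y0.
rewrite (eq_bigr (fun=> 1)); last first.
  by move=> i _; rewrite (le_trans _ (ltW Ly))// ler_nat.
rewrite sumr_const card_ord; have [Ly1|] := leP (L.+1%:R : R) y.
  have -> : y = L.+1%:R by apply: le_anti; rewrite y1.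
  by rewrite -(natr1 L) subrr lexx ler01.
rewrite -natr1 addr0 => H; lra.
Qed.

(** A bounded function is a uniform limit of step functions, taken here as
staircases with equal steps: setwise convergence of measures then passes to
integrals of bounded functions. *)
Lemma bdd_staircase M f (e : R) : bdd M f -> 0 < e ->
  exists (L : nat) (A : nat -> set T) (c s : R), (forall i, measurable (A i)) /\
    forall x, `|f x - (c + s * \sum_(i < L) \1_(A i) x)| <= e.
Proof.
move=> [mf fM] e0; have M0 := bdd_ge0 (conj mf fM).
pose L := `|Num.ceil (2 * M / e)|%N.
have LM : 2 * M / e <= L%:R.
  by rewrite (le_trans (ceil_ge _))// -[leRHS]/((Posz L)%:~R) ler_int /L abszE ler_norm.
exists L, (fun i => [set x | i.+1%:R <= (f x + M) / e :> R]), (- M), e; split.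
  move=> i; rewrite -[X in measurable X]setTI.
  apply: measurable_fun_ler => //; mea.
move=> x.
have := @count_le_approx L ((f x + M) / e).
have fx := fM x; move: fx; rewrite ler_norml => /andP[f1 f2].
rewrite divr_ge0//=; [|lra|lra].
rewrite (le_trans _ LM); last by rewrite ler_pM2r ?invr_gt0//; lra.
move=> /(_ isT) /andP[h1 h2].
rewrite (eq_bigr (fun i : 'I_L => ((i.+1%:R <= (f x + M) / e :> R))%:R)); last first.
  by move=> i _; rewrite indicE mem_setE.
set S := \sum_(i < L) _ in h1 h2 *.
have -> : f x - (- M + e * S) = e * ((f x + M) / e - S) by field; rewrite gt_eqF.
by rewrite normrM gtr0_norm// ger0_norm// ger_pMr.
Qed.

End bounded.

Lemma lebesgue_measure_shift (R : realType) (c : R) (A : set R) : measurable A ->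
  @lebesgue_measure R ((fun x => x + c) @^-1` A) = lebesgue_measure A.
Proof.
move=> mA.
have mc : measurable_fun [set: measurableTypeR R] (fun x : R => (x + c : measurableTypeR R)).
  by mea.
apply/esym/(@lebesgue_measure_unique R (pushforward lebesgue_measure (fun x : R => (x + c : measurableTypeR R)))) => //= _ [[a b]] _ <-.
rewrite /pushforward.
rewrite (_ : _ @^-1` _ = `](a - c), (b - c)]%classic); last first.
  by apply/seteqP; split=> x /=; rewrite !in_itv/= ltrBlDr lerBrDr.
rewrite !lebesgue_measure_itv/= !lte_fin ltrD2r; case: ifPn => // _.
by rewrite -!EFinD; congr EFin; lra.
Qed.

(** * Limits of measures along an ultrafilter *)

Section ultra.
Context (R : realType) (U : set_system nat) (UU : UltraFilter U).
Hypothesis Uoo : \oo `<=` U.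

(** Compactness of [-M, M]: the image ultrafilter has a cluster point, to
which it converges. *)
Lemma ultra_cvg (u : nat -> R) (M : R) : (forall n, `|u n| <= M) -> cvg (u @ U).
Proof.
move=> uM.
have /(_ (u @ U) _) := @segment_compact R (- M) M.
case.
  by apply: nearW => n /=; rewrite in_itv/= -ler_norml.
move=> x [_ ux]; apply/cvg_ex; exists x => B xB.
have [//|UnB] := in_ultra_setVsetC (u @^-1` B) UU.
have [y [nBy By]] : (~` B) `&` B !=set0 by exact: ux.
by [].
Qed.

Lemma ultra_cvg_oo (u : nat -> R) (l : R) : u @ \oo --> l -> u @ U --> l.
Proof. by move=> ul A /ul; exact: Uoo. Qed.
End ultra.

Section ultra_measure.
Context d (T : measurableType d) (R : realType) (U : set_system nat) (UU : UltraFilter U).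

(** Continuity from above at the empty set, uniformly in [n]. It is what a
setwise limit needs in order to be countably additive. *)
Definition uca (m_ : nat -> set T -> \bar R) :=
  forall E : nat -> set T, (forall j, measurable (E j)) ->
    (forall i j, (i <= j)%N -> E j `<=` E i) -> \bigcap_j E j = set0 ->
  forall e : R, 0 < e -> exists j, forall n, (m_ n (E j) <= e%:E)%E.

Variables (m_ : nat -> {finite_measure set T -> \bar R}) (N : R).
Hypothesis mN : forall n, mass (m_ n) <= N.
Hypothesis m_uca : uca m_.

Let v (A : set T) : R := Num.max 0 (lim (fine (m_ n A) @[n --> U])).

Let vbnd A n : measurable A -> `|fine (m_ n A)| <= N.
Proof.
move=> mA; rewrite ger0_norm ?fine_ge0//; apply: le_trans (mN n).
by rewrite fine_le ?fin_num_measure// le_measure ?inE.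
Qed.

Let vcvg A : measurable A -> fine (m_ n A) @[n --> U] --> v A.
Proof.
move=> mA; have c : cvg (fine (m_ n A) @[n --> U]).
  by apply: (@ultra_cvg _ _ _ _ N) => n; exact: vbnd.
rewrite /v max_r//; apply: limr_ge => //.
by apply: nearW => n; rewrite fine_ge0.
Qed.

Let v_unique A (x : R) : measurable A -> fine (m_ n A) @[n --> U] --> x -> v A = x.
Proof. by move=> mA h; rewrite -(cvg_lim _ (vcvg mA))//; exact: cvg_lim h. Qed.

Let nu A := (v A)%:E.

Let nu0 : nu set0 = 0%E.
Proof.
rewrite /nu (@v_unique _ 0)//.
by under eq_fun do rewrite measure0; exact: cvg_cst.
Qed.

Let nu_ge0 A : (0 <= nu A)%E.
Proof. by rewrite lee_fin /v le_max lexx. Qed.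

Let vU A B : measurable A -> measurable B -> A `&` B = set0 -> v (A `|` B) = v A + v B.
Proof.
move=> mA mB AB; apply: v_unique; first exact: measurableU.
under eq_fun do rewrite measureU// fineD ?fin_num_measure//.
by apply: cvgD; exact: vcvg.
Qed.

Let vle A e : measurable A -> (forall n, (m_ n A <= e%:E)%E) -> v A <= e.
Proof.
move=> mA h; have /cvg_lim <- := vcvg mA; last by [].
apply: limr_le; first by apply: cvgP; exact: vcvg.
apply: nearW => n; rewrite -lee_fin fineK ?fin_num_measure//.
Qed.

Let nu_sigma : semi_sigma_additive nu.
Proof.
move=> F mF tF mUF.
pose E n := (\bigcup_k F k) `\` \big[setU/set0]_(i < n) F i.
have mE n : measurable (E n).
  by apply: measurableD => //; apply: bigsetU_measurable.
have vE n : v (\bigcup_k F k) = v (E n) + \sum_(i < n) v (F i).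
  have -> : \sum_(i < n) v (F i) = v (\big[setU/set0]_(i < n) F i).
    elim: n => [|n IH]; first by rewrite !big_ord0; have [->] := nu0.
    rewrite !big_ord_recr/= IH vU//.
      exact: bigsetU_measurable.
    rewrite -subset0 => x [+ xn]; rewrite -bigcup_mkord => -[i /= ilt xi].
    have ein : i = n by apply: tF => //; exists x.
    by rewrite ein ltnn in ilt.
  rewrite -vU//.
  - by congr v; rewrite /E setDKU//; exact: bigsetU_bigcup.
  - exact: bigsetU_measurable.
  - by rewrite /E setDE -setIA setICl setI0.
have -> : (fun n => (\sum_(0 <= i < n) nu (F i))%E) =
    EFin \o (fun n => \sum_(i < n) v (F i)).
  by apply/funext => n /=; rewrite /nu sumEFin big_mkord.
apply: cvg_EFin; first exact: nearW.
have -> : fine \o (EFin \o (fun n => \sum_(i < n) v (F i))) =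
    (fun n => v (\bigcup_k F k) - v (E n)).
  by apply/funext => n /=; rewrite (vE n); ring.
rewrite -[X in _ --> X]subr0; apply: cvgB; first exact: cvg_cst.
have Edec i j : (i <= j)%N -> E j `<=` E i.
  by move=> ij; apply: setDS; exact: subset_bigsetU.
have E0 : \bigcap_j E j = set0.
  rewrite -subset0 => x xE; have [[k _ xk] _] := xE 0%N I.
  by have [_] := xE k.+1 I; apply; rewrite big_ord_recr/=; right.
apply/cvgrPdist_le => e e0; have [j jE] := m_uca mE Edec E0 e0.
near=> n; rewrite sub0r normrN ger0_norm; last by rewrite -lee_fin; exact: nu_ge0.
apply: vle => // k; apply: le_trans (jE k).
apply: le_measure; rewrite ?inE//; apply: Edec; near: n; exact: nbhs_infty_ge.
Unshelve. all: by end_near. Qed.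

(** The setwise limit. It is additive as a limit of additive functions, and
countably additive by [uca]; [v] is cut at 0 so that it is nonnegative on
nonmeasurable sets too. *)
Definition ulim_measure of (forall n, mass (m_ n) <= N) & uca m_ & UltraFilter U := nu.
Local Notation lm := (ulim_measure mN m_uca UU).

HB.instance Definition _ := isMeasure.Build _ _ _ lm nu0 nu_ge0 nu_sigma.
Let lm_fin : fin_num_fun lm. Proof. by []. Qed.
HB.instance Definition _ := Measure_isFinite.Build _ _ _ lm lm_fin.

Lemma ulim_measure_exists : exists nu : {finite_measure set T -> \bar R},
  forall A, measurable A -> fine (m_ n A) @[n --> U] --> fine (nu A).
Proof. by exists lm => A mA; exact: vcvg. Qed.
End ultra_measure.

Lemma bdd_Rintegral_sum d (T : measurableType d) (R : realType)
    (nu : {finite_measure set T -> \bar R}) (M : R) (I : Type) (r : seq I)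
    (f : I -> T -> R) : (forall i, bdd M (f i)) ->
  \int[nu]_x (\sum_(i <- r) f i x) = \sum_(i <- r) \int[nu]_x f i x.
Proof.
move=> bf; elim: r => [|i r IH].
  by rewrite big_nil; under eq_Rintegral do rewrite big_nil; rewrite Rintegral_cstT mul0r.
rewrite big_cons -IH -RintegralD//; last 2 first.
- exact: bdd_integrable (bf i).
- exact: (bdd_integrable _ (bdd_sum r predT bf)).
by apply: eq_Rintegral => x _; rewrite big_cons.
Qed.

Section ultra_integral.
Context d (T : measurableType d) (R : realType) (U : set_system nat) (UU : UltraFilter U).
Variables (m_ : nat -> {finite_measure set T -> \bar R}) (nu : {finite_measure set T -> \bar R}).
Hypothesis m_nu : forall A, measurable A -> fine (m_ n A) @[n --> U] --> fine (nu A).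

Lemma ultra_cvg_Rintegral M (f : T -> R) : bdd M f ->
  \int[m_ n]_x f x @[n --> U] --> \int[nu]_x f x.
Proof.
move=> bf; apply/cvgrPdist_le => /= e e0.
pose N := mass nu + 1.
have N0 : 0 < N by rewrite ltr_pwDr// mass_ge0.
have e3 : 0 < e / (3 * N) by rewrite divr_gt0// mulr_gt0.
have [L [A [c [s [mA fA]]]]] := bdd_staircase bf e3.
pose g x := c + s * \sum_(i < L) \1_(A i) x : R.
have b1 (i : 'I_L) : bdd (1 : R) (\1_(A i) : T -> R) by exact: bdd_indic.
have bsum := bdd_sum (index_enum 'I_L) predT b1.
have bs := bddM (bdd_cst T s) bsum.
have bg := bddD (bdd_cst T c) bs.
have Ig (m : {finite_measure set T -> \bar R}) :
    \int[m]_x g x = c * mass m + s * \sum_(i < L) fine (m (A i)).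
  rewrite /g RintegralD//; [|exact: bdd_integrable (bdd_cst _ _)|exact: bdd_integrable bs].
  rewrite Rintegral_cstT RintegralZl//; last exact: bdd_integrable bsum.
  rewrite (bdd_Rintegral_sum _ _ b1); congr (_ + _ * _).
  by apply: eq_bigr => i _; rewrite Rintegral_indicT.
have bfg : bdd (e / (3 * N)) (fun x => f x - g x).
  by have [] := bddB bf bg; split.
have fg (m : {finite_measure set T -> \bar R}) :
    `|\int[m]_x f x - \int[m]_x g x| <= e / (3 * N) * mass m.
  rewrite -RintegralB//; [|exact: bdd_integrable bf|exact: bdd_integrable bg].
  exact: bdd_Rintegral_le.
have cm : mass (m_ n) @[n --> U] --> mass nu by exact: m_nu.
have cg : \int[m_ n]_x g x @[n --> U] --> \int[nu]_x g x.
  rewrite Ig; under eq_fun do rewrite Ig.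
  apply: cvgD; first by apply: cvgM => //; exact: cvg_cst.
  apply: cvgM; first exact: cvg_cst.
  elim: (L) => [|k IH].
    by under eq_fun do rewrite big_ord0; rewrite big_ord0; exact: cvg_cst.
  under eq_fun do rewrite big_ord_recr/=.
  by rewrite big_ord_recr/=; apply: cvgD => //; exact: m_nu.
have e30 : 0 < e / 3 by rewrite divr_gt0.
move/cvgrPdist_le : cg => /(_ _ e30); move/cvgrPdist_le : cm => /(_ _ ltr01).
apply: filterS2 => n h1 h2.
have mN : mass (m_ n) <= N by move: h1; rewrite ler_distlC /N => /andP[_]; lra.
have nN : mass nu <= N by rewrite /N lerDl.
have b (x : R) : x <= N -> e / (3 * N) * x <= e / 3.
  move=> xN; rewrite (le_trans (ler_wpM2l (ltW e3) xN))//.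
  by rewrite le_eqVlt; apply/orP; left; apply/eqP; field; rewrite gt_eqF.
have := le_trans (fg nu) (b _ nN); have := le_trans (fg (m_ n)) (b _ mN).
move: h2; rewrite !ler_norml => /andP[? ?] /andP[? ?] /andP[? ?]; apply/andP; split; lra.
Qed.

End ultra_integral.

Section uca_product.
Context d1 d2 (T1 : measurableType d1) (T2 : measurableType d2) (R : realType).
Variables (a_ : nat -> {finite_measure set T1 -> \bar R})
  (b_ : nat -> {finite_measure set T2 -> \bar R}) (N : R).
Hypotheses (aN : forall n, mass (a_ n) <= N) (bN : forall n, mass (b_ n) <= N).

Lemma mass_fprod (a : {finite_measure set T1 -> \bar R}) (b : {finite_measure set T2 -> \bar R}) :
  mass (fprod a b) = mass a * mass b.
Proof.
rewrite /mass /= /fprod -setXTT product_measure1E// fineM ?fin_num_measure//.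
Qed.

(** If [E_j] decreases to the empty set, then so do its sections, and the set
[G_j] of those x whose section has [b_n]-measure above [c] for some [n]. Thus
the product measure of [E_j] is at most [c * mass (a_n) + N * a_n (G_j)]. *)
Lemma uca_fprod : uca a_ -> uca b_ -> uca (fun n => fprod (a_ n) (b_ n)).
Proof.
move=> ua ub E mE dE E0 e e0.
have N0 : 0 <= N by rewrite (le_trans _ (aN 0%N))// mass_ge0.
(* e = c * (N + 1) + (N + 1) * c, one term for each part of the bound *)
pose c := e / (2 * (N + 1)).
have c0 : 0 < c by rewrite divr_gt0// mulr_gt0//; lra.
pose G j := \bigcup_n [set x | (c%:E < b_ n (xsection (E j) x))%E].
have mG j : measurable (G j).
  apply: bigcup_measurable => n _; rewrite -[X in measurable X]setTI.
  by apply: emeasurable_fun_o_infty => //; exact: measurable_fun_xsection.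
have [j hj] : exists j, forall n, (a_ n (G j) <= c%:E)%E.
  apply: ua => //.
  - move=> i j ij x [n _ /= h]; exists n => //=; apply: (lt_le_trans h).
    apply: le_measure; rewrite ?inE; try exact: measurable_xsection.
    by apply: le_xsection; exact: dE.
  - rewrite -subset0 => x xG.
    have [j hj] : exists j, forall n, (b_ n (xsection (E j) x) <= c%:E)%E.
      apply: ub => //.
      + by move=> j; exact: measurable_xsection.
      + by move=> i j ij; apply: le_xsection; exact: dE.
      + rewrite -subset0 => y yE.
        have : (\bigcap_j E j) (x, y) by move=> j _; have := yE j I; rewrite xsectionE.
        by rewrite E0.
    by have [n _ /=] := xG j I; rewrite ltNge hj.
exists j => n.
rewrite /fprod /product_measure1.
apply: (@le_trans _ _ (\int[a_ n]_x ((c + N * \1_(G j) x)%:E))%E).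
  apply: ge0_le_integral => //.
  - exact: measurable_fun_xsection.
  - apply/measurable_EFinP; apply: measurable_funD => //.
    by apply: measurable_funM => //; exact: measurable_indic.
  - move=> x _ /=; rewrite indicE; case: (boolP (x \in G j)) => xG.
      rewrite mulr1; apply: (@le_trans _ _ (b_ n setT)).
        by apply: le_measure; rewrite ?inE//; exact: measurable_xsection.
      by rewrite massE lee_fin (le_trans (bN n))// lerDr ltW.
    rewrite mulr0 addr0 leNgt; apply/negP => h; move: xG; rewrite notin_setE; apply.
    by exists n.
have bi : bdd (N * 1) (fun x => N * \1_(G j) x : R).
  by rewrite -{1}(ger0_norm N0); apply: bddM; [exact: bdd_cst|exact: bdd_indic].
have bc := bddD (bdd_cst T1 c) bi.
rewrite -(bdd_EFin_Rintegral _ bc) lee_fin RintegralD//; last 2 first.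
- exact: bdd_integrable (bdd_cst T1 c).
- exact: bdd_integrable bi.
rewrite Rintegral_cstT RintegralZl//; last exact: bdd_integrable (bdd_indic _ (mG j)).
rewrite Rintegral_indicT//.
have h1 : fine (a_ n (G j)) <= c by rewrite -lee_fin fineK ?fin_num_measure.
have -> : e = c * (N + 1) + (N + 1) * c by rewrite /c; field; rewrite gt_eqF//; lra.
apply: lerD.
  by apply: ler_wpM2l; [exact: ltW|rewrite (le_trans (aN n))// lerDl].
by rewrite ler_pM// ?fine_ge0// lerDl.
Qed.

(** The product measures have some setwise limit by [uca_fprod]; on rectangles
it is the product of the limits, and this determines it. *)
Lemma ultra_fprod (U : set_system nat) (UU : UltraFilter U)
  (a : {finite_measure set T1 -> \bar R}) (b : {finite_measure set T2 -> \bar R}) :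
  uca a_ -> uca b_ ->
  (forall A, measurable A -> fine (a_ n A) @[n --> U] --> fine (a A)) ->
  (forall A, measurable A -> fine (b_ n A) @[n --> U] --> fine (b A)) ->
  forall A, measurable A ->
    fine (fprod (a_ n) (b_ n) A) @[n --> U] --> fine (fprod a b A).
Proof.
move=> ua ub ca cb.
have N0 : 0 <= N by rewrite (le_trans _ (aN 0%N))// mass_ge0.
have mN n : mass (fprod (a_ n) (b_ n)) <= N * N.
  by rewrite mass_fprod ler_pM ?mass_ge0.
have [c cc] := ulim_measure_exists UU mN (uca_fprod ua ub).
have cab A : measurable A -> fprod a b A = c A.
  apply: product_measure_unique => A1 A2 mA1 mA2.
  rewrite -[LHS]fineK ?fin_num_measure//; last exact: measurableX.
  transitivity ((fine (a A1))%:E * (fine (b A2))%:E)%E; last first.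
    by congr (_ * _)%E; rewrite fineK// fin_num_measure.
  rewrite -EFinM; congr EFin.
  have h1 := cc _ (measurableX mA1 mA2).
  have h2 : fine (a_ n A1) * fine (b_ n A2) @[n --> U] --> fine (a A1) * fine (b A2).
    by apply: cvgM; [exact: ca|exact: cb].
  rewrite -(cvg_lim _ h1)// -(cvg_lim _ h2)//; congr (lim (_ @ U)); apply/funext => n.
  by rewrite /= /fprod product_measure1E// fineM ?fin_num_measure.
by move=> A mA; rewrite cab//; exact: cc.
Qed.

End uca_product.

(** * One explicit Euler step *)

Section as_finite.
Context d (T : measurableType d) (R : realType) (m : {measure set T -> \bar R}).
Definition as_finite of (m setT < +oo)%E : set T -> \bar R := m.
Variable moo : (m setT < +oo)%E.
HB.instance Definition _ := Measure.on (as_finite moo).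
Let fin : fin_num_fun (as_finite moo).
Proof.
move=> A mA; rewrite ge0_fin_numE//; apply: le_lt_trans moo.
by apply: le_measure; rewrite ?inE.
Qed.
HB.instance Definition _ := Measure_isFinite.Build _ _ _ (as_finite moo) fin.
End as_finite.

Section transport.
Context d d' (T : measurableType d) (T' : measurableType d') (R : realType).
Local Open Scope ereal_scope.

(** The image by [p] of the measure with density [K]. *)
Lemma transport_measure (P : {finite_measure set T -> \bar R}) (K : T -> R) (b : R)
    (p : T -> T') : measurable_fun setT p -> bdd b K -> (forall x, 0 <= K x)%R ->
  exists m : {finite_measure set T' -> \bar R},
    forall f, measurable_fun setT f -> (forall x, 0 <= f x) ->
      \int[m]_x f x = \int[P]_x (f (p x) * (K x)%:E).
Proof.
move=> mp bK K0.
have iK : P.-integrable setT (EFin \o K) by exact: bdd_integrable bK.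
have [m0 m0E] : exists m : {measure set T' -> \bar R},
    (m : set T' -> \bar R) = pushforward (density K0 iK) p.
  unshelve (refine (ex_intro _ (pushforward (density K0 iK) p : {measure set T' -> \bar R}) _)); last by [].
  exact: mp.
have m0oo : m0 setT < +oo.
  by rewrite m0E /pushforward preimage_setT ltey_eq fin_num_measure.
exists (as_finite m0oo) => f mf f0.
transitivity (\int[pushforward (density K0 iK) p]_x f x); first by rewrite -m0E.
rewrite ge0_integral_pushforward//= preimage_setT integral_density//=.
exact: measurableT_comp.
Qed.

Lemma add_measure (m1 m2 : {finite_measure set T -> \bar R}) :
  exists m : {finite_measure set T -> \bar R},
    forall f, measurable_fun setT f -> (forall x, 0 <= f x) ->
      \int[m]_x f x = \int[m1]_x f x + \int[m2]_x f x.
Proof.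
have moo : measure_add m1 m2 setT < +oo.
  by rewrite measure_addE lte_add_pinfty// ltey_eq fin_num_measure.
exists (as_finite moo) => f mf f0.
exact: ge0_integral_measure_add.
Qed.
End transport.

Section step.
Context (R : realType) (theta : {finite_measure set R -> \bar R}) (h : R) (k : R * R * R -> R).
Implicit Types (u v : {finite_measure set R -> \bar R}) (f : R -> R).

(** The rate at which a cluster of size [x] leaves this size, by giving (first
term) or by receiving (second term), in a population [v]. *)
Definition rate v x := \int[fprod v theta]_q (k (x, q.1, q.2) + k (q.1, x, q.2)).

Definition gain v f x := (\int[fprod v theta]_q
  (f (x - q.2) * k (x, q.1, q.2) + f (x + q.2) * k (q.1, x, q.2))%:E)%E.

(** The dual action of one explicit Euler step of length [h] on a test
function. Its target is the extended reals since [f] may be unbounded. *)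
Definition markov v f x := ((f x * (1 - h * rate v x))%:E + h%:E * gain v f x)%E.

(** Testing against nonnegative functions determines [u'] and is directly
usable for the unbounded weights as well. The population [v] that drives the
jumps is kept apart from the measure [u] that is moved: the scheme has
[u = v], and the scheme cut to a ball has [u] smaller than [v]. *)
Definition is_step u v u' := forall f, measurable_fun setT f -> (forall x, 0 <= f x) ->
  (\int[u']_x (f x)%:E = \int[u]_x markov v f x)%E.

Variable b : R.
Hypotheses (h0 : 0 <= h) (mk : measurable_fun setT k) (k0 : forall p, 0 <= k p)
  (kb : forall p, k p <= b).

Let kbdd : bdd b k.
Proof. by split => // p; rewrite ger0_norm. Qed.

Let b0 : 0 <= b. Proof. exact: bdd_ge0 kbdd. Qed.

Let rint x : bdd (b + b) (fun q : R * R => k (x, q.1, q.2) + k (q.1, x, q.2)).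
Proof.
by apply: bddD; split=> [|q]; rewrite ?ger0_norm//; mea.
Qed.

Lemma rate_ge0 v x : 0 <= rate v x.
Proof. by apply: Rintegral_ge0 => q _; rewrite addr_ge0. Qed.

Lemma measurable_rate v : measurable_fun setT (rate v).
Proof.
rewrite (_ : rate v = fine \o (fubini_F (fprod v theta) (fun p : R * (R * R) => (k (p.1, p.2.1, p.2.2) + k (p.2.1, p.1, p.2.2))%:E))) //.
apply: measurableT_comp => //; apply: measurable_fun_fubini_tonelli_F.
  by mea.
by move=> p; rewrite lee_fin addr_ge0.
Qed.

Lemma rate_EFin v x : (\int[fprod v theta]_q (k (x, q.1, q.2) + k (q.1, x, q.2))%:E = (rate v x)%:E)%E.
Proof. by rewrite -(bdd_EFin_Rintegral _ (rint x)). Qed.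

Lemma gain_ge0 v f x : (forall x, 0 <= f x) -> (0 <= gain v f x)%E.
Proof. by move=> f0; apply: integral_ge0 => q _; rewrite lee_fin addr_ge0// mulr_ge0. Qed.

Lemma measurable_gain v f : measurable_fun setT f -> (forall x, 0 <= f x) ->
  measurable_fun setT (gain v f).
Proof.
move=> mf f0.
apply: (@measurable_fun_fubini_tonelli_F _ _ _ _ _ (fprod v theta) (fun p : R * (R * R) => (f (p.1 - p.2.2) * k (p.1, p.2.1, p.2.2) + f (p.1 + p.2.2) * k (p.2.1, p.1, p.2.2))%:E)%E).
  by mea.
by move=> p; rewrite lee_fin addr_ge0// mulr_ge0.
Qed.

Lemma markov_ge0 v f x : h * rate v x <= 1 -> (forall x, 0 <= f x) -> (0 <= markov v f x)%E.
Proof.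
move=> hr f0; rewrite adde_ge0//; first by rewrite lee_fin mulr_ge0// subr_ge0.
by rewrite mule_ge0// gain_ge0.
Qed.

Lemma measurable_markov v f : measurable_fun setT f -> (forall x, 0 <= f x) ->
  measurable_fun setT (markov v f).
Proof.
move=> mf f0; have mr := measurable_rate v; have mg := measurable_gain v mf f0.
by apply: emeasurable_funD; [mea|apply: emeasurable_funM; [mea|]].
Qed.

(** The step is the sum of three images of finite measures: the clusters
which stay, those which give and those which receive. The time step restriction
makes the first one nonnegative. *)
Lemma step_exists u v : (forall x, h * rate v x <= 1) ->
  exists u' : {finite_measure set R -> \bar R}, is_step u v u'.
Proof.
move=> hr.
have F1 x : 0 <= 1 - h * rate v x by rewrite subr_ge0.
have mr := measurable_rate v.
have b1 : bdd 1 (fun x => 1 - h * rate v x).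
  split; first by mea.
  by move=> x; rewrite ger0_norm// gerBl mulr_ge0// rate_ge0.
have ba : bdd (h * b) (fun p : R * (R * R) => h * k (p.1, p.2.1, p.2.2)).
  by split=> [|x]; [mea|rewrite ger0_norm ?mulr_ge0// ler_wpM2l].
have bc : bdd (h * b) (fun p : R * (R * R) => h * k (p.2.1, p.1, p.2.2)).
  by split=> [|x]; [mea|rewrite ger0_norm ?mulr_ge0// ler_wpM2l].
have mm : measurable_fun setT (fun p : R * (R * R) => p.1 - p.2.2) by mea.
have mp : measurable_fun setT (fun p : R * (R * R) => p.1 + p.2.2) by mea.
pose P := fprod u (fprod v theta).
have [m1 m1E] := transport_measure u (@measurable_id _ _ setT) b1 F1.
have [m2 m2E] := transport_measure P mm ba (fun p => mulr_ge0 h0 (k0 _)).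
have [m3 m3E] := transport_measure P mp bc (fun p => mulr_ge0 h0 (k0 _)).
have [m4 m4E] := add_measure m2 m3.
have [m mE] := add_measure m1 m4.
exists m => f mf f0.
have mf' : measurable_fun setT (fun x => (f x)%:E) by mea.
have f0' x : (0 <= (f x)%:E)%E by rewrite lee_fin.
rewrite mE// m4E// m1E// m2E// m3E//.
rewrite ge0_integralD//; last 4 first.
- by move=> x _; rewrite lee_fin mulr_ge0.
- by mea.
- by move=> x _; rewrite mule_ge0// gain_ge0.
- by have := measurable_gain v mf f0 => mg; mea.
congr (_ + _)%E.
rewrite -ge0_integralD//; last 4 first.
- by move=> x _; rewrite mule_ge0// lee_fin mulr_ge0.
- by mea.
- by move=> x _; rewrite mule_ge0// lee_fin mulr_ge0.
- by mea.
rewrite tonelli2//; last 2 first.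
- by apply: emeasurable_funD; apply: emeasurable_funM; mea.
- by move=> x; rewrite adde_ge0// mule_ge0// lee_fin mulr_ge0.
apply: eq_integral => x _; rewrite -ge0_integralZl//; last 2 first.
- by mea.
- by move=> q _; rewrite lee_fin addr_ge0// mulr_ge0.
by apply: eq_integral => q _ /=; rewrite -!EFinM -EFinD; congr EFin; ring.
Qed.
End step.

Section bdd_fubini.
Context d1 d2 (T1 : measurableType d1) (T2 : measurableType d2) (R : realType).
Variables (a : {finite_measure set T1 -> \bar R}) (b : {finite_measure set T2 -> \bar R}).
Variables (M : R) (F : T1 * T2 -> R).
Hypothesis bF : bdd M F.

Lemma bdd_section1 x : bdd M (fun y => F (x, y)).
Proof. by case: bF => mF FM; split => //; mea. Qed.

Lemma bdd_section2 y : bdd M (fun x => F (x, y)).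
Proof. by case: bF => mF FM; split => //; mea. Qed.

Lemma bdd_partial1 : bdd (M * mass b) (fun x => \int[b]_y F (x, y)).
Proof.
split; last by move=> x; apply: bdd_Rintegral_le; exact: bdd_section1.
apply: measurableT_comp => //.
apply: (@measurable_fubini_F _ _ _ _ _ a b (EFin \o F)).
exact: (bdd_integrable (fprod a b) bF).
Qed.

Lemma bdd_partial2 : bdd (M * mass a) (fun y => \int[a]_x F (x, y)).
Proof.
split; last by move=> y; apply: bdd_Rintegral_le; exact: bdd_section2.
apply: measurableT_comp => //.
apply: (@measurable_fubini_G _ _ _ _ _ a b (EFin \o F)).
exact: (bdd_integrable (fprod a b) bF).
Qed.

Lemma bdd_fubini1 : \int[fprod a b]_p F p = \int[a]_x \int[b]_y F (x, y).
Proof.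
apply: EFin_inj; rewrite (bdd_EFin_Rintegral _ bF) (bdd_EFin_Rintegral _ bdd_partial1).
rewrite -(integral12_prod_meas1 (f := EFin \o F)); last exact: (bdd_integrable (fprod a b) bF).
by apply: eq_integral => x _; rewrite (bdd_EFin_Rintegral _ (bdd_section1 x)).
Qed.

Lemma bdd_fubini2 : \int[fprod a b]_p F p = \int[b]_y \int[a]_x F (x, y).
Proof.
apply: EFin_inj; rewrite (bdd_EFin_Rintegral _ bF) (bdd_EFin_Rintegral _ bdd_partial2).
rewrite -(integral21_prod_meas1 (f := EFin \o F)); last exact: (bdd_integrable (fprod a b) bF).
by apply: eq_integral => x _; rewrite (bdd_EFin_Rintegral _ (bdd_section2 x)).
Qed.

End bdd_fubini.

Lemma fprod_swap d1 d2 d3 (T1 : measurableType d1) (T2 : measurableType d2)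
  (T3 : measurableType d3) (R : realType) (m1 : {finite_measure set T1 -> \bar R})
  (m2 : {finite_measure set T2 -> \bar R}) (m3 : {finite_measure set T3 -> \bar R})
  (F : T1 * T2 * T3 -> \bar R) : measurable_fun setT F -> (forall p, 0 <= F p)%E ->
  (\int[m1]_x \int[fprod m2 m3]_q F (x, q.1, q.2) =
   \int[m2]_y \int[fprod m1 m3]_q F (q.1, y, q.2))%E.
Proof.
move=> mF F0.
pose G p := (\int[m3]_z F (p, z))%E.
have mG : measurable_fun setT G by exact: measurable_fun_fubini_tonelli_F.
have G0 p : (0 <= G p)%E by exact: integral_ge0.
transitivity (\int[m1]_x \int[m2]_y G (x, y))%E.
  by apply: eq_integral => x _; rewrite tonelli2//; mea.
rewrite fubini_tonelli//; apply: eq_integral => y _.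
by rewrite tonelli2//; mea.
Qed.

Section step_estimates.
Context (R : realType) (theta : {finite_measure set R -> \bar R}) (h : R) (k : R * R * R -> R).
Implicit Types (u v : {finite_measure set R -> \bar R}) (f : R -> R).
Variable b : R.
Hypotheses (h0 : 0 <= h) (mk : measurable_fun setT k) (k0 : forall p, 0 <= k p)
  (kb : forall p, k p <= b).
Local Notation rate := (rate theta k).
Local Notation gain := (gain theta k).
Local Notation markov := (markov theta h k).
Local Notation is_step := (is_step theta h k).

(** The [f x * rate] terms cancel, so a pointwise bound on the gain of [f] in
one jump is a bound on the increment over one step. *)
Lemma markov_drift v f (c : R * R -> R) x : measurable_fun setT f ->
  measurable_fun setT c -> (forall x, 0 <= f x) -> (forall q, 0 <= c q) ->
  (forall q, f (x - q.2) * k (x, q.1, q.2) + f (x + q.2) * k (q.1, x, q.2) <=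
    f x * (k (x, q.1, q.2) + k (q.1, x, q.2)) + c q) ->
  (markov v f x <= (f x)%:E + h%:E * \int[fprod v theta]_q (c q)%:E)%E.
Proof.
move=> mf mc f0 c0 fc; rewrite /markov.
have : (gain v f x <= (f x * rate v x)%:E + \int[fprod v theta]_q (c q)%:E)%E.
  rewrite EFinM -(rate_EFin theta mk k0 kb) -ge0_integralZl//; last 3 first.
  - by mea.
  - by move=> q _; rewrite lee_fin addr_ge0.
  - by rewrite lee_fin.
  rewrite -ge0_integralD//; last 4 first.
  - by move=> q _; rewrite -EFinM lee_fin mulr_ge0// addr_ge0.
  - by apply: emeasurable_funM; mea.
  - by move=> q _; rewrite lee_fin.
  - by mea.
  apply: ge0_le_integral => //.
  - by move=> q _; rewrite lee_fin addr_ge0// mulr_ge0.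
  - by mea.
  - by apply: emeasurable_funD; [apply: emeasurable_funM|]; mea.
  - by move=> q _; rewrite -EFinM -EFinD lee_fin.
set C := (\int[_]_q _)%E => gC.
have C0 : (0 <= C)%E by apply: integral_ge0 => q _; rewrite lee_fin.
apply: (@le_trans _ _ ((f x * (1 - h * rate v x))%:E + h%:E * ((f x * rate v x)%:E + C))%E).
  by rewrite leeD2l// lee_wpmul2l.
rewrite ge0_muleDr//; last by rewrite lee_fin mulr_ge0// rate_ge0.
rewrite addeA -EFinM -EFinD le_eqVlt; apply/orP; left; apply/eqP.
by congr (_%:E + _)%E; ring.
Qed.

Lemma markov_one v x : markov v (cst 1) x = 1%:E.
Proof.
rewrite /markov /gain /= (_ : (\int[_]_q _)%E = (rate v x)%:E); last first.
  by rewrite -(rate_EFin theta mk k0 kb); apply: eq_integral => q _ /=; rewrite !mul1r.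
by rewrite -EFinM -EFinD; congr EFin; ring.
Qed.

Lemma step_mass u v u' : is_step u v u' -> mass u' = mass u.
Proof.
move=> /(_ (cst 1) (measurable_cst _) (fun _ => ler01)).
rewrite (eq_integral (cst 1%E) (markov v (cst 1))); last by move=> x _; rewrite markov_one.
have A (m : {finite_measure set R -> \bar R}) : fine (\int[m]_x (cst 1 x)%:E)%E = mass m.
  by rewrite -[LHS]/(\int[m]_x (1 : R)) Rintegral_cstT mul1r.
by move=> /(congr1 fine); rewrite (A u') (A u).
Qed.

(** One step is linear and positive in the measure that is moved. *)
Lemma step_le u1 u2 v u1' u2' : (forall x, h * rate v x <= 1) ->
  is_step u1 v u1' -> is_step u2 v u2' ->
  (forall A, measurable A -> (u1 A <= u2 A)%E) ->
  forall A, measurable A -> (u1' A <= u2' A)%E.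
Proof.
move=> hr s1 s2 u12 A mA.
have mI : measurable_fun setT (\1_A : R -> R) by exact: measurable_indic.
have I0 x : 0 <= (\1_A : R -> R) x by rewrite indicE.
have E (m : {finite_measure set R -> \bar R}) : (m A = \int[m]_x (\1_A x)%:E)%E.
  by rewrite integral_indic// setIT.
rewrite !E s1// s2//; apply: ge0_le_measure_integral => //.
- by move=> x; apply: markov_ge0.
- exact: measurable_markov mI I0.
Qed.

(** The integrated form of [markov_drift]. The pointwise bound is asked on a
set [D] that carries [u]: in the cut scheme it holds on the ball only. *)
Lemma step_drift u v u' (D : set R) f (c : R * (R * R) -> R) :
  is_step u v u' -> (forall x, h * rate v x <= 1) ->
  measurable D -> u (~` D) = 0%E -> measurable_fun setT f ->
  measurable_fun setT c -> (forall x, 0 <= f x) -> (forall q, 0 <= c q) ->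
  (forall x q, D x -> f (x - q.2) * k (x, q.1, q.2) + f (x + q.2) * k (q.1, x, q.2) <=
    f x * (k (x, q.1, q.2) + k (q.1, x, q.2)) + c (x, q)) ->
  (\int[u']_x (f x)%:E <= \int[u]_x (f x)%:E +
     h%:E * \int[u]_x \int[fprod v theta]_q (c (x, q))%:E)%E.
Proof.
move=> s hr mD uD mf mc f0 c0 fc; rewrite s//.
pose C x := (\int[fprod v theta]_q (c (x, q))%:E)%E.
have mC : measurable_fun setT C.
  apply: (@measurable_fun_fubini_tonelli_F _ _ _ _ _ _ (EFin \o c)); first by mea.
  by move=> p; rewrite lee_fin.
have C0 x : (0 <= C x)%E by apply: integral_ge0 => q _; rewrite lee_fin.
have <- : (\int[u]_x (h%:E * C x) = h%:E * \int[u]_x C x)%E by rewrite ge0_integralZl.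
rewrite -ge0_integralD//; last 4 first.
- by move=> x _; rewrite lee_fin.
- by mea.
- by move=> x _; rewrite mule_ge0.
- by apply: emeasurable_funM; mea.
apply: ae_ge0_le_integral => //.
- by move=> x _; exact: markov_ge0.
- exact: measurable_markov.
- by move=> x _; rewrite adde_ge0// ?lee_fin// mule_ge0.
- by apply: emeasurable_funD; [mea|apply: emeasurable_funM; mea].
exists (~` D); split => //; first exact: measurableC.
move=> x /= nx Dx; apply: nx => _; apply: markov_drift => //.
- by mea.
- by move=> q; exact: fc.
Qed.

End step_estimates.

Lemma integral_cst_mass d (T : measurableType d) (R : realType)
    (m : {finite_measure set T -> \bar R}) (c : R) :
  (\int[m]_x c%:E = (c * mass m)%:E)%E.
Proof. by rewrite -Rintegral_cstT (bdd_EFin_Rintegral _ (bdd_cst T c)). Qed.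

Lemma ge0_integral_EFinD d (T : measurableType d) (R : realType)
    (m : {measure set T -> \bar R}) (F G : T -> R) :
  measurable_fun setT F -> measurable_fun setT G ->
  (forall x, 0 <= F x) -> (forall x, 0 <= G x) ->
  (\int[m]_x (F x + G x)%:E = \int[m]_x (F x)%:E + \int[m]_x (G x)%:E)%E.
Proof.
move=> mF mG F0 G0; under eq_integral do rewrite EFinD.
apply: ge0_integralD => //; first by move=> x _; rewrite lee_fin.
- by mea.
- by move=> x _; rewrite lee_fin.
- by mea.
Qed.

Lemma ge0_integral_EFinZ d (T : measurableType d) (R : realType)
    (m : {measure set T -> \bar R}) (c : R) (F : T -> R) :
  measurable_fun setT F -> (forall x, 0 <= F x) -> 0 <= c ->
  (\int[m]_x (c * F x)%:E = c%:E * \int[m]_x (F x)%:E)%E.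
Proof.
move=> mF F0 c0; under eq_integral do rewrite EFinM.
apply: ge0_integralZl => //; first by mea.
by move=> x _; rewrite lee_fin.
Qed.

Lemma ge0_le_integral_EFin d (T : measurableType d) (R : realType)
    (m : {measure set T -> \bar R}) (F G : T -> R) :
  measurable_fun setT F -> measurable_fun setT G ->
  (forall x, 0 <= F x) -> (forall x, F x <= G x) ->
  (\int[m]_x (F x)%:E <= \int[m]_x (G x)%:E)%E.
Proof.
move=> mF mG F0 FG; apply: ge0_le_integral => //.
- by move=> x _; rewrite lee_fin.
- by mea.
- by mea.
- by move=> x _; rewrite lee_fin.
Qed.

Lemma ge0_integral_fprodM d1 d2 (T1 : measurableType d1) (T2 : measurableType d2)
    (R : realType) (a : {finite_measure set T1 -> \bar R})
    (b : {finite_measure set T2 -> \bar R}) (F : T1 -> R) (G : T2 -> R) :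
  measurable_fun setT F -> measurable_fun setT G ->
  (forall x, 0 <= F x) -> (forall y, 0 <= G y) ->
  (\int[fprod a b]_q (F q.1 * G q.2)%:E =
   \int[a]_x (F x)%:E * \int[b]_y (G y)%:E)%E.
Proof.
move=> mF mG F0 G0; rewrite tonelli2; last 2 first.
- by mea.
- by move=> q; rewrite lee_fin mulr_ge0.
rewrite -ge0_integralZr//; last 3 first.
- by mea.
- by move=> x _; rewrite lee_fin.
- by apply: integral_ge0 => y _; rewrite lee_fin.
by apply: eq_integral => x _; rewrite -ge0_integral_EFinZ.
Qed.

Section step_bounded.
Context (R : realType) (theta : {finite_measure set R -> \bar R}) (h : R) (k : R * R * R -> R).
Implicit Types (u v : {finite_measure set R -> \bar R}) (f : R -> R).
Variable b : R.
Hypotheses (h0 : 0 <= h) (mk : measurable_fun setT k) (k0 : forall p, 0 <= k p)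
  (kb : forall p, k p <= b).
Local Notation rate := (rate theta k).
Local Notation gain := (gain theta k).
Local Notation markov := (markov theta h k).
Local Notation is_step := (is_step theta h k).

(** The change of [f] caused at a cluster of size [p.1] by a partner of size
[p.2.1]: giving away [p.2.2], and receiving [p.2.2]. *)
Definition jump f (p : R * (R * R)) :=
  (f (p.1 - p.2.2) - f p.1) * k (p.1, p.2.1, p.2.2) +
  (f (p.1 + p.2.2) - f p.1) * k (p.2.1, p.1, p.2.2).

Lemma bdd_jump M f : bdd M f -> bdd (4 * M * b) (jump f).
Proof.
move=> bf; have [mf fM] := bf; have M0 := bdd_ge0 bf.
split; first by rewrite /jump; mea.
move=> p; rewrite (le_trans (ler_normD _ _))//.
have -> : 4 * M * b = (M + M) * b + (M + M) * b by ring.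
by apply: lerD; rewrite normrM (ger0_norm (k0 _)) ler_pM//;
  rewrite (le_trans (ler_normB _ _))// lerD.
Qed.

(** For bounded [f] the linear and the gain terms are separately integrable,
so the increment over one step is an exact integral of [jump]. *)
Lemma step_bdd M f u v u' : bdd M f -> is_step u v u' ->
  \int[u']_x f x = \int[u]_x f x + h * \int[fprod u (fprod v theta)]_p jump f p.
Proof.
move=> bf s; have [mf fM] := bf; have M0 := bdd_ge0 bf.
have bc := bdd_cst R M; rewrite ger0_norm// in bc.
have bfM := bddD bf bc.
have fM0 x : 0 <= f x + M by rewrite -lerBlDr sub0r; have := fM x; rewrite ler_norml => /andP[].
have bj := bdd_jump bf.
have bj1 x : bdd (4 * M * b) (fun q => jump f (x, q)) by exact: bdd_section1.
have bR x : bdd (b + b) (fun q : R * R => k (x, q.1, q.2) + k (q.1, x, q.2)).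
  by apply: bddD; split=> [|q]; rewrite ?ger0_norm//; mea.
have bfk x : bdd ((M + M) * (b + b)) (fun q : R * R => (f x + M) * (k (x, q.1, q.2) + k (q.1, x, q.2))).
  have bb : bdd (M + M) (fun _ : R * R => f x + M).
    by split; [mea|move=> _; case: bfM].
  exact: bddM bb (bR x).
have mE x : markov v (fun x => f x + M) x =
    (f x + M + h * \int[fprod v theta]_q jump f (x, q))%:E.
  rewrite /markov.
  have -> : gain v (fun x => f x + M) x =
    ((f x + M) * rate v x + \int[fprod v theta]_q jump f (x, q))%:E.
    rewrite /rate -RintegralZl//; last exact: bdd_integrable (bR x).
    rewrite -RintegralD//; last 2 first.
    - exact: bdd_integrable (bfk x).
    - exact: bdd_integrable (bj1 x).
    rewrite (bdd_EFin_Rintegral _ (bddD (bfk x) (bj1 x))).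
    by apply: eq_integral => q _; congr EFin; rewrite /jump/=; ring.
  by rewrite -EFinM -EFinD; congr EFin; ring.
have := s _ bfM.1 fM0.
under [RHS]eq_integral do rewrite mE.
have bJ : bdd (4 * M * b * mass (fprod v theta))
   (fun x => \int[fprod v theta]_q jump f (x, q)) by exact: bdd_partial1.
have bhJ := bddM (bdd_cst R h) bJ.
move=> /(congr1 fine); rewrite -[LHS]/(\int[u']_x (f x + M)).
rewrite -[RHS]/(\int[u]_x (f x + M + h * \int[fprod v theta]_q jump f (x, q))).
rewrite RintegralD//; [|exact: bdd_integrable bf|exact: bdd_integrable bc].
rewrite RintegralD//; [|exact: bdd_integrable bfM|exact: bdd_integrable bhJ].
rewrite RintegralD//; [|exact: bdd_integrable bf|exact: bdd_integrable bc].
rewrite RintegralZl//; last exact: bdd_integrable bJ.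
rewrite !Rintegral_cstT (step_mass mk k0 kb s) (bdd_fubini1 _ _ bj).
by move=> ?; lra.
Qed.

Hypothesis k_supp : forall p, k p != 0 -> [/\ 0 < p.2, p.2 < p.1.1 & 0 < p.1.2].

Definition weight (x : R) : R := 1 + `|x|.

Lemma weight_ge1 x : 1 <= weight x. Proof. by rewrite lerDl. Qed.

Lemma weight_ge0 x : 0 <= weight x. Proof. exact: le_trans (weight_ge1 x). Qed.

Lemma measurable_weight : measurable_fun setT weight.
Proof. by rewrite /weight; mea. Qed.

(** Giving [z] lowers the weight by [z] and receiving [z] raises it by [z].
The loss is written on the left since only nonnegative integrals may be added
freely. *)
Lemma markov_weight v x :
  (markov v weight x + h%:E * \int[fprod v theta]_q (`|q.2| * k (x, q.1, q.2))%:E =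
   (weight x)%:E + h%:E * \int[fprod v theta]_q (`|q.2| * k (q.1, x, q.2))%:E)%E.
Proof.
have m1 : measurable_fun setT (fun q : R * R => k (x, q.1, q.2)) by mea.
have m2 : measurable_fun setT (fun q : R * R => k (q.1, x, q.2)) by mea.
have mz : measurable_fun setT (fun q : R * R => `|q.2|) by mea.
have z0 (q : R * R) : (0 <= `|q.2|%:E)%E by rewrite lee_fin.
have mm : measurable_fun setT (fun q : R * R => weight (x - q.2)) by have := measurable_weight => mW; mea.
have mp : measurable_fun setT (fun q : R * R => weight (x + q.2)) by have := measurable_weight => mW; mea.
have pt (q : R * R) : weight (x - q.2) * k (x, q.1, q.2) + weight (x + q.2) * k (q.1, x, q.2) +
    `|q.2| * k (x, q.1, q.2) =
    weight x * (k (x, q.1, q.2) + k (q.1, x, q.2)) + `|q.2| * k (q.1, x, q.2).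
  rewrite /weight.
  have [-> |/k_supp/= [q2 xq q1]] := eqVneq (k (x, q.1, q.2)) 0;
  have [-> |/k_supp/= [q2' q1x x0]] := eqVneq (k (q.1, x, q.2)) 0.
  - ring.
  - by rewrite (ger0_norm (ltW x0)) (ger0_norm (ltW q2')) (@ger0_norm _ (x + q.2)); [ring|lra].
  - by rewrite (ger0_norm (ltW q2)) (@ger0_norm _ x) ?(@ger0_norm _ (x - q.2)); [ring|lra|lra].
  - by rewrite (ger0_norm (ltW q2)) (@ger0_norm _ x) ?(@ger0_norm _ (x - q.2)) ?(@ger0_norm _ (x + q.2)); [ring|lra|lra|lra].
have gE : (gain v weight x + \int[fprod v theta]_q (`|q.2| * k (x, q.1, q.2))%:E = (weight x * rate v x)%:E + \int[fprod v theta]_q (`|q.2| * k (q.1, x, q.2))%:E)%E.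
  rewrite EFinM -(rate_EFin theta mk k0 kb) -ge0_integral_EFinZ ?weight_ge0//; last 2 first.
  - by mea.
  - by move=> q; rewrite addr_ge0.
  rewrite /gain -ge0_integral_EFinD; last 4 first.
  - by apply: measurable_funD; apply: measurable_funM.
  - exact: measurable_funM.
  - by move=> q; rewrite addr_ge0// mulr_ge0// weight_ge0.
  - by move=> q; rewrite mulr_ge0.
  rewrite -ge0_integral_EFinD; last 4 first.
  - by apply: measurable_funM => //; exact: measurable_funD.
  - exact: measurable_funM.
  - by move=> q; rewrite mulr_ge0 ?weight_ge0// addr_ge0.
  - by move=> q; rewrite mulr_ge0.
  by apply: eq_integral => q _; rewrite pt.
rewrite /markov -addeA -ge0_muleDr; last 2 first.
- exact: (gain_ge0 theta k0 v x weight_ge0).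
- by apply: integral_ge0 => q _; rewrite lee_fin mulr_ge0.
rewrite gE ge0_muleDr; last 2 first.
- by rewrite lee_fin mulr_ge0 ?weight_ge0// (rate_ge0 theta k0).
- by apply: integral_ge0 => q _; rewrite lee_fin mulr_ge0.
by rewrite addeA -EFinM -EFinD; congr (_%:E + _)%E; ring.
Qed.

Lemma fprod_z_le v x (T1 : R) : (\int[theta]_z `|z|%:E <= T1%:E)%E ->
  (\int[fprod v theta]_q (`|q.2| * k (x, q.1, q.2))%:E <= (b * mass v * T1)%:E)%E.
Proof.
move=> T1E; have b0 : 0 <= b by apply: le_trans (kb (0,0,0)).
apply: (@le_trans _ _ (\int[fprod v theta]_q (b * `|q.2|)%:E)%E).
  apply: ge0_le_integral_EFin.
  - by mea.
  - by mea.
  - by move=> q; rewrite mulr_ge0.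
  - by move=> q; rewrite mulrC ler_wpM2r.
rewrite (@ge0_integral_fprodM _ _ _ _ _ v theta (fun=> b) (fun z => `|z|));
  [|by mea|by mea|by []|by []].
rewrite integral_cst_mass [leRHS]EFinM; apply: lee_wpmul2l => //.
by rewrite lee_fin mulr_ge0 ?mass_ge0.
Qed.

(** Conservation of number and mass: the two first-order terms of
[markov_weight] have equal integrals, since each becomes the other when the two
clusters are exchanged. This uses that the population drives itself. *)
Lemma step_moment v v' (T1 : R) : is_step v v v' -> (forall x, h * rate v x <= 1) ->
  (\int[theta]_z `|z|%:E <= T1%:E)%E ->
  (\int[v']_x (weight x)%:E = \int[v]_x (weight x)%:E)%E.
Proof.
move=> s hr T1E.
rewrite (s _ measurable_weight weight_ge0).
pose Z1 x := (\int[fprod v theta]_q (`|q.2| * k (x, q.1, q.2))%:E)%E.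
pose Z2 x := (\int[fprod v theta]_q (`|q.2| * k (q.1, x, q.2))%:E)%E.
have Z10 x : (0 <= Z1 x)%E by apply: integral_ge0 => q _; rewrite lee_fin mulr_ge0.
have Z20 x : (0 <= Z2 x)%E by apply: integral_ge0 => q _; rewrite lee_fin mulr_ge0.
have mZ1 : measurable_fun setT Z1.
  apply: (@measurable_fun_fubini_tonelli_F _ _ _ _ _ (fprod v theta) (fun p : R * (R * R) => (`|p.2.2| * k (p.1, p.2.1, p.2.2))%:E)%E).
    by mea.
  by move=> p; rewrite lee_fin mulr_ge0.
have mZ2 : measurable_fun setT Z2.
  apply: (@measurable_fun_fubini_tonelli_F _ _ _ _ _ (fprod v theta) (fun p : R * (R * R) => (`|p.2.2| * k (p.2.1, p.1, p.2.2))%:E)%E).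
    by mea.
  by move=> p; rewrite lee_fin mulr_ge0.
have Z12 : (\int[v]_x Z1 x = \int[v]_x Z2 x)%E.
  apply: (@fprod_swap _ _ _ _ _ _ _ v v theta (fun p : R * R * R => (`|p.2| * k p)%:E)).
    by mea.
  by move=> p; rewrite lee_fin mulr_ge0.
have mW := measurable_weight.
have mg : measurable_fun setT (markov v weight).
  exact: (measurable_markov theta h mk k0 v mW weight_ge0).
have mg0 x : (0 <= markov v weight x)%E by exact: (markov_ge0 h0 k0 (hr x) weight_ge0).
have E x : (markov v weight x + h%:E * Z1 x = (weight x)%:E + h%:E * Z2 x)%E.
  exact: markov_weight.
have b0 : 0 <= b by apply: le_trans (kb (0,0,0)).
have Zb x : (Z1 x <= (b * mass v * T1)%:E)%E by exact: fprod_z_le.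
have Zfin : (\int[v]_x Z1 x)%E \is a fin_num.
  rewrite ge0_fin_numE; last exact: integral_ge0.
  apply: (@le_lt_trans _ _ (\int[v]_x (b * mass v * T1)%:E)%E); last first.
    by rewrite integral_cst_mass ltry.
  by apply: ge0_le_integral.
have Eint : (\int[v]_x markov v weight x + h%:E * \int[v]_x Z1 x =
    \int[v]_x (weight x)%:E + h%:E * \int[v]_x Z2 x)%E.
  rewrite -!ge0_integralZl; [|by []..].
  rewrite -ge0_integralD; [|by []| | | |]; last 4 first.
  - by move=> x _; exact: mg0.
  - by [].
  - by move=> x _; rewrite mule_ge0.
  - by apply: emeasurable_funM; [mea|].
  rewrite -ge0_integralD; [|by []| | | |]; last 4 first.
  - by move=> x _; rewrite lee_fin weight_ge0.
  - by mea.
  - by move=> x _; rewrite mule_ge0.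
  - by apply: emeasurable_funM; [mea|].
  by apply: eq_integral => x _; exact: E.
move: Eint; rewrite Z12 in Zfin *; move/(congr1 (fun y => y - h%:E * \int[v]_x Z2 x)%E).
by rewrite !addeK// fin_numM.
Qed.
End step_bounded.

(** * Estimates for a kernel dominated by a product *)

Lemma ge0_integral3M (R : realType) (u v w : {finite_measure set R -> \bar R})
    (F G H : R -> R) :
  measurable_fun setT F -> measurable_fun setT G -> measurable_fun setT H ->
  (forall x, 0 <= F x) -> (forall x, 0 <= G x) -> (forall x, 0 <= H x) ->
  (\int[u]_x \int[fprod v w]_q (F x * (G q.1 * H q.2))%:E =
   \int[u]_x (F x)%:E * (\int[v]_y (G y)%:E * \int[w]_z (H z)%:E))%E.
Proof.
move=> mF mG mH F0 G0 H0.
rewrite -ge0_integral_fprodM// -ge0_integralZr//; last 3 first.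
- by mea.
- by move=> x _; rewrite lee_fin.
- by apply: integral_ge0 => q _; rewrite lee_fin mulr_ge0.
apply: eq_integral => x _; rewrite ge0_integral_EFinZ//; first by mea.
by move=> q; rewrite mulr_ge0.
Qed.

(** Lipschitz, so that one jump can raise it only by a bounded
multiple of the jump size; its integral measures the tail of the first
moment. *)
Definition excess (R : realType) (r x : R) : R := Num.max 0 (`|x| - r).

Definition far (R : realType) (r x : R) : R := if r <= `|x| then 1 else 0.

Lemma excess_ge0 (R : realType) (r x : R) : 0 <= excess r x.
Proof. by rewrite le_max lexx. Qed.

Lemma far_ge0 (R : realType) (r x : R) : 0 <= far r x.
Proof. by rewrite /far; case: ifP. Qed.

(** If [x + z] exceeds [r] then [x] or [z] exceeds [r / 2]. *)
Lemma excess_shift (R : realType) (r x z : R) : 0 <= x -> 0 <= z ->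
  excess r (x + z) <= excess r x + (far (r / 2) x + far (r / 2) z) * z.
Proof.
move=> x0 z0.
rewrite /excess /far (ger0_norm x0) (ger0_norm z0) ger0_norm ?addr_ge0//.
have h1 : 0 <= Num.max 0 (x - r) by rewrite le_max lexx.
have h2 : x - r <= Num.max 0 (x - r) by rewrite le_max lexx orbT.
have [xr|xr] := leP (r / 2) x; have [zr|zr] := leP (r / 2) z;
  by rewrite ge_max; apply/andP; split; lra.
Qed.

Lemma measurable_excess (R : realType) (r : R) : measurable_fun setT (excess r).
Proof. by rewrite /excess; mea. Qed.

Lemma measurable_far (R : realType) (r : R) : measurable_fun setT (far r).
Proof.
rewrite (_ : far r = \1_[set x : R | r <= `|x|]); last first.
  by apply/funext => x; rewrite indicE /far; case: ifPn => xr; [rewrite mem_set|rewrite memNset//; exact/negP].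
apply: measurable_indic; rewrite -[X in measurable X]setTI.
by apply: measurable_fun_ler => //; mea.
Qed.

Section kernel_estimates.
Context (R : realType) (theta : {finite_measure set R -> \bar R}) (h : R) (k : R * R * R -> R).
Implicit Types (u v : {finite_measure set R -> \bar R}) (f : R -> R).
Variable b : R.
Hypotheses (h0 : 0 <= h) (mk : measurable_fun setT k) (k0 : forall p, 0 <= k p)
  (kb : forall p, k p <= b).
Hypothesis k_supp : forall p, k p != 0 -> [/\ 0 < p.2, p.2 < p.1.1 & 0 < p.1.2].
Variables (g : R -> R) (C M Th : R).
Hypotheses (mg : measurable_fun setT g) (g0 : forall x, 0 <= g x)
  (kg : forall p, k p <= g p.1.1 * g p.1.2)
  (C0 : 0 <= C) (gC : forall x, g x <= C * weight x)
  (theta_weight : (\int[theta]_z (weight z)%:E <= Th%:E)%E).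
Local Notation rate := (rate theta k).
Local Notation is_step := (is_step theta h k).
Local Notation moment v := (\int[v]_x (weight x)%:E)%E.

Let mW := @measurable_weight R.
Let W0 := @weight_ge0 R.

Lemma moment_g v : (moment v <= M%:E)%E -> (\int[v]_x (g x)%:E <= (C * M)%:E)%E.
Proof.
move=> vM; apply: (@le_trans _ _ (\int[v]_x (C * weight x)%:E)%E).
  by apply: ge0_le_integral_EFin => //; mea.
by rewrite ge0_integral_EFinZ// EFinM lee_wpmul2l.
Qed.

Lemma mass_moment v : (moment v <= M%:E)%E -> mass v <= M.
Proof.
move=> vM; rewrite -lee_fin; apply: le_trans vM.
rewrite -[mass v]mul1r -integral_cst_mass; apply: ge0_le_integral_EFin => //; last exact: weight_ge1.
Qed.

Lemma mass_theta : mass theta <= Th.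
Proof.
rewrite -lee_fin; apply: le_trans theta_weight.
rewrite -[mass theta]mul1r -integral_cst_mass; apply: ge0_le_integral_EFin => //; last exact: weight_ge1.
Qed.

Lemma theta_abs : (\int[theta]_z `|z|%:E <= Th%:E)%E.
Proof.
apply: le_trans theta_weight; apply: ge0_le_integral_EFin => //.
  by move=> x; rewrite lerDr.
Qed.

Lemma integral_gg_le u v : (moment u <= M%:E)%E -> (moment v <= M%:E)%E ->
  (\int[fprod u (fprod v theta)]_p (g p.1 * g p.2.1)%:E <= ((C * M) ^+ 2 * Th)%:E)%E.
Proof.
move=> uM vM.
have -> : (\int[fprod u (fprod v theta)]_p (g p.1 * g p.2.1)%:E =
    \int[u]_x \int[fprod v theta]_q (g x * (g q.1 * 1))%:E)%E.
  rewrite tonelli2; last 2 first.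
  - by mea.
  - by move=> p; rewrite lee_fin mulr_ge0.
  by apply: eq_integral => x _; apply: eq_integral => q _; rewrite mulr1.
rewrite (@ge0_integral3M _ u v theta g g (fun=> 1)) ?integral_cst_mass ?mul1r//.
rewrite expr2 -mulrA EFinM; apply: lee_pmul => //.
- by apply: integral_ge0 => x _; rewrite lee_fin.
- apply: mule_ge0; [by apply: integral_ge0 => x _; rewrite lee_fin|by rewrite lee_fin mass_ge0].
- exact: moment_g.
rewrite EFinM; apply: lee_pmul => //.
- by apply: integral_ge0 => x _; rewrite lee_fin.
- by rewrite lee_fin mass_ge0.
- exact: moment_g.
- by rewrite lee_fin mass_theta.
Qed.

Lemma jump_le N f p : bdd N f -> `|jump k f p| <= 4 * N * (g p.1 * g p.2.1).
Proof.
move=> bf; have [mf fN] := bf; have N0 := bdd_ge0 bf.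
rewrite (le_trans (ler_normD _ _))//.
have -> : 4 * N * (g p.1 * g p.2.1) =
  (N + N) * (g p.1 * g p.2.1) + (N + N) * (g p.2.1 * g p.1) by ring.
by apply: lerD; rewrite normrM (ger0_norm (k0 _)) ler_pM//;
  rewrite ?(le_trans (ler_normB _ _))// ?lerD//; exact: (kg (_, _, _)).
Qed.

(** From [step_bdd], since |jump| <= 4 N g(x) g(y) and [g] has a finite
integral. *)
Lemma step_lipschitz N f u v u' : bdd N f -> is_step u v u' ->
  (moment u <= M%:E)%E -> (moment v <= M%:E)%E ->
  `|\int[u']_x f x - \int[u]_x f x| <= h * (4 * N * ((C * M) ^+ 2 * Th)).
Proof.
move=> bf s uM vM; rewrite (step_bdd mk k0 kb bf s) addrAC subrr add0r.
have N0 := bdd_ge0 bf; have bj := bdd_jump mk k0 kb bf.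
rewrite normrM (ger0_norm h0) ler_wpM2l//.
set P := fprod u _.
apply: (le_trans (le_normr_Rintegral _ _)) => //; first exact: bdd_integrable bj.
have bj' : bdd (4 * N * b) (fun p => `|jump k f p|).
  by have [mj jN] := bj; split; [mea|move=> p; rewrite normr_id].
rewrite -lee_fin (bdd_EFin_Rintegral _ bj').
apply: (@le_trans _ _ (\int[P]_p (4 * N * (g p.1 * g p.2.1))%:E)%E).
  apply: ge0_le_integral_EFin => //; first by case: bj'.
  - by mea.
  - by move=> p; exact: jump_le.
rewrite ge0_integral_EFinZ//; last 3 first.
- by mea.
- by move=> p; rewrite mulr_ge0.
- by rewrite mulr_ge0.
by rewrite [leRHS]EFinM lee_wpmul2l// ?lee_fin ?mulr_ge0//; exact: integral_gg_le.
Qed.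

(** A giver only loses excess. For a receiver [excess_shift] leaves two cases:
it is large, and then [g x <= e * weight x]; or the jump is large, and such
jumps have small first moment under [theta]. *)
Lemma step_excess r e v v' : is_step v v v' -> (forall x, h * rate v x <= 1) ->
  (moment v <= M%:E)%E -> 0 <= r -> 0 <= e ->
  (forall x, r / 2 <= `|x| -> g x <= e * weight x) ->
  (\int[theta]_z (far (r / 2) z * `|z|)%:E <= e%:E)%E ->
  (\int[v']_x (excess r x)%:E <= \int[v]_x (excess r x)%:E +
    (h * (e * (C * M ^+ 2 * (Th + C))))%:E)%E.
Proof.
move=> s hr vM r0 e0 ge ze.
pose c (p : R * (R * R)) := far (r / 2) p.1 * g p.1 * (g p.2.1 * `|p.2.2|) +
   g p.1 * (g p.2.1 * (far (r / 2) p.2.2 * `|p.2.2|)).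
have far0 := far_ge0 (r / 2).
have mf := measurable_far (r / 2).
have mc : measurable_fun setT c by rewrite /c; mea.
have me := measurable_excess r.
apply: (le_trans (@step_drift _ theta h k b h0 mk k0 kb v v v' setT (excess r) c s hr _ _ me mc _ _ _)) => //.
- by rewrite setCT measure0.
- exact: excess_ge0.
- by move=> p; rewrite /c addr_ge0// !mulr_ge0.
- move=> x q _ /=.
  have c0 : 0 <= c (x, q) by rewrite /c addr_ge0// !mulr_ge0.
  have kk : g q.1 * g x = g x * g q.1 by rewrite mulrC.
  have e1 : excess r (x - q.2) * k (x, q.1, q.2) <= excess r x * k (x, q.1, q.2).
    have [->|/k_supp/= [z0 zx y0]] := eqVneq (k (x, q.1, q.2)) 0; first by rewrite !mulr0.
    rewrite ler_wpM2r// /excess (@ger0_norm _ x) ?(@ger0_norm _ (x - q.2)); [|lra|lra].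
    by rewrite ge_max !le_max lexx/=; apply/orP; right; lra.
  have e2 : excess r (x + q.2) * k (q.1, x, q.2) <= excess r x * k (q.1, x, q.2) + c (x, q).
    have [->|kn0] := eqVneq (k (q.1, x, q.2)) 0; first by rewrite !mulr0 add0r.
    have /= [z0 zy x0] := k_supp kn0.
    have kgx : k (q.1, x, q.2) <= g x * g q.1 by rewrite -kk; exact: (kg (_, _, _)).
    apply: (@le_trans _ _ ((excess r x + (far (r / 2) x + far (r / 2) q.2) * q.2) * k (q.1, x, q.2))).
      by rewrite ler_wpM2r//; apply: excess_shift; apply: ltW.
    rewrite mulrDl lerD2l /c/= (ger0_norm (ltW z0)).
    apply: (@le_trans _ _ ((far (r / 2) x + far (r / 2) q.2) * q.2 * (g x * g q.1))).
      by rewrite ler_wpM2l// mulr_ge0 ?addr_ge0// ltW.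
    by rewrite le_eqVlt; apply/orP; left; apply/eqP; ring.
  by rewrite mulrDr -addrA lerD.
rewrite leeD2l// [leRHS]EFinM lee_wpmul2l//.
have gv := moment_g vM.
have ig : (0 <= \int[v]_x (g x)%:E)%E by apply: integral_ge0 => x _; rewrite lee_fin.
have iz : (0 <= \int[theta]_z `|z|%:E)%E by apply: integral_ge0 => x _; rewrite lee_fin.
have ifz : (0 <= \int[theta]_z (far (r / 2) z * `|z|)%:E)%E.
  by apply: integral_ge0 => x _; rewrite lee_fin mulr_ge0.
have ifg : (0 <= \int[v]_x (far (r / 2) x * g x)%:E)%E.
  by apply: integral_ge0 => x _; rewrite lee_fin mulr_ge0.
have fg : (\int[v]_x (far (r / 2) x * g x)%:E <= (e * M)%:E)%E.
  apply: (@le_trans _ _ (\int[v]_x (e * weight x)%:E)%E).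
    apply: ge0_le_integral_EFin; [by mea|by mea|by move=> x; rewrite mulr_ge0|].
    move=> x; rewrite /far; case: ifPn => [gx|_]; first by rewrite mul1r; exact: ge.
    by rewrite mul0r mulr_ge0.
  by rewrite ge0_integral_EFinZ// EFinM lee_wpmul2l.
have -> : (\int[v]_x \int[fprod v theta]_q (c (x, q))%:E =
   \int[v]_x \int[fprod v theta]_q (far (r / 2) x * g x * (g q.1 * `|q.2|))%:E +
   \int[v]_x \int[fprod v theta]_q (g x * (g q.1 * (far (r / 2) q.2 * `|q.2|)))%:E)%E.
  pose c1 (p : R * (R * R)) := far (r / 2) p.1 * g p.1 * (g p.2.1 * `|p.2.2|).
  pose c2 (p : R * (R * R)) := g p.1 * (g p.2.1 * (far (r / 2) p.2.2 * `|p.2.2|)).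
  have mc1 : measurable_fun setT c1 by rewrite /c1; mea.
  have mc2 : measurable_fun setT c2 by rewrite /c2; mea.
  have c10 p : 0 <= c1 p by rewrite !mulr_ge0.
  have c20 p : 0 <= c2 p by rewrite !mulr_ge0.
  transitivity (\int[fprod v (fprod v theta)]_p (c1 p + c2 p)%:E)%E.
    by rewrite tonelli2//; [mea|move=> p; rewrite lee_fin addr_ge0].
  rewrite ge0_integral_EFinD//; congr (_ + _)%E.
    by rewrite tonelli2//; mea.
  by rewrite tonelli2//; mea.
rewrite (@ge0_integral3M _ v v theta (fun x => far (r / 2) x * g x) g (fun z => `|z|));
  [|by mea|by []|by mea|by move=> x; rewrite mulr_ge0|by []|by []].
rewrite (@ge0_integral3M _ v v theta g g (fun z => far (r / 2) z * `|z|));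
  [|by []|by []|by mea|by []|by []|by move=> x; rewrite mulr_ge0].
apply: (@le_trans _ _ ((e * M)%:E * ((C * M)%:E * Th%:E) + (C * M)%:E * ((C * M)%:E * e%:E))%E).
  apply: leeD; apply: lee_pmul => //; try exact: mule_ge0.
    by apply: lee_pmul => //; exact: theta_abs.
  exact: lee_pmul.
by rewrite -!EFinM -EFinD lee_fin le_eqVlt; apply/orP; left; apply/eqP; ring.
Qed.

End kernel_estimates.

(** * Absolute continuity by cutting large clusters *)

(** Quantitative absolute continuity with respect to Lebesgue measure. The
modulus [d] is the same along the whole scheme, only [e] evolves. *)
Definition uac (R : realType) (u : set R -> \bar R) (d e : R) :=
  forall E : set R, measurable E -> (@lebesgue_measure R E <= d%:E)%E -> (u E <= e%:E)%E.

Definition ball0 (R : realType) (r : R) : set R := [set x | `|x| <= r].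

Lemma measurable_ball0 (R : realType) (r : R) : measurable (ball0 r).
Proof.
rewrite /ball0 -[X in measurable X]setTI.
by apply: measurable_fun_ler => //; mea.
Qed.

Lemma restrict_measure d (T : measurableType d) (R : realType)
    (u : {finite_measure set T -> \bar R}) (D : set T) : measurable D ->
  exists m : {finite_measure set T -> \bar R},
    (forall A, measurable A -> m A = u (A `&` D)) /\
    forall f, measurable_fun setT f -> (forall x, 0 <= f x)%E ->
      (\int[m]_x f x = \int[u]_x (f x * (\1_D x)%:E))%E.
Proof.
move=> mD.
have [m mE] := transport_measure u (@measurable_id _ _ setT) (bdd_indic R mD)
  (fun x => ltac:(by rewrite indicE)).
exists m; split => // A mA.
have mI : measurable_fun setT (fun x => (\1_A x)%:E : \bar R).
  by apply/measurable_EFinP; exact: measurable_indic.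
have EE (w : {finite_measure set T -> \bar R}) B : measurable B -> (w B = \int[w]_x (\1_B x)%:E)%E.
  by move=> mB; rewrite integral_indic// setIT.
rewrite EE// mE//.
rewrite EE; last exact: measurableI.
by apply: eq_integral => x _; rewrite -EFinM indicI.
Qed.

(** Mass outside the ball carries at least [1 + r] times as much moment. The
sum on the left is the quantity that stays bounded along the cut scheme. *)
Lemma restricted_moment (R : realType) (u2 w : {finite_measure set R -> \bar R}) (r : R) :
  0 <= r -> (forall f, measurable_fun setT f -> (forall x, 0 <= f x)%E ->
      (\int[w]_x f x = \int[u2]_x (f x * (\1_(ball0 r) x)%:E))%E) ->
  (\int[w]_x (weight x)%:E + ((1 + r) * fine (u2 (~` ball0 r)))%:E <=
   \int[u2]_x (weight x)%:E)%E.
Proof.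
move=> r0 wint.
have mW := @measurable_weight R.
have W0 := @weight_ge0 R.
have mD := measurable_ball0 r.
have mDc : measurable (~` ball0 r) by exact: measurableC.
rewrite wint//; last by mea.
rewrite EFinM fineK ?fin_num_measure//.
have -> : (u2 (~` ball0 r) = \int[u2]_x (\1_(~` ball0 r) x)%:E)%E.
  by rewrite integral_indic// setIT.
have mI : measurable_fun setT (\1_(ball0 r) : R -> R) by exact: measurable_indic.
have mIc : measurable_fun setT (\1_(~` ball0 r) : R -> R) by exact: measurable_indic.
rewrite -ge0_integral_EFinZ; last 3 first.
- exact: mIc.
- by move=> x; rewrite indicE.
- by rewrite addr_ge0.
rewrite [X in (X + _)%E](eq_integral (fun x : R => (weight x * \1_(ball0 r) x)%:E)); last first.
  by move=> x _; rewrite EFinM.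
rewrite -ge0_integral_EFinD; last 4 first.
- by mea.
- by mea.
- by move=> x; rewrite mulr_ge0// indicE.
- by move=> x; rewrite mulr_ge0 ?addr_ge0// indicE.
apply: ge0_le_integral_EFin; [by mea|by mea| |].
- by move=> x; rewrite addr_ge0// mulr_ge0 ?addr_ge0// indicE.
- move=> x; rewrite !indicE in_setC; case: (boolP (x \in ball0 r)) => /=.
    by rewrite mulr1 mulr0 addr0.
  rewrite notin_setE /ball0/= => /negP; rewrite -ltNge => xr.
  by rewrite mulr0 mulr1 add0r lerD2l ltW.
Qed.

Section cut.
Context (R : realType) (theta : {finite_measure set R -> \bar R}) (h : R) (k : R * R * R -> R).
Implicit Types (u v : {finite_measure set R -> \bar R}) (f : R -> R).
Variable b : R.
Hypotheses (h0 : 0 <= h) (mk : measurable_fun setT k) (k0 : forall p, 0 <= k p)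
  (kb : forall p, k p <= b).
Hypothesis k_supp : forall p, k p != 0 -> [/\ 0 < p.2, p.2 < p.1.1 & 0 < p.1.2].
Variables (g : R -> R) (C M Th : R).
Hypotheses (mg : measurable_fun setT g) (g0 : forall x, 0 <= g x)
  (kg : forall p, k p <= g p.1.1 * g p.1.2)
  (C0 : 0 <= C) (gC : forall x, g x <= C * weight x)
  (theta_weight : (\int[theta]_z (weight z)%:E <= Th%:E)%E).
Local Notation rate := (rate theta k).
Local Notation is_step := (is_step theta h k).
Local Notation moment v := (\int[v]_x (weight x)%:E)%E.

Let mW := @measurable_weight R.
Let W0 := @weight_ge0 R.

(** The cut scheme is driven by a larger population than its own, so that its
moment is not conserved; it grows at a bounded rate. *)
Lemma step_weight u v u' : is_step u v u' -> (forall x, h * rate v x <= 1) ->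
  (moment u <= M%:E)%E -> (moment v <= M%:E)%E ->
  (moment u' <= moment u + (h * ((C * M) ^+ 2 * Th))%:E)%E.
Proof.
move=> s hr uM vM.
pose c (p : R * (R * R)) := g p.1 * (g p.2.1 * `|p.2.2|).
have mc : measurable_fun setT c by rewrite /c; mea.
apply: (le_trans (@step_drift _ theta h k b h0 mk k0 kb u v u' setT (@weight R) c s hr _ _ mW mc _ _ _)) => //.
- by rewrite setCT measure0.
- by move=> p; rewrite /c !mulr_ge0.
- move=> x q _ /=.
  have c0 : 0 <= c (x, q) by rewrite /c !mulr_ge0.
  have kk : g q.1 * g x = g x * g q.1 by rewrite mulrC.
  have e1 : weight (x - q.2) * k (x, q.1, q.2) <= weight x * k (x, q.1, q.2).
    have [->|/k_supp/= [z0 zx y0]] := eqVneq (k (x, q.1, q.2)) 0; first by rewrite !mulr0.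
    by rewrite ler_wpM2r// /weight (@ger0_norm _ x) ?(@ger0_norm _ (x - q.2)); lra.
  have e2 : weight (x + q.2) * k (q.1, x, q.2) <= weight x * k (q.1, x, q.2) + c (x, q).
    have kgx : k (q.1, x, q.2) <= g x * g q.1 by rewrite -kk; exact: (kg (_, _, _)).
    apply: (@le_trans _ _ ((weight x + `|q.2|) * k (q.1, x, q.2))).
      by rewrite ler_wpM2r// /weight -addrA lerD2l ler_normD.
    rewrite mulrDl lerD2l /c/=.
    by rewrite mulrA [leRHS]mulrC ler_wpM2l.
  by rewrite mulrDr -addrA lerD.
rewrite leeD2l// [leRHS]EFinM lee_wpmul2l//.
rewrite (@ge0_integral3M _ u v theta g g (fun z => `|z|)); [|by []|by []|by mea|by []..].
have ig (w : {finite_measure set R -> \bar R}) : (0 <= \int[w]_x (g x)%:E)%E by apply: integral_ge0 => x _; rewrite lee_fin.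
have iz : (0 <= \int[theta]_z `|z|%:E)%E by apply: integral_ge0 => x _; rewrite lee_fin.
rewrite expr2 -mulrA [leRHS]EFinM; apply: lee_pmul => //; first exact: mule_ge0.
  exact: moment_g.
by rewrite [leRHS]EFinM; apply: lee_pmul => //; [exact: moment_g|exact: theta_abs].
Qed.

(** Twice the bound [C * (1 + r)] of [g] on the ball, times a bound of
\int g dv, times a bound of the mass of [theta]. *)
Definition cut_rate r := 2 * (C * (1 + r)) * (C * M) * Th.

(** A set [E] receives mass from its translates [E - z] and [E + z], which are
as small as [E]; on the ball the transfer rates are bounded by
[C * (1 + r) * g y]. *)
Lemma step_uac u v u' r d e : is_step u v u' -> (forall x, h * rate v x <= 1) ->
  (moment v <= M%:E)%E -> u (~` ball0 r) = 0%E -> 0 <= r -> 0 <= e ->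
  uac u d e -> uac u' d (e * (1 + h * cut_rate r)).
Proof.
move=> s hr vM uD r0 e0 ue E mE Ed.
have mI : measurable_fun setT (\1_E : R -> R) by exact: measurable_indic.
have I0 x : 0 <= (\1_E : R -> R) x by rewrite indicE.
have EE (m : {finite_measure set R -> \bar R}) : (m E = \int[m]_x (\1_E x)%:E)%E.
  by rewrite integral_indic// setIT.
pose G := C * (1 + r).
have G0 : 0 <= G by rewrite mulr_ge0// addr_ge0.
pose c (p : R * (R * R)) : R := (\1_E (p.1 - p.2.2) + \1_E (p.1 + p.2.2)) * (G * g p.2.1).
have mc : measurable_fun setT c by rewrite /c; mea.
have c0 p : 0 <= c p by rewrite /c !mulr_ge0// addr_ge0.
rewrite EE.
apply: (le_trans (@step_drift _ theta h k b h0 mk k0 kb u v u' (ball0 r) (\1_E) c s hr _ uD mI mc I0 c0 _)) => //.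
- exact: measurable_ball0.
- move=> x q xr.
  have gx : g x <= G by rewrite (le_trans (gC x))// ler_wpM2l// lerD2l.
  have k1 : k (x, q.1, q.2) <= G * g q.1.
    by rewrite (le_trans (kg (_, _, _)))//= ler_wpM2r.
  have k2 : k (q.1, x, q.2) <= G * g q.1.
    by rewrite (le_trans (kg (_, _, _)))//= mulrC ler_wpM2r.
  apply: (@le_trans _ _ (c (x, q))); last by rewrite lerDr mulr_ge0// addr_ge0.
  by rewrite /c mulrDl/=; apply: lerD; apply: ler_wpM2l.
rewrite mulrDr mulr1 EFinD -EE; apply: leeD; first exact: ue.
rewrite mulrCA [leRHS]EFinM; apply: lee_wpmul2l => //.
rewrite (@fubini_tonelli _ _ _ _ _ u (fprod v theta) (EFin \o c)); last 2 first.
- by mea.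
- by move=> p; rewrite lee_fin.
apply: (@le_trans _ _ (\int[fprod v theta]_q ((2 * e * G) * g q.1 * 1)%:E)%E).
  apply: ge0_le_integral => //.
  - by move=> q _; apply: integral_ge0 => x _; rewrite lee_fin.
  - apply: (@measurable_fun_fubini_tonelli_G _ _ _ _ _ u (EFin \o c)); first by mea.
    by move=> p; rewrite lee_fin.
  - by mea.
  - move=> q _.
    have sh (w : R) : (\int[u]_x (\1_E (x + w))%:E <= e%:E)%E.
      have mEw : measurable ((fun x => x + w) @^-1` E).
        rewrite -[X in measurable X]setTI.
        suff : measurable_fun setT (fun x : R => x + w) by apply.
        by mea.
      rewrite (eq_integral (fun x => (\1_((fun x => x + w) @^-1` E) x)%:E)) => [|x _].
        by rewrite integral_indic// setIT; apply: ue => //; rewrite lebesgue_measure_shift.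
      by rewrite !indicE; congr (_%:R%:E); apply/idP/idP; rewrite !inE.
    rewrite (eq_integral (fun x : R => (G * g q.1 * (\1_E (x - q.2) + \1_E (x + q.2)))%:E)); last first.
      by move=> x _ /=; rewrite /c /= mulrC.
    have m1 : measurable_fun setT (fun x : R => \1_E (x - q.2) : R) by mea.
    have m2 : measurable_fun setT (fun x : R => \1_E (x + q.2) : R) by mea.
    rewrite ge0_integral_EFinZ; last 3 first.
    - exact: measurable_funD.
    - by move=> x; rewrite addr_ge0.
    - by rewrite mulr_ge0.
    rewrite mulr1 (_ : 2 * e * G * g q.1 = (G * g q.1) * (e + e)); last by ring.
    rewrite [leRHS]EFinM lee_wpmul2l//; first by rewrite lee_fin mulr_ge0.
    rewrite ge0_integral_EFinD//.
    by rewrite EFinD leeD.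
have H0 y : 0 <= 2 * e * G * g y by rewrite mulr_ge0// mulr_ge0// mulr_ge0.
rewrite (@ge0_integral_fprodM _ _ _ _ _ v theta (fun y => 2 * e * G * g y) (fun=> 1));
  [|by mea|by mea|by []|by []].
rewrite integral_cst_mass mul1r ge0_integral_EFinZ ?mulr_ge0//.
have -> : e * cut_rate r = 2 * e * G * (C * M) * Th by rewrite /cut_rate /G; ring.
rewrite [leRHS]EFinM; apply: lee_pmul => //.
- apply: mule_ge0; first by rewrite lee_fin mulr_ge0// mulr_ge0.
  by apply: integral_ge0 => x _; rewrite lee_fin.
- by rewrite lee_fin mass_ge0.
- rewrite [leRHS]EFinM lee_wpmul2l//; first by rewrite lee_fin mulr_ge0// mulr_ge0.
  exact: moment_g.
- by rewrite lee_fin; exact: mass_theta.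
by rewrite addr_ge0.
Qed.

(** One step followed by the restriction to the ball. The number [de] bounds
the mass lost so far: it is controlled through [(1 + r) * de], which together
with the moment of the cut measure grows at a bounded rate. *)
Lemma cut_step v v' r d e u de (m0 : R) :
  is_step v v v' -> (forall x, h * rate v x <= 1) ->
  (moment v <= M%:E)%E -> 0 <= r -> 0 <= e -> 0 <= de ->
  (forall A, measurable A -> (u A <= v A)%E) -> u (~` ball0 r) = 0%E -> uac u d e ->
  mass v <= mass u + de -> (moment u + ((1 + r) * de)%:E <= m0%:E)%E ->
  exists (u' : {finite_measure set R -> \bar R}) (de' : R),
  [/\ 0 <= de', forall A, measurable A -> (u' A <= v' A)%E, u' (~` ball0 r) = 0%E,
     uac u' d (e * (1 + h * cut_rate r)) & mass v' <= mass u' + de' /\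
    (moment u' + ((1 + r) * de')%:E <= (m0 + h * ((C * M) ^+ 2 * Th))%:E)%E].
Proof.
move=> s hr vM r0 e0 de0 uv uD ue vu um.
have [u2 s2] := @step_exists _ theta h k b h0 mk k0 kb u v hr.
have mD := measurable_ball0 r.
have uM : (moment u <= M%:E)%E.
  apply: le_trans vM; apply: ge0_le_measure_integral => //; by mea.
have [w [wE wint]] := restrict_measure u2 mD.
have mDc : measurable (~` ball0 r) by exact: measurableC.
exists w, (de + fine (u2 (~` ball0 r))); split.
- by rewrite addr_ge0// fine_ge0.
- move=> A mA; apply: (@le_trans _ _ (u2 A)).
    by rewrite wE//; apply: le_measure; rewrite ?inE//; exact: measurableI.
  exact: (step_le h0 mk k0 hr s2 s uv).
- by rewrite wE// setICl measure0.
- move=> A mA Ad; apply: (@le_trans _ _ (u2 A)).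
    by rewrite wE//; apply: le_measure; rewrite ?inE//; exact: measurableI.
  exact: (step_uac s2 hr vM uD r0 e0 ue).
have u2D : mass u2 = mass w + fine (u2 (~` ball0 r)).
  rewrite /mass wE// setTI -fineD ?fin_num_measure//.
  by rewrite -measureU ?setUv// ?setICr.
split.
  rewrite (step_mass mk k0 kb s); apply: (le_trans vu).
  by rewrite -(step_mass mk k0 kb s2) u2D addrAC addrA.
have h2 := step_weight s2 hr uM vM.
have h3 := restricted_moment r0 wint.
have -> : (1 + r) * (de + fine (u2 (~` ball0 r))) =
  (1 + r) * fine (u2 (~` ball0 r)) + (1 + r) * de by ring.
rewrite EFinD addeA; apply: (le_trans (leeD2r _ h3)); apply: (le_trans (leeD2r _ h2)).
by rewrite addeAC EFinD; exact: leeD2r.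
Qed.
End cut.

(** * The quadratic term and the Euler scheme *)

Section bilinear.
Context (R : realType) (theta : {finite_measure set R -> \bar R}).
Implicit Types (u v : {finite_measure set R -> \bar R}) (f : R -> R).

(** Telescoping: the first two factors are replaced one at a time, the other
two being integrated out. *)
Lemma triple_lipschitz u v (Phi : R * (R * R) -> R) (B a M Th : R) : bdd B Phi ->
  mass u <= M -> mass v <= M -> mass theta <= Th ->
  (forall N f, bdd N f -> `|\int[u]_x f x - \int[v]_x f x| <= N * a) ->
  `|\int[fprod u (fprod u theta)]_p Phi p - \int[fprod v (fprod v theta)]_p Phi p| <=
    2 * (B * (M * Th)) * a.
Proof.
move=> bPhi uM vM tT uv.
have B0 := bdd_ge0 bPhi.
have a0 : 0 <= a.
  by have := uv 1 (fun=> 0); rewrite mul1r => h; apply: le_trans (h _) => //; split; [mea|move=> x; rewrite normr0].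
have M0 : 0 <= M := le_trans (mass_ge0 u) uM.
have bF1 := bdd_partial1 u (fprod u theta) bPhi.
have bF2 := bdd_partial2 v (fprod u theta) bPhi.
have bF3 := bdd_partial1 u theta bF2.
have bF2' := bdd_partial2 v (fprod v theta) bPhi.
have E1 : `|\int[fprod u (fprod u theta)]_p Phi p - \int[fprod v (fprod u theta)]_p Phi p| <=
    B * (M * Th) * a.
  rewrite (bdd_fubini1 u _ bPhi) (bdd_fubini1 v _ bPhi).
  apply: (le_trans (uv _ _ bF1)); rewrite ler_wpM2r// ler_wpM2l// mass_fprod.
  by rewrite ler_pM ?mass_ge0.
have E2 : `|\int[fprod v (fprod u theta)]_p Phi p - \int[fprod v (fprod v theta)]_p Phi p| <=
    B * (M * Th) * a.
  rewrite (bdd_fubini2 v (fprod u theta) bPhi) (bdd_fubini2 v (fprod v theta) bPhi).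
  rewrite (bdd_fubini1 u theta bF2) (bdd_fubini1 v theta bF2).
  apply: (le_trans (uv _ _ bF3)); rewrite ler_wpM2r// -mulrA ler_wpM2l//.
  by rewrite ler_pM ?mass_ge0.
rewrite (_ : 2 * _ * a = B * (M * Th) * a + B * (M * Th) * a); last by ring.
by rewrite (le_trans _ (lerD E1 E2))// (le_trans _ (ler_normD _ _))// addrA subrK.
Qed.

Section truncation.
Variables (g : R -> R) (C M Th : R).
Hypotheses (mg : measurable_fun setT g) (g0 : forall x, 0 <= g x)
  (C0 : 0 <= C) (gC : forall x, g x <= C * weight x)
  (theta_weight : (\int[theta]_z (weight z)%:E <= Th%:E)%E).
Local Notation moment v := (\int[v]_x (weight x)%:E)%E.

(** Bounds by [g x * g y] are integrable since [g] is at most a multiple of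
the weight. *)
Lemma gg_integrable v (A : R) (J : R * (R * R) -> R) : (moment v <= M%:E)%E ->
  measurable_fun setT J -> (forall p, `|J p| <= A * (g p.1 * g p.2.1)) ->
  (fprod v (fprod v theta)).-integrable setT (EFin \o J).
Proof.
move=> vM mJ JA; apply/integrableP; split; first by mea.
apply: (@le_lt_trans _ _ (\int[fprod v (fprod v theta)]_p (`|A| * (g p.1 * g p.2.1))%:E)%E).
  apply: ge0_le_integral_EFin; [by mea|by mea|by []|].
  by move=> p; rewrite (le_trans (JA p))// ler_wpM2r ?mulr_ge0// ler_norm.
rewrite ge0_integral_EFinZ; [|by mea|by move=> p; rewrite mulr_ge0|by []].
apply: (@le_lt_trans _ _ (`|A|%:E * ((C * M) ^+ 2 * Th)%:E)%E).
  by rewrite lee_wpmul2l//; apply: integral_gg_le.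
by rewrite -EFinM ltry.
Qed.

(** Outside the ball one of the two factors [g] is at most [e] times the
weight. *)
Lemma truncation_error v r e (A : R) (J JR : R * (R * R) -> R) :
  (moment v <= M%:E)%E -> 0 <= A -> 0 <= e ->
  measurable_fun setT J -> measurable_fun setT JR ->
  (forall p, `|J p| <= A * (g p.1 * g p.2.1)) ->
  (forall p, JR p = J p * (\1_(ball0 r) p.1 * \1_(ball0 r) p.2.1)) ->
  (forall x, r <= `|x| -> g x <= e * weight x) ->
  `|\int[fprod v (fprod v theta)]_p J p - \int[fprod v (fprod v theta)]_p JR p| <=
    e * (A * (2 * (C * M ^+ 2 * Th))).
Proof.
move=> vM A0 e0 mJ mJR JA JRE ge.
pose chi (p : R * (R * R)) : R := \1_(ball0 r) p.1 * \1_(ball0 r) p.2.1.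
have chi0 p : 0 <= chi p by rewrite mulr_ge0// indicE.
have chi1 p : chi p <= 1 by rewrite /chi !indicE; do 2 case: (_ \in _); rewrite ?mulr1 ?mulr0.
have JRn p : `|JR p| = `|J p| * chi p by rewrite JRE normrM (ger0_norm (chi0 p)).
have JRA p : `|JR p| <= A * (g p.1 * g p.2.1).
  by rewrite JRn (le_trans _ (JA p))// ler_piMr.
set P := fprod v (fprod v theta).
have iJ : P.-integrable setT (EFin \o J) by exact: gg_integrable JA.
have iJR : P.-integrable setT (EFin \o JR) by exact: gg_integrable JRA.
rewrite -RintegralB//.
have iB : P.-integrable setT (EFin \o (fun p => J p - JR p)).
  rewrite (_ : _ \o _ = (fun p => (J p)%:E - (JR p)%:E)%E) //; exact: integrableB.
apply: (le_trans (le_normr_Rintegral _ _)) => //.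
pose c (p : R * (R * R)) := far r p.1 * g p.1 * (g p.2.1 * 1) + g p.1 * (far r p.2.1 * g p.2.1 * 1).
have mf := measurable_far r; have f0 := far_ge0 r.
have JB p : `|J p - JR p| <= A * c p.
  have Z : `|J p| * (1 - \1_(ball0 r) p.1 * \1_(ball0 r) p.2.1) <= A * c p.
    rewrite !indicE /c /far.
    have A1 : A * (g p.1 * g p.2.1) <= A * (g p.1 * g p.2.1 * 1) by rewrite mulr1.
    have gg : 0 <= A * (g p.1 * g p.2.1) by rewrite !mulr_ge0.
    have lem x : x \notin ball0 r -> r <= `|x|.
      by rewrite notin_setE /ball0/= => /negP; rewrite -ltNge; exact: ltW.
    case: (boolP (p.1 \in ball0 r)) => p1; case: (boolP (p.2.1 \in ball0 r)) => p2;
      rewrite /= ?(lem _ p1) ?(lem _ p2) ?mulr1 ?mulr0 ?mul1r ?mul0r ?subrr ?subr0 ?mulr0 ?mulr1.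
    - by rewrite mulr_ge0// addr_ge0// mulr_ge0//; case: ifP; rewrite ?mul1r ?mul0r.
    - by rewrite (le_trans (JA p))// ler_wpM2l// lerDr mulr_ge0//; case: ifP; rewrite ?mul1r ?mul0r.
    - by rewrite (le_trans (JA p))// ler_wpM2l// lerDl mulr_ge0//; case: ifP; rewrite ?mul1r ?mul0r.
    - by rewrite (le_trans (JA p))// ler_wpM2l// lerDl mulr_ge0.
  rewrite JRE -/(chi p) -{1}(mulr1 (J p)) -mulrBr normrM (le_trans _ Z)// ler_wpM2l// ger0_norm//.
  by rewrite subr_ge0.
have c0 p : 0 <= c p by rewrite /c addr_ge0// !mulr_ge0.
have mc : measurable_fun setT c by rewrite /c; mea.
have iA : P.-integrable setT (EFin \o (fun p => `|J p - JR p|)) by exact: integrable_norm.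
rewrite -lee_fin /Rintegral fineK; last exact: integrable_fin_num.
apply: (@le_trans _ _ (\int[P]_p (A * c p)%:E)%E).
  by apply: ge0_le_integral_EFin => //; mea.
rewrite ge0_integral_EFinZ// (_ : e * _ = A * (e * (2 * (C * M ^+ 2 * Th)))); last by ring.
rewrite EFinM lee_wpmul2l//.
have H1 : (\int[v]_x (far r x * g x)%:E <= (e * M)%:E)%E.
  apply: (@le_trans _ _ (\int[v]_x (e * weight x)%:E)%E).
    apply: ge0_le_integral_EFin.
    - by mea.
    - by have := @measurable_weight R => mW; mea.
    - by move=> x; rewrite mulr_ge0.
    - move=> x; rewrite /far; case: ifPn => [/ge|_]; first by rewrite mul1r.
      by rewrite mul0r mulr_ge0// weight_ge0.
  rewrite ge0_integral_EFinZ//; last 2 first.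
  - exact: measurable_weight.
  - exact: weight_ge0.
  by rewrite EFinM lee_wpmul2l.
have H2 := moment_g mg g0 C0 gC vM.
have H3 : ((mass theta)%:E <= Th%:E)%E by rewrite lee_fin; exact: mass_theta.
have fg0 x : 0 <= far r x * g x by rewrite mulr_ge0.
have I0 (w : R -> R) : (forall x, 0 <= w x) -> (0 <= \int[v]_x (w x)%:E)%E.
  by move=> w0; apply: integral_ge0 => x _; rewrite lee_fin.
rewrite ge0_integral_EFinD; last 4 first.
- by mea.
- by mea.
- by move=> p; rewrite !mulr_ge0.
- by move=> p; rewrite !mulr_ge0.
rewrite (_ : e * _ = e * M * (C * M * Th) + C * M * (e * M * Th)); last by ring.
rewrite EFinD; apply: leeD.
  rewrite tonelli2; [|by mea|by move=> p; rewrite lee_fin !mulr_ge0].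
  rewrite (@ge0_integral3M _ v v theta (fun x => far r x * g x) g (fun=> 1));
    [|by mea|by []|by mea|by []|by []|by []].
  rewrite integral_cst_mass mul1r [leRHS]EFinM; apply: lee_pmul => //; first exact: I0.
  - by rewrite mule_ge0 ?I0// lee_fin mass_ge0.
  - by rewrite [leRHS]EFinM; apply: lee_pmul => //; [exact: I0|rewrite lee_fin mass_ge0].
rewrite tonelli2; [|by mea|by move=> p; rewrite lee_fin !mulr_ge0].
rewrite (@ge0_integral3M _ v v theta g (fun x => far r x * g x) (fun=> 1));
  [|by []|by mea|by mea|by []|by []|by []].
rewrite integral_cst_mass mul1r [leRHS]EFinM; apply: lee_pmul => //; first exact: I0.
- by rewrite mule_ge0 ?I0// lee_fin mass_ge0.
- by rewrite [leRHS]EFinM; apply: lee_pmul => //; [exact: I0|rewrite lee_fin mass_ge0].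
Qed.
End truncation.
End bilinear.

Section euler.
Context (R : realType) (theta : {finite_measure set R -> \bar R}) (h : R) (k : R * R * R -> R).
Variable b : R.
Hypotheses (h0 : 0 <= h) (mk : measurable_fun setT k) (k0 : forall p, 0 <= k p)
  (kb : forall p, k p <= b).
Hypothesis k_supp : forall p, k p != 0 -> [/\ 0 < p.2, p.2 < p.1.1 & 0 < p.1.2].
Variables (g : R -> R) (C M Th : R).
Hypotheses (mg : measurable_fun setT g) (g0 : forall x, 0 <= g x)
  (kg : forall p, k p <= g p.1.1 * g p.1.2)
  (C0 : 0 <= C) (gC : forall x, g x <= C * weight x)
  (M0 : 0 <= M) (Th0 : 0 <= Th)
  (theta_weight : (\int[theta]_z (weight z)%:E <= Th%:E)%E).
Local Notation rate := (rate theta k).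
Local Notation is_step := (is_step theta h k).
Local Notation moment v := (\int[v]_x (weight x)%:E)%E.

Lemma euler_exists (nu0 : {finite_measure set R -> \bar R}) :
  (forall v : {finite_measure set R -> \bar R}, (moment v <= M%:E)%E -> forall x, h * rate v x <= 1) ->
  (moment nu0 <= M%:E)%E ->
  exists nu : nat -> {finite_measure set R -> \bar R},
    nu 0%N = nu0 /\
    forall j, is_step (nu j) (nu j) (nu j.+1) /\ (moment (nu j) <= M%:E)%E.
Proof.
move=> hr nuM.
pose S := {v : {finite_measure set R -> \bar R} | (moment v <= M%:E)%E}.
have /choice[F FE] : forall v : S, exists v' : S, is_step (sval v) (sval v) (sval v').
  move=> [v vM]; have [v' vv'] := @step_exists _ theta h k b h0 mk k0 kb v v (hr v vM).
  have v'M : (moment v' <= M%:E)%E.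
    by rewrite (step_moment h0 mk k0 kb k_supp vv' (hr v vM) (theta_abs theta_weight)).
  by exists (exist _ v' v'M).
exists (fun j => sval (iter j F (exist _ nu0 nuM))); split => // j; split.
  exact: FE.
by case: (iter j F _).
Qed.

Variable nu : nat -> {finite_measure set R -> \bar R}.
Hypotheses (nu_step : forall j, is_step (nu j) (nu j) (nu j.+1))
  (nuM : forall j, (moment (nu j) <= M%:E)%E)
  (hr : forall j x, h * rate (nu j) x <= 1).

Definition speed := 4 * ((C * M) ^+ 2 * Th).

Lemma speed_ge0 : 0 <= speed.
Proof. by rewrite /speed mulr_ge0// mulr_ge0// sqr_ge0. Qed.

Lemma euler_lipschitz N f i j : bdd N f ->
  `|\int[nu (i + j)%N]_x f x - \int[nu i]_x f x| <= N * (j%:R * h * speed).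
Proof.
move=> bf; elim: j => [|j IH]; first by rewrite addn0 subrr normr0 !mul0r mulr0.
rewrite addnS.
have s := step_lipschitz h0 mk k0 kb mg g0 kg C0 gC theta_weight bf
  (nu_step (i + j)) (nuM _) (nuM _).
rewrite (_ : N * _ = h * (4 * N * ((C * M) ^+ 2 * Th)) + N * (j%:R * h * speed)); last first.
  by rewrite /speed -natr1; ring.
rewrite (le_trans _ (lerD s IH))// (le_trans _ (ler_normD _ _))//.
by rewrite addrA subrK.
Qed.

Lemma euler_excess r e j : 0 <= r -> 0 <= e ->
  (forall x, r / 2 <= `|x| -> g x <= e * weight x) ->
  (\int[theta]_z (far (r / 2) z * `|z|)%:E <= e%:E)%E ->
  (\int[nu j]_x (excess r x)%:E <= \int[nu 0%N]_x (excess r x)%:E +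
    (j%:R * h * (e * (C * M ^+ 2 * (Th + C))))%:E)%E.
Proof.
move=> r0 e0 ge ze; elim: j => [|j IH]; first by rewrite !mul0r adde0.
have s := step_excess h0 mk k0 kb k_supp mg g0 kg C0 gC theta_weight (nu_step j) (hr j) (nuM j) r0 e0 ge ze.
apply: (le_trans s); apply: (le_trans (leeD2r _ IH)).
by rewrite -addeA -EFinD -natr1 leeD2l// lee_fin le_eqVlt; apply/orP; left; apply/eqP; ring.
Qed.

(** By induction with [cut_step]: the scheme dominates the cut scheme, to
which the geometric growth of the modulus applies, and the difference of their
masses is at most the moment divided by [1 + r]. *)
Lemma euler_uac r d e j : 0 <= r -> 0 <= e -> uac (nu 0%N) d e ->
  uac (nu j) d (e * (1 + h * cut_rate C M Th r) ^+ j +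
     (M + j%:R * (h * ((C * M) ^+ 2 * Th))) / (1 + r)).
Proof.
move=> r0 e0 ue.
have cr0 : 0 <= cut_rate C M Th r.
  by rewrite /cut_rate mulr_ge0// mulr_ge0// ?mulr_ge0// addr_ge0.
have mD := measurable_ball0 r.
have mDc : measurable (~` ball0 r) by exact: measurableC.
(* u is the cut measure after j steps, de a bound of the mass lost *)
suff [u [de [de0 uv uD ud [vu um]]]] :
    exists (u : {finite_measure set R -> \bar R}) (de : R),
  [/\ 0 <= de, forall A, measurable A -> (u A <= nu j A)%E, u (~` ball0 r) = 0%E,
     uac u d (e * (1 + h * cut_rate C M Th r) ^+ j) & mass (nu j) <= mass u + de /\
    (moment u + ((1 + r) * de)%:E <= (M + j%:R * (h * ((C * M) ^+ 2 * Th)))%:E)%E].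
  move=> E mE Ed.
  have mEc : measurable (~` E) by exact: measurableC.
  have nE : fine (nu j E) <= fine (u E) + de.
    have E1 (v : {finite_measure set R -> \bar R}) : mass v = fine (v E) + fine (v (~` E)).
      by rewrite /mass -fineD ?fin_num_measure// -measureU ?setUv// ?setICr.
    have := uv _ mEc; rewrite -[X in (X <= _)%E]fineK ?fin_num_measure//.
    rewrite -[X in (_ <= X)%E]fineK ?fin_num_measure// lee_fin => ?.
    by move: vu; rewrite !E1; lra.
  rewrite -[X in (X <= _)%E]fineK ?fin_num_measure// lee_fin (le_trans nE)//.
  apply: lerD; first by have := ud _ mE Ed; rewrite -[X in (X <= _)%E]fineK ?fin_num_measure.
  rewrite ler_pdivlMr; last by rewrite ltr_pwDl.
  rewrite mulrC -lee_fin (le_trans _ um)// leeDr//.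
  by apply: integral_ge0 => x _; rewrite lee_fin weight_ge0.
elim: j => [|j [u [de [de0 uv uD ud [vu um]]]]].
  have [u [uE uint]] := restrict_measure (nu 0%N) mD.
  have E0 : mass (nu 0%N) = mass u + fine (nu 0%N (~` ball0 r)).
    by rewrite /mass uE// setTI -fineD ?fin_num_measure// -measureU ?setUv// ?setICr.
  exists u, (fine (nu 0%N (~` ball0 r))); split.
  - by rewrite fine_ge0.
  - by move=> A mA; rewrite uE//; apply: le_measure; rewrite ?inE//; exact: measurableI.
  - by rewrite uE// setICl measure0.
  - move=> A mA Ad; rewrite expr0 mulr1 uE//; apply: le_trans (ue _ mA Ad).
    by apply: le_measure; rewrite ?inE//; exact: measurableI.
  split; first by rewrite E0.
  rewrite mul0r addr0; apply: le_trans (nuM 0%N).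
  exact: restricted_moment r0 uint.
have [u' [de' [h1 h2 h3 h4 [h5 h6]]]] := cut_step h0 mk k0 kb k_supp mg g0 kg C0 gC
  theta_weight (nu_step j) (hr j) (nuM j) r0 (mulr_ge0 e0 (exprn_ge0 j (addr_ge0 ler01 (mulr_ge0 h0 cr0)))) de0 uv uD ud vu um.
exists u', de'; split => //; first by rewrite exprSr mulrA.
split => //; apply: (le_trans h6).
by rewrite lee_fin -natr1 le_eqVlt; apply/orP; left; apply/eqP; ring.
Qed.

(** A bound of the jump on the ball, independent of the truncation of the
kernel. *)
Definition jump_bound N r := 4 * N * (C * (1 + r)) ^+ 2.

Lemma bdd_truncated_jump N f r (JR : R * (R * R) -> R) : bdd N f -> 0 <= r ->
  (forall p, JR p = jump k f p * (\1_(ball0 r) p.1 * \1_(ball0 r) p.2.1)) ->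
  bdd (jump_bound N r) JR.
Proof.
move=> bf r0 JRE; have N0 := bdd_ge0 bf.
have bj := bdd_jump mk k0 kb bf.
have mI : measurable_fun setT (\1_(ball0 r) : R -> R).
  exact: measurable_indic (measurable_ball0 r).
split.
  have mj := bj.1.
  have -> : JR = (fun p : R * (R * R) => jump k f p * (\1_(ball0 r) p.1 * \1_(ball0 r) p.2.1)).
    exact/funext.
  by apply: measurable_funM => //; mea; exact: measurable_ball0.
move=> p; rewrite JRE !indicE.
have B0 : 0 <= jump_bound N r by rewrite /jump_bound mulr_ge0 ?sqr_ge0// mulr_ge0.
have gr x : x \in ball0 r -> g x <= C * (1 + r).
  by rewrite inE => xr; rewrite (le_trans (gC x))// ler_wpM2l// lerD2l.
case: (boolP (p.1 \in ball0 r)) => p1; last by rewrite mul0r mulr0 normr0.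
case: (boolP (p.2.1 \in ball0 r)) => p2; last by rewrite mulr0 mulr0 normr0.
rewrite /= !mulr1 (le_trans (jump_le k0 kg p bf))// /jump_bound ler_wpM2l ?mulr_ge0// expr2.
by rewrite ler_pM// gr.
Qed.

(** By induction on [j]. Replacing the exact rate by the truncated one costs
[e] times the weight, and the truncated rate varies slowly by
[triple_lipschitz]. *)
Lemma euler_local N f r e (JR : R * (R * R) -> R) i j : bdd N f -> 0 <= r -> 0 <= e ->
  (forall x, r <= `|x| -> g x <= e * weight x) ->
  (forall p, JR p = jump k f p * (\1_(ball0 r) p.1 * \1_(ball0 r) p.2.1)) ->
  `|\int[nu (i + j)%N]_x f x - \int[nu i]_x f x -
     j%:R * h * \int[fprod (nu i) (fprod (nu i) theta)]_p JR p| <=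
  j%:R * h * (e * (4 * N * (2 * (C * M ^+ 2 * Th))) +
     2 * (jump_bound N r * (M * Th)) * speed * (j%:R * h)).
Proof.
move=> bf r0 e0 ge JRE; have N0 := bdd_ge0 bf.
have bJR := bdd_truncated_jump bf r0 JRE.
have bj := bdd_jump mk k0 kb bf.
set Q := fun v => \int[fprod v (fprod v theta)]_p JR p.
rewrite -/(Q (nu i)).
set eps := e * _; set c := 2 * _ * speed.
have c0 : 0 <= c.
  by rewrite /c mulr_ge0 ?speed_ge0// mulr_ge0// mulr_ge0 ?(bdd_ge0 bJR)// mulr_ge0.
elim: j => [|j IH].
  by rewrite addn0 subrr sub0r !mul0r oppr0 normr0.
rewrite addnS (step_bdd mk k0 kb bf (nu_step (i + j))).
set I := \int[_]_p jump k f p.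
have h1 : `|I - Q (nu (i + j)%N)| <= eps.
  apply: (truncation_error mg g0 C0 gC theta_weight (nuM _) _ e0 bj.1 bJR.1 _ JRE ge).
    by rewrite mulr_ge0.
  by move=> p; exact: jump_le.
have h2 : `|Q (nu (i + j)%N) - Q (nu i)| <= c * (j%:R * h).
  have := @triple_lipschitz _ theta (nu (i + j)%N) (nu i) JR _ (j%:R * h * speed) M Th bJR.
  rewrite (_ : c * _ = 2 * (jump_bound N r * (M * Th)) * (j%:R * h * speed)); last by rewrite /c; ring.
  apply.
  - exact: mass_moment (nuM _).
  - exact: mass_moment (nuM _).
  - exact: mass_theta theta_weight.
  - by move=> N' f' bf'; exact: euler_lipschitz.
have h3 : `|h * (I - Q (nu i))| <= h * (eps + c * (j%:R * h)).
  rewrite normrM (ger0_norm h0) ler_wpM2l//.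
  have -> : I - Q (nu i) = (I - Q (nu (i + j)%N)) + (Q (nu (i + j)%N) - Q (nu i)) by ring.
  by rewrite (le_trans (ler_normD _ _))// lerD.
have -> : \int[nu (i + j)%N]_x f x + h * I - \int[nu i]_x f x - j.+1%:R * h * Q (nu i) =
  (\int[nu (i + j)%N]_x f x - \int[nu i]_x f x - j%:R * h * Q (nu i)) + h * (I - Q (nu i)).
  by rewrite -natr1; ring.
rewrite (le_trans (ler_normD _ _))// (le_trans (lerD IH h3))//.
have j0 : 0 <= j%:R :> R by rewrite ler0n.
have hh : 0 <= h * h by rewrite mulr_ge0.
have chj : 0 <= c * (h * h) * (j%:R + 1) by rewrite mulr_ge0 ?mulr_ge0// addr_ge0.
rewrite -subr_ge0 -natr1.
by rewrite (_ : _ - _ = c * (h * h) * (j%:R + 1)) //; ring.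
Qed.

End euler.

(** * Tightness and uniform countable additivity *)

Lemma decreasing_measure_le d (T : measurableType d) (R : realType)
    (m : {measure set T -> \bar R}) (E : nat -> set T) (e : R) : 0 < e ->
  (m (E 0%N) < +oo)%E -> (forall j, measurable (E j)) ->
  (forall i j, (i <= j)%N -> E j `<=` E i) -> \bigcap_j E j = set0 ->
  exists j, forall i, (j <= i)%N -> (m (E i) <= e%:E)%E.
Proof.
move=> e0 E0 mE dE Enil.
have h : m (E n) @[n --> \oo] --> 0%E.
  rewrite -(measure0 m) -Enil; apply: nonincreasing_cvg_mu => //.
    by rewrite Enil.
  by move=> i j ij; apply/subsetPset; exact: dE.
have e0' : (0 < e%:E)%E by rewrite lte_fin.
have /h [j _ hj] := open_ereal_lt' e0'.
by exists j => i ij; apply: ltW; exact: hj.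
Qed.

Lemma ball0_exhaust (R : realType) : \bigcap_(j in [set: nat]) (~` ball0 (j%:R : R)) = set0.
Proof.
rewrite -subset0 => x h; have := h (Num.truncn `|x|).+1 I; apply.
by rewrite /ball0/= ltW// truncnS_gt.
Qed.

Lemma ball0_subset (R : realType) (r s : R) : r <= s -> ball0 r `<=` ball0 s.
Proof. by move=> rs x /= xr; exact: le_trans rs. Qed.

(** Continuity from above of the measure with density [weight]. *)
Lemma weight_tail (R : realType) (m : {finite_measure set R -> \bar R}) (e : R) :
  (\int[m]_x (weight x)%:E < +oo)%E -> 0 < e ->
  exists r0, forall r, r0 <= r -> (\int[m]_x (far r x * weight x)%:E <= e%:E)%E.
Proof.
move=> moo e0.
have W0 := @weight_ge0 R; have mW := @measurable_weight R.
have iW : m.-integrable setT (EFin \o (@weight R)).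
  apply/integrableP; split; first by mea.
  rewrite (eq_integral (EFin \o (@weight R)))// => x _ /=; by rewrite ger0_norm.
pose nu := density W0 iW.
have mB (j : nat) : measurable (~` ball0 (j%:R : R)).
  by apply: measurableC; exact: measurable_ball0.
have [j hj] : exists j, forall i, (j <= i)%N -> (nu (~` ball0 (i%:R : R)) <= e%:E)%E.
  apply: (@decreasing_measure_le _ _ _ nu (fun j => ~` ball0 (j%:R : R))) => //.
- by rewrite ltey_eq fin_num_measure.
- by move=> i j ij; apply: subsetC; apply: ball0_subset; rewrite ler_nat.
- exact: ball0_exhaust.
exists j.+1%:R => r jr; apply: le_trans (hj j (leqnn _)).
rewrite /nu /density [leRHS]integral_mkcond.
have mf := measurable_far r.
apply: ge0_le_integral => //.
- by move=> x _; rewrite lee_fin mulr_ge0// far_ge0.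
- by mea.
- apply/(measurable_restrictT _ _).1 => //; apply: measurable_funTS; mea.
- move=> x _; rewrite patchE /far; case: ifPn => xr; last first.
    by rewrite mul0r; case: ifPn => // _; rewrite lee_fin.
  rewrite mem_set ?mul1r// /ball0/= => xj.
  have := le_trans jr xr; rewrite leNgt => /negP; apply.
  by rewrite (le_lt_trans xj)// ltr_nat.
Qed.

Lemma chebyshev_weight (R : realType) (m : {finite_measure set R -> \bar R}) (M r : R) : 0 <= r ->
  (\int[m]_x (weight x)%:E <= M%:E)%E -> (m (~` ball0 r) <= (M / (1 + r))%:E)%E.
Proof.
move=> r0 mM.
have mB : measurable (~` ball0 r) by apply: measurableC; exact: measurable_ball0.
have mI : measurable_fun setT (\1_(~` ball0 r) : R -> R) by exact: measurable_indic.
rewrite -[leLHS]fineK ?fin_num_measure// lee_fin ler_pdivlMr ?ltr_pwDl// mulrC -lee_fin EFinM.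
rewrite fineK ?fin_num_measure//; apply: le_trans mM.
have -> : (m (~` ball0 r) = \int[m]_x (\1_(~` ball0 r) x)%:E)%E.
  by rewrite integral_indic// setIT.
rewrite -ge0_integral_EFinZ; last 3 first.
- exact: mI.
- by move=> x; rewrite indicE.
- by rewrite addr_ge0.
have mW := @measurable_weight R.
apply: ge0_le_integral_EFin; [by mea|by []| |].
- by move=> x; rewrite mulr_ge0 ?addr_ge0// indicE.
- move=> x; rewrite indicE in_setC; case: (boolP (x \in ball0 r)) => /=.
    by rewrite mulr0 weight_ge0.
  by rewrite notin_setE /ball0/= => /negP; rewrite -ltNge => xr; rewrite mulr1 lerD2l ltW.
Qed.

(** On a ball the Lebesgue measure of a decreasing sequence with empty
intersection tends to 0, and the mass outside the ball is uniformly small. *)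
Lemma uca_uac_moment (R : realType) (m_ : nat -> {finite_measure set R -> \bar R}) (M : R) :
  (forall n, (\int[m_ n]_x (weight x)%:E <= M%:E)%E) ->
  (forall e, 0 < e -> exists2 d, 0 < d & forall n, uac (m_ n) d e) -> uca m_.
Proof.
move=> mM ua E mE dE Enil e e0.
have M0 : 0 <= M.
  by rewrite -lee_fin (le_trans _ (mM 0%N))//; apply: integral_ge0 => x _; rewrite lee_fin weight_ge0.
have e2 : 0 < e / 2 by rewrite divr_gt0.
pose r := 2 * M / e.
have r0 : 0 <= r by rewrite divr_ge0// ?mulr_ge0// ltW.
have [d d0 ud] := ua _ e2.
have mB := measurable_ball0 r.
have [j hj] : exists j, forall i, (j <= i)%N -> (@lebesgue_measure R (E i `&` ball0 r) <= d%:E)%E.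
  apply: (@decreasing_measure_le _ _ _ (@lebesgue_measure R) (fun j => E j `&` ball0 r)) => //.
- apply: (@le_lt_trans _ _ (@lebesgue_measure R (ball0 r))).
    apply: le_measure.
    - by rewrite inE; exact: (measurableI _ _ (mE 0%N) mB).
    - by rewrite inE; exact: mB.
    - exact: subIsetr.
  rewrite (_ : ball0 r = `[- r, r]%classic); last first.
    by apply/seteqP; split => x; rewrite /ball0/= in_itv/= ler_norml.
  by rewrite lebesgue_measure_itv/=; case: ifPn => // _; rewrite -EFinD ltry.
- by move=> j; exact: (measurableI _ _ (mE j) mB).
- by move=> i j ij; apply: setSI; exact: dE.
- by rewrite -subset0 -Enil => x xE j _; have [] := xE j I.
exists j => n.
have mBc : measurable (~` ball0 r) by exact: measurableC.
apply: (@le_trans _ _ (m_ n (E j `&` ball0 r) + m_ n (~` ball0 r))%E).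
  rewrite -[X in (X <= _)%E](_ : m_ n ((E j `&` ball0 r) `|` (E j `&` ~` ball0 r)) = _); last first.
    by rewrite -setIUr setUv setIT.
  rewrite measureU//; [|exact: measurableI|exact: measurableI|]; last first.
    by rewrite setIACA setICr setI0.
  by rewrite leeD2l//; apply: le_measure; rewrite ?inE//; exact: measurableI.
rewrite (splitr e) EFinD; apply: leeD.
  by apply: ud; [exact: measurableI|exact: hj].
apply: (le_trans (chebyshev_weight r0 (mM n))); rewrite lee_fin ler_pdivrMr ?ltr_pwDl//.
rewrite mulrDr mulr1 /r (_ : e / 2 * (2 * M / e) = M); first by rewrite lerDr ltW.
by field; rewrite gt_eqF.
Qed.

(** Fatou's lemma for setwise limits: truncate [f], then pass to the limit. *)
Lemma ultra_integral_le d (T : measurableType d) (R : realType) (U : set_system nat)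
    (UU : UltraFilter U) (m_ : nat -> {finite_measure set T -> \bar R})
    (nu : {finite_measure set T -> \bar R}) (f : T -> R) (A : R) :
  (forall B, measurable B -> fine (m_ n B) @[n --> U] --> fine (nu B)) ->
  measurable_fun setT f -> (forall x, 0 <= f x) ->
  (\near U, (\int[m_ U]_x (f x)%:E <= A%:E)%E) -> (\int[nu]_x (f x)%:E <= A%:E)%E.
Proof.
move=> m_nu mf f0 fA.
pose F (j : nat) x := (Num.min (f x) j%:R)%:E.
have bF j : bdd j%:R (fun x => Num.min (f x) j%:R).
  split; first by mea.
  by move=> x; rewrite ger0_norm; [rewrite ge_min lexx orbT|rewrite le_min f0/=].
have -> : (\int[nu]_x (f x)%:E = limn (fun j => \int[nu]_x F j x))%E.
  rewrite -monotone_convergence//.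
  - apply: eq_integral => x _; apply/esym/cvg_lim => //; apply: cvg_near_cst.
    exists (Num.truncn (f x)).+1 => // j /= jx; rewrite /F min_l// ltW//.
    by rewrite (lt_le_trans (truncnS_gt _))// ler_nat.
  - by move=> j; apply/measurable_EFinP; have [] := bF j.
  - by move=> j x _; rewrite lee_fin le_min f0/=.
  - move=> x _ i j ij; rewrite lee_fin le_min ge_min lexx/= ge_min.
    by rewrite (_ : (i%:R <= j%:R :> R))// ?orbT// ler_nat.
apply: lime_le.
  apply: ereal_nondecreasing_is_cvgn => i j ij; apply: ge0_le_integral_EFin.
  - by have [] := bF i.
  - by have [] := bF j.
  - by move=> x; rewrite le_min f0/=.
  - by move=> x; rewrite le_min ge_min lexx/= ge_min ler_nat ij orbT.
apply: nearW => j; rewrite /F -(bdd_EFin_Rintegral _ (bF j)) lee_fin.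
have /cvg_lim <- := ultra_cvg_Rintegral UU m_nu (bF j); last by [].
apply: limr_le; first by apply: (cvgP _ (ultra_cvg_Rintegral UU m_nu (bF j))).
move: fA; apply: filterS => n fA; rewrite -lee_fin (bdd_EFin_Rintegral _ (bF j)).
apply: le_trans fA; apply: ge0_le_integral_EFin => //; first by have [] := bF j.
- by move=> x; rewrite le_min f0/=.
- by move=> x; rewrite ge_min lexx.
Qed.

Lemma uca_cst d (T : measurableType d) (R : realType) (m : {finite_measure set T -> \bar R}) :
  uca (fun=> m).
Proof.
move=> E mE dE E0 e e0.
have moo : (m (E 0%N) < +oo)%E by rewrite ltey_eq fin_num_measure.
by have [j hj] := decreasing_measure_le e0 moo mE dE E0; exists j => _; exact: hj.
Qed.

(** * From increments to integrals *)

Section increments.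
Context (R : realType) (F q : R -> R).
Local Notation mu := (@lebesgue_measure R).
Hypothesis inc : forall e : R, 0 < e -> exists2 L : R, 0 <= L & forall t t' : R, 0 <= t -> t <= t' ->
  `|F t' - F t - (t' - t) * q t| <= (t' - t) * (e + L * (t' - t)) /\
  `|q t' - q t| <= e + L * (t' - t).

Let sym (e : R) : 0 < e -> exists2 L : R, 0 <= L & forall s t : R, 0 <= s -> 0 <= t ->
  `|F t - F s - (t - s) * q s| <= `|t - s| * (2 * (e + L * `|t - s|)) /\
  `|q t - q s| <= e + L * `|t - s|.
Proof.
move=> e0; have [L L0 h] := inc e0; exists L => // s t s0 t0.
have [st|ts] := leP s t.
  have [h1 h2] := h s t s0 st; rewrite (ger0_norm (_ : 0 <= t - s)) ?subr_ge0//; split => //.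
  have ts : 0 <= t - s by rewrite subr_ge0.
  have eL : 0 <= e + L * (t - s) by rewrite addr_ge0 ?mulr_ge0// ltW.
  by apply: (le_trans h1); apply: ler_wpM2l => //; lra.
have [h1 h2] := h t s t0 (ltW ts).
have st : 0 <= s - t by rewrite subr_ge0 ltW.
have -> : `|t - s| = s - t by rewrite distrC ger0_norm.
split; last by rewrite distrC.
have -> : F t - F s - (t - s) * q s = (s - t) * (q s - q t) - (F s - F t - (s - t) * q t) by ring.
rewrite (le_trans (ler_normB _ _))// normrM (ger0_norm st) mulrCA mulr_natl mulr2n lerD//.
exact: ler_wpM2l.
Qed.

Let near_small (s b : R) : 0 < b -> \forall t \near nbhs s, `|t - s| <= b.
Proof. by move=> b0; apply/nbhs_ballP; exists b => //= t; rewrite /ball/= distrC => /ltW. Qed.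

Let q_near (s e : R) : 0 <= s -> 0 < e -> \forall t \near nbhs s, 0 <= t -> `|q s - q t| <= e.
Proof.
move=> s0 e0; have e2 : 0 < e / 2 by rewrite divr_gt0.
have [L L0 h] := sym e2.
have L1 : 0 < 1 + L by rewrite ltr_pwDl.
near=> t => t0; rewrite distrC; have [_ h2] := h s t s0 t0; apply: (le_trans h2).
rewrite [leRHS](splitr e) lerD2l.
have : `|t - s| <= e / 2 / (1 + L).
  by near: t; apply: near_small; rewrite divr_gt0.
rewrite ler_pdivlMr// => h3; rewrite (le_trans _ h3)// mulrC ler_wpM2l// lerDr//.
Unshelve. all: by end_near. Qed.

Let quotient_near (s e : R) : 0 <= s -> 0 < e ->
  \forall t \near nbhs s, 0 <= t -> `|F t - F s - (t - s) * q s| <= `|t - s| * e.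
Proof.
move=> s0 e0; have e4 : 0 < e / 4 by rewrite divr_gt0.
have [L L0 h] := sym e4.
have L1 : 0 < 1 + L by rewrite ltr_pwDl.
near=> t => t0; have [h1 _] := h s t s0 t0; rewrite (le_trans h1)// ler_wpM2l//.
have : `|t - s| <= e / 4 / (1 + L).
  by near: t; apply: near_small; rewrite divr_gt0.
rewrite ler_pdivlMr// mulrDr mulr1 [in L * _]mulrC => h3.
have := normr_ge0 (t - s); lra.
Unshelve. all: by end_near. Qed.

Let F_near (s e : R) : 0 <= s -> 0 < e -> \forall t \near nbhs s, 0 <= t -> `|F s - F t| <= e.
Proof.
move=> s0 e0; have h := quotient_near s0 ltr01.
have N0 : 0 < 1 + `|q s| by rewrite ltr_pwDl.
near=> t => t0; rewrite distrC.
have /(_ t0) h1 : 0 <= t -> `|F t - F s - (t - s) * q s| <= `|t - s| * 1 by near: t; exact: h.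
rewrite mulr1 in h1.
have h2 : `|t - s| <= e / (1 + `|q s|).
  by near: t; apply: near_small; rewrite divr_gt0.
move: h2; rewrite ler_pdivlMr// => h2; rewrite (le_trans _ h2)// mulrDr -normrM.
have -> : F t - F s = (F t - F s - (t - s) * q s) + (t - s) * q s by rewrite subrK.
by rewrite (le_trans (ler_normD _ _))// mulr1 lerD2r.
Unshelve. all: by end_near. Qed.

(** Since [e] is arbitrary, the hypothesis makes [q] continuous and equal to the
derivative of [F]. It is one-sided, with the rate at the left end, and is first
made symmetric. *)
Lemma increments_integral T : 0 < T ->
  mu.-integrable `[0, T] (EFin \o q) /\ \int[mu]_(s in `[0, T]) q s = F T - F 0.
Proof.
move=> T0.
have cq : {within `[0, T], continuous q}.
  apply/subspace_continuousP => s; rewrite /= in_itv/= => /andP[s0 sT].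
  apply/cvgrPdist_le => e e0; have := q_near s0 e0; rewrite /prop_near1 nbhs_simpl /within /=.
  by apply: filterS => t h; rewrite in_itv/= => /andP[t0 _]; exact: h.
have iq : mu.-integrable `[0, T] (EFin \o q).
  by apply: continuous_compact_integrable => //; exact: segment_compact.
split => //.
have dF (s : R) : 0 < s ->
    (fun h : R => h^-1 *: ((F \o shift s) (h *: (1 : R)) - F s)) @ 0^' --> q s.
  move=> s0; apply/cvgrPdist_le => e e0.
  have hq := quotient_near (ltW s0) e0.
  have hp : \forall h \near nbhs (0 : R), 0 <= h + s.
    near=> h; have : `|h - 0| <= s by near: h; apply: near_small.
    by rewrite subr0 ler_norml => /andP[]; lra.
  have hs : \forall h \near nbhs (0 : R), 0 <= h + s ->
      `|F (h + s) - F s - (h + s - s) * q s| <= `|h + s - s| * e.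
    have cs : (h + s) @[h --> (0 : R)] --> s.
      by rewrite -[X in _ --> X]add0r; apply: cvgD; [exact: cvg_id|exact: cvg_cst].
    exact: cs hq.
  near=> h.
  have h0 : h != 0 by near: h; exact: nbhs_dnbhs_neq.
  have h1 : 0 <= h + s by near: h; exact: (cvg_within _ hp).
  have /(_ h1) : 0 <= h + s ->
      `|F (h + s) - F s - (h + s - s) * q s| <= `|h + s - s| * e.
    by near: h; exact: (cvg_within _ hs).
  rewrite addrK => h2.
  rewrite /= ; have -> : q s - h^-1 *: (F (h *: (1 : R) + s) - F s) = - h^-1 * (F (h + s) - F s - h * q s).
    by rewrite scaler1 /GRing.scale/= ; field.
  by rewrite normrM normrN normfV mulrC ler_pdivrMr ?normr_gt0// [leRHS]mulrC.
rewrite /Rintegral (@continuous_FTC2 R q F 0 T)//.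
    split.
    - move=> s; rewrite in_itv/= => /andP[s0 _]; apply/cvg_ex; exists (q s); exact: dF.
    - apply/cvgrPdist_le => e e0; have := F_near (lexx 0) e0.
      move=> h; near=> t; have t0 : 0 < t by near: t; exact: nbhs_right_gt.
      have : 0 <= t -> `|F 0 - F t| <= e by near: t; exact: (cvg_within _ h).
      by apply; exact: ltW.
    - apply/cvgrPdist_le => e e0.
      have h1 := F_near (ltW T0) e0.
      have h2 := near_small T T0.
      near=> t; have : `|t - T| <= T by near: t; exact: (cvg_within _ h2).
      rewrite ler_norml => /andP[h3 _]; have t0 : 0 <= t by lra.
      have : 0 <= t -> `|F T - F t| <= e by near: t; exact: (cvg_within _ h1).
      exact.
  by move=> s; rewrite in_itv/= => /andP[s0 _]; rewrite derive1E; apply/cvg_lim => //; exact: dF.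
Unshelve. all: by end_near. Qed.
End increments.

(** * The limit curve of measures *)

Section limit.
Context (R : realType) (theta : {finite_measure set R -> \bar R}) (k : R * R * R -> R).
Hypotheses (mk : measurable_fun setT k) (k0 : forall p, 0 <= k p).
Hypothesis k_supp : forall p, k p != 0 -> [/\ 0 < p.2, p.2 < p.1.1 & 0 < p.1.2].
Variables (g : R -> R) (C M Th : R).
Hypotheses (mg : measurable_fun setT g) (g0 : forall x, 0 <= g x)
  (kg : forall p, k p <= g p.1.1 * g p.1.2)
  (C0 : 0 <= C) (gC : forall x, g x <= C * weight x)
  (M0 : 0 <= M) (Th0 : 0 <= Th)
  (theta_weight : (\int[theta]_z (weight z)%:E <= Th%:E)%E).
Local Notation moment v := (\int[v]_x (weight x)%:E)%E.

Definition trunc_kernel (n : nat) (p : R * R * R) : R :=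
  k p * (\1_(ball0 n%:R) p.1.1 * \1_(ball0 n%:R) p.1.2).

(** The rate of a point for the kernel truncated at [n] is at most
[2 * C * (1 + n) * (C * M) * Th]. *)
Definition time_step (n : nat) : R := (1 + 2 * (C * (C * M) * Th))^-1 / (1 + n%:R).

Let Kpos : 0 < 1 + 2 * (C * (C * M) * Th).
Proof. by rewrite ltr_pwDl// !mulr_ge0. Qed.

Let npos (n : nat) : 0 < 1 + n%:R :> R.
Proof. by rewrite ltr_pwDl// ler0n. Qed.

Lemma time_step_gt0 n : 0 < time_step n.
Proof. by rewrite divr_gt0// invr_gt0. Qed.

Lemma time_step_le n : time_step n <= (1 + n%:R)^-1.
Proof.
apply: ler_piMl; first by rewrite invr_ge0 ltW.
by rewrite invf_le1// lerDl !mulr_ge0.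
Qed.

Lemma measurable_trunc_kernel n : measurable_fun setT (trunc_kernel n).
Proof.
have mI : measurable_fun setT (\1_(ball0 n%:R) : R -> R).
  exact: measurable_indic (measurable_ball0 _).
by apply: measurable_funM => //; mea; exact: measurable_ball0.
Qed.

Lemma trunc_kernel_ge0 n p : 0 <= trunc_kernel n p.
Proof. by rewrite mulr_ge0// mulr_ge0// indicE. Qed.

Lemma trunc_kernel_le n p : trunc_kernel n p <= k p.
Proof.
by rewrite /trunc_kernel !indicE; do 2 case: (_ \in _);
  rewrite /= ?mulr0n ?mulr1n ?mulr1 ?mulr0 ?mulr1.
Qed.

Lemma trunc_kernel_gg n p : trunc_kernel n p <= g p.1.1 * g p.1.2.
Proof. exact: le_trans (trunc_kernel_le n p) (kg p). Qed.

Let gball (n : nat) x : x \in ball0 (n%:R : R) -> g x <= C * (1 + n%:R).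
Proof. by rewrite inE => xn; rewrite (le_trans (gC x))// ler_wpM2l// lerD2l. Qed.

Lemma trunc_kernel_bound n p : trunc_kernel n p <= (C * (1 + n%:R)) ^+ 2.
Proof.
rewrite /trunc_kernel !indicE.
case: (boolP (p.1.1 \in _)) => p1; last by rewrite mul0r mulr0 sqr_ge0.
case: (boolP (p.1.2 \in _)) => p2; last by rewrite !mulr0 sqr_ge0.
by rewrite /= !mulr1 (le_trans (kg p))// expr2 ler_pM// gball.
Qed.

Lemma trunc_kernel_supp n p : trunc_kernel n p != 0 -> [/\ 0 < p.2, p.2 < p.1.1 & 0 < p.1.2].
Proof. by rewrite mulf_eq0 negb_or => /andP[/k_supp]. Qed.

(** For a nonzero value of the truncated kernel both clusters lie in the ball
of radius [n], so one factor [g] is at most [C * (1 + n)]; the other one is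
integrated. *)
Lemma trunc_rate n (v : {finite_measure set R -> \bar R}) x : (moment v <= M%:E)%E ->
  time_step n * rate theta (trunc_kernel n) v x <= 1.
Proof.
move=> vM.
have mkn := measurable_trunc_kernel n.
rewrite mulrC -ler_pdivlMr ?time_step_gt0// div1r /time_step invfM !invrK.
rewrite -lee_fin -(rate_EFin theta mkn (trunc_kernel_ge0 n) (trunc_kernel_bound n)).
apply: (@le_trans _ _ (\int[fprod v theta]_q (2 * (C * (1 + n%:R)) * g q.1 * 1)%:E)%E).
  apply: ge0_le_integral_EFin.
  - by mea.
  - by mea.
  - by move=> q; rewrite addr_ge0 ?trunc_kernel_ge0.
  - move=> q; rewrite mulr1 -mulrA mulr_natl mulr2n.
    apply: lerD; rewrite /trunc_kernel !indicE.
      case: (boolP (x \in _)) => xn; last by rewrite mul0r mulr0 !mulr_ge0// ltW.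
      have := gball xn => gx.
      rewrite mul1r (le_trans (_ : _ <= k (x, q.1, q.2)))//.
        by case: (_ \in _); rewrite ?mulr1 ?mulr0.
      by rewrite (le_trans (kg _))//= ler_wpM2r.
    case: (boolP (x \in _)) => xn; last by rewrite !mulr0 !mulr_ge0// ltW.
    have := gball xn => gx.
    rewrite mulr1 (le_trans (_ : _ <= k (q.1, x, q.2)))//.
      by case: (_ \in _); rewrite ?mulr1 ?mulr0.
    by rewrite (le_trans (kg _))//= mulrC ler_wpM2r.
have G0 : 0 <= 2 * (C * (1 + n%:R)) by rewrite mulr_ge0// mulr_ge0// ltW.
have H0 y : 0 <= 2 * (C * (1 + n%:R)) * g y by rewrite mulr_ge0.
rewrite (@ge0_integral_fprodM _ _ _ _ _ v theta (fun y => 2 * (C * (1 + n%:R)) * g y) (fun=> 1));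
  [|by mea|by mea|by []|by []].
rewrite integral_cst_mass mul1r ge0_integral_EFinZ//.
apply: (@le_trans _ _ ((2 * (C * (1 + n%:R)))%:E * (C * M)%:E * Th%:E)%E).
  apply: lee_pmul => //.
  - rewrite mule_ge0//; by apply: integral_ge0 => y _; rewrite lee_fin.
  - by rewrite lee_fin mass_ge0.
  - by rewrite lee_wpmul2l//; exact: moment_g.
  - by rewrite lee_fin; exact: mass_theta.
rewrite -!EFinM lee_fin -subr_ge0.
by rewrite (_ : _ - _ = 1 + n%:R) ?ltW//; ring.
Qed.

(** On a fixed ball the truncation is eventually not felt. *)
Lemma trunc_jump n f r p : r <= n%:R ->
  jump (trunc_kernel n) f p * (\1_(ball0 r) p.1 * \1_(ball0 r) p.2.1) =
  jump k f p * (\1_(ball0 r) p.1 * \1_(ball0 r) p.2.1).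
Proof.
move=> rn.
have [p1|p1] := boolP (p.1 \in ball0 r); last first.
  by rewrite [\1_(ball0 r) p.1]indicE (negbTE p1) mul0r !mulr0.
have [p2|p2] := boolP (p.2.1 \in ball0 r); last first.
  by rewrite [\1_(ball0 r) p.2.1]indicE (negbTE p2) !mulr0.
have b1 : p.1 \in ball0 (n%:R : R) by move: p1; rewrite !inE; exact: ball0_subset.
have b2 : p.2.1 \in ball0 (n%:R : R) by move: p2; rewrite !inE; exact: ball0_subset.
by rewrite /jump /trunc_kernel/= ![\1_(ball0 n%:R) _]indicE b1 b2 !mulr1.
Qed.

Variable nu0 : {finite_measure set R -> \bar R}.
Hypothesis nu0M : (moment nu0 <= M%:E)%E.

(** The moment is conserved, so the time step restriction holds at every
step and the scheme never stops. *)
Lemma schemes_exist : exists nu : nat -> nat -> {finite_measure set R -> \bar R},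
  forall n, nu n 0%N = nu0 /\ forall j,
    is_step theta (time_step n) (trunc_kernel n) (nu n j) (nu n j) (nu n j.+1) /\
    (moment (nu n j) <= M%:E)%E.
Proof.
suff /choice[nu nuP] : forall n, exists nu : nat -> {finite_measure set R -> \bar R},
  nu 0%N = nu0 /\ forall j, is_step theta (time_step n) (trunc_kernel n) (nu j) (nu j) (nu j.+1) /\
    (moment (nu j) <= M%:E)%E by exists nu.
move=> n.
apply: (euler_exists (ltW (time_step_gt0 n)) (measurable_trunc_kernel n)
  (trunc_kernel_ge0 n) (trunc_kernel_bound n) (@trunc_kernel_supp n) theta_weight _ nu0M).
by move=> v vM x; exact: trunc_rate.
Qed.

Lemma ge0_time_step n : 0 <= time_step n.
Proof. exact: ltW (time_step_gt0 n). Qed.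

(** The number of steps of the [n]-th scheme completed at time [t]. *)
Definition step_count (n : nat) (t : R) : nat := Num.truncn (t / time_step n).

Lemma step_count_itv n t : 0 <= t ->
  (step_count n t)%:R * time_step n <= t < (step_count n t)%:R * time_step n + time_step n.
Proof.
move=> t0; have h0 := time_step_gt0 n.
have := truncn_itv (divr_ge0 t0 (ltW h0)); rewrite -/(step_count n t).
rewrite ler_pdivlMr// ltr_pdivrMr// => /andP[-> /=].
by rewrite -natr1 mulrDl mul1r.
Qed.

Lemma step_count_le n t t' : 0 <= t -> t <= t' -> (step_count n t <= step_count n t')%N.
Proof.
by move=> t0 tt; apply: le_truncn; rewrite ler_pM2r ?invr_gt0 ?time_step_gt0.
Qed.

Lemma step_count_cvg t : 0 <= t -> (step_count n t)%:R * time_step n @[n --> \oo] --> t.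
Proof.
move=> t0; apply/cvgrPdist_le => e e0.
exists (Num.truncn e^-1) => // n /= en.
have /andP[h1 h2] := step_count_itv n t0.
rewrite ger0_norm ?subr_ge0// lerBlDl (le_trans (ltW h2))// lerD2l.
rewrite (le_trans (time_step_le n))// -[leRHS]invrK lef_pV2 ?posrE ?invr_gt0//.
rewrite (le_trans (ltW (truncnS_gt _)))// -natr1 addrC lerD2l ler_nat//.
Qed.

Section schemes.
Variable nu : nat -> nat -> {finite_measure set R -> \bar R}.
Hypothesis nuP : forall n, nu n 0%N = nu0 /\ forall j,
    is_step theta (time_step n) (trunc_kernel n) (nu n j) (nu n j) (nu n j.+1) /\
    (moment (nu n j) <= M%:E)%E.
Hypothesis g_sub : forall e, 0 < e -> exists r0, forall x, r0 <= `|x| -> g x <= e * weight x.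
Hypothesis nu0_uac : forall e, 0 < e -> exists2 d, 0 < d & uac nu0 d e.

Let nuM n j : (moment (nu n j) <= M%:E)%E. Proof. by have [_ /(_ j)[]] := nuP n. Qed.

Let nuS n j : is_step theta (time_step n) (trunc_kernel n) (nu n j) (nu n j) (nu n j.+1).
Proof. by have [_ /(_ j)[]] := nuP n. Qed.

Let nuR n j x : time_step n * rate theta (trunc_kernel n) (nu n j) x <= 1.
Proof. exact: trunc_rate. Qed.

Definition approx_at t n := nu n (step_count n t).

(** In [euler_uac] the radius [r] is chosen first, to make the discarded mass
small up to time [t], and then the modulus of the initial datum. The growth
factor is bounded by an exponential, uniformly in the time step. *)
Lemma approx_uac t e : 0 <= t -> 0 < e ->
  exists2 d, 0 < d & forall n, uac (approx_at t n) d e.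
Proof.
move=> t0 e0.
pose B := (C * M) ^+ 2 * Th.
have B0 : 0 <= B by rewrite mulr_ge0// sqr_ge0.
(* [r] makes the discarded mass, at most (M + t B) / (1 + r), less than e / 2 *)
pose r := 2 * (M + t * B) / e.
have MtB : 0 <= M + t * B by rewrite addr_ge0// mulr_ge0.
have r0 : 0 <= r by rewrite divr_ge0 ?mulr_ge0// ltW.
pose c := cut_rate C M Th r.
have c0 : 0 <= c.
  by rewrite /c /cut_rate mulr_ge0// mulr_ge0// ?mulr_ge0// addr_ge0.
(* the modulus grows at most by the factor (1 + h c)^j <= exp(t c) *)
pose e1 := e / 2 / expR (t * c).
have e10 : 0 < e1 by rewrite divr_gt0 ?expR_gt0// divr_gt0.
have [d d0 ud] := nu0_uac e10.
exists d => // n E mE Ed.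
have /andP[h1 _] := step_count_itv n t0.
have u0 : uac (nu n 0%N) d e1 by have [-> _] := nuP n.
have := euler_uac (ge0_time_step n) (measurable_trunc_kernel n) (trunc_kernel_ge0 n)
  (trunc_kernel_bound n) (@trunc_kernel_supp n) mg g0 (trunc_kernel_gg n) C0 gC M0 Th0 theta_weight
  (nuS n) (nuM n) (nuR n) (step_count n t) r0 (ltW e10) u0.
move=> /(_ E mE Ed) h; apply: (le_trans h).
rewrite lee_fin [leRHS](splitr e); apply: lerD.
  rewrite /e1 -mulrA; apply: ler_piMr; first by rewrite divr_ge0// ltW.
  rewrite mulrC ler_pdivrMr ?expR_gt0// mul1r -/c.
  have hc : 0 <= time_step n * c by rewrite mulr_ge0// ge0_time_step.
  apply: (@le_trans _ _ (expR (time_step n * c) ^+ step_count n t)).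
    by rewrite lerXn2r ?nnegrE ?expR_ge0 ?addr_ge0// expR_ge1Dx.
  by rewrite -expRM_natl ler_expR mulrA ler_wpM2r.
rewrite ler_pdivrMr ?ltr_pwDl// -/B.
apply: (@le_trans _ _ (M + t * B)).
  by rewrite lerD2l mulrA ler_wpM2r.
rewrite mulrDr mulr1 /r (_ : e / 2 * (2 * (M + t * B) / e) = M + t * B).
  by rewrite lerDr divr_ge0// ltW.
by field; rewrite gt_eqF.
Qed.

Lemma approx_uca t : 0 <= t -> uca (approx_at t).
Proof.
move=> t0; apply: (@uca_uac_moment _ _ M) => [n|e e0]; first exact: nuM.
exact: approx_uac.
Qed.

(** The radius has to serve three purposes: sublinearity of [g], smallness of
the tail of [theta], and smallness of the tail of the initial datum. *)
Lemma approx_excess T e : 0 <= T -> 0 < e -> exists2 r, 0 <= r & forall t n, 0 <= t <= T ->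
  (\int[approx_at t n]_x (excess r x)%:E <= e%:E)%E.
Proof.
move=> T0 e0.
pose K := C * M ^+ 2 * (Th + C).
have K0 : 0 <= K by rewrite mulr_ge0 ?addr_ge0// mulr_ge0// sqr_ge0.
pose e1 := e / 2 / (1 + T * K).
have TK : 0 < 1 + T * K by rewrite ltr_pwDl// mulr_ge0.
have e10 : 0 < e1 by rewrite divr_gt0// divr_gt0.
have [r1 h1] := g_sub e10.
have thoo : (moment theta < +oo)%E by rewrite (le_lt_trans theta_weight) ?ltry.
have nuoo : (moment nu0 < +oo)%E by rewrite (le_lt_trans nu0M) ?ltry.
have [r2 h2] := weight_tail thoo e10.
have e20 : 0 < e / 2 by rewrite divr_gt0.
have [r3 h3] := weight_tail nuoo e20.
pose r := Num.max 0 (Num.max (2 * r1) (Num.max (2 * r2) r3)).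
have r0 : 0 <= r by rewrite le_max lexx.
have rr1 : r1 <= r / 2 by rewrite ler_pdivlMr// mulrC !le_max lexx !orbT.
have rr2 : r2 <= r / 2 by rewrite ler_pdivlMr// mulrC !le_max lexx !orbT.
have rr3 : r3 <= r by rewrite !le_max lexx !orbT.
exists r => // t n /andP[t0 tT].
have /andP[ht _] := step_count_itv n t0.
have W0 := @weight_ge0 R; have mW := @measurable_weight R.
have mf s := @measurable_far R s.
have zf : (\int[theta]_z (far (r / 2) z * `|z|)%:E <= e1%:E)%E.
  apply: le_trans (h2 _ rr2); have mfr := mf (r / 2).
  apply: ge0_le_integral_EFin; [by mea|by mea| |].
  - by move=> x; rewrite mulr_ge0// far_ge0.
  - by move=> x; rewrite ler_wpM2l ?far_ge0// lerDr.
have gf x : r / 2 <= `|x| -> g x <= e1 * weight x.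
  by move=> rx; apply: h1; exact: le_trans rx.
have := euler_excess (ge0_time_step n) (measurable_trunc_kernel n) (trunc_kernel_ge0 n)
  (trunc_kernel_bound n) (@trunc_kernel_supp n) mg g0 (trunc_kernel_gg n) C0 gC theta_weight
  (nuS n) (nuM n) (nuR n) (step_count n t) r0 (ltW e10) gf zf.
move=> h; apply: (le_trans h); have [-> _] := nuP n.
rewrite [leRHS](_ : _ = (e / 2)%:E + (e / 2)%:E)%E; last by rewrite -EFinD -splitr.
apply: leeD.
  apply: le_trans (h3 _ rr3); have mfr := mf r; have me := @measurable_excess R r.
  apply: ge0_le_integral_EFin; [by mea|by mea|exact: excess_ge0|].
  move=> x; rewrite /excess /far; case: ifPn => [rx|].
    by rewrite mul1r ge_max W0/= lerBlDr /weight; lra.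
  by rewrite -ltNge => xr; rewrite mul0r ge_max lexx/= subr_le0 ltW.
have hK : (step_count n t)%:R * time_step n * K <= 1 + T * K.
  apply: (@le_trans _ _ (T * K)); last by rewrite lerDr.
  by apply: ler_wpM2r => //; exact: (le_trans ht tT).
rewrite lee_fin -/K mulrCA /e1 mulrAC ler_pdivrMr//.
by apply: ler_wpM2l hK; rewrite divr_ge0// ltW.
Qed.

Context (U : set_system nat) (UU : UltraFilter U).
Hypothesis Uoo : \oo `<=` U.

Let thetaM : mass theta <= Th. Proof. exact: mass_theta theta_weight. Qed.

Let approxM t n : mass (approx_at t n) <= M.
Proof. exact: mass_moment (nuM _ _). Qed.

(** Since the ultrafilter is chosen before the time, the limits at different
times come from the same schemes and can be compared. *)
Lemma approx_limit : exists rho : R -> {finite_measure set R -> \bar R},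
  forall t, 0 <= t -> forall A, measurable A ->
    fine (approx_at t n A) @[n --> U] --> fine (rho t A).
Proof.
suff /choice[rho rhoP] : forall t, exists m : {finite_measure set R -> \bar R},
  0 <= t -> forall A, measurable A -> fine (approx_at t n A) @[n --> U] --> fine (m A) by exists rho.
move=> t; have [t0|t0] := leP 0 t; last by exists nu0.
have [m hm] := ulim_measure_exists UU (approxM t) (approx_uca t0).
by exists m => _.
Qed.

Variable rho : R -> {finite_measure set R -> \bar R}.
Hypothesis rhoP : forall t, 0 <= t -> forall A, measurable A ->
    fine (approx_at t n A) @[n --> U] --> fine (rho t A).

Lemma rho0 A : measurable A -> rho 0 A = nu0 A.
Proof.
move=> mA; have /cvg_lim h := rhoP (lexx 0) mA.
rewrite -[LHS]fineK ?fin_num_measure// -[RHS]fineK ?fin_num_measure//; congr EFin.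
rewrite -h//; apply: cvg_lim => //; rewrite /approx_at /step_count.
under eq_fun do rewrite mul0r truncn0 (nuP _).1.
exact: cvg_cst.
Qed.

Lemma rho_dominates t A : 0 <= t -> measurable A -> @lebesgue_measure R A = 0%E -> rho t A = 0%E.
Proof.
move=> t0 mA A0.
rewrite -[LHS]fineK ?fin_num_measure//; congr EFin; apply/eqP.
rewrite eq_le fine_ge0// andbT; apply/ler_addgt0Pr => e e0; rewrite add0r.
have [d d0 ud] := approx_uac t0 e0.
apply: cvgr_to_le (rhoP t0 mA) _; apply: nearW => n.
rewrite -lee_fin fineK ?fin_num_measure//; apply: ud => //.
by rewrite A0 lee_fin ltW.
Qed.

Lemma rho_moment t : 0 <= t -> (moment (rho t) <= M%:E)%E.
Proof.
move=> t0; apply: (ultra_integral_le UU (rhoP t0)).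
- exact: measurable_weight.
- exact: weight_ge0.
- by apply: nearW => n; exact: nuM.
Qed.

Lemma rho_excess T e : 0 <= T -> 0 < e -> exists2 r, 0 <= r & forall t, 0 <= t <= T ->
  (\int[rho t]_x (excess r x)%:E <= e%:E)%E.
Proof.
move=> T0 e0; have [r r0 h] := approx_excess T0 e0; exists r => // t tT.
have /andP[t0 _] := tT.
apply: (ultra_integral_le UU (rhoP t0)).
- exact: measurable_excess.
- exact: excess_ge0.
- by apply: nearW => n; exact: h.
Qed.

Let stepT n t t' : 0 <= t -> t <= t' ->
  (step_count n t' - step_count n t)%N%:R * time_step n =
  (step_count n t')%:R * time_step n - (step_count n t)%:R * time_step n.
Proof. by move=> t0 tt; rewrite natrB ?step_count_le// mulrBl. Qed.

Let elapsed_cvg t t' : 0 <= t -> t <= t' ->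
  (step_count n t' - step_count n t)%N%:R * time_step n @[n --> U] --> t' - t.
Proof.
move=> t0 tt.
have -> : (fun n => (step_count n t' - step_count n t)%N%:R * time_step n) =
  (fun n => (step_count n t')%:R * time_step n - (step_count n t)%:R * time_step n).
  by apply/funext => n; exact: stepT.
apply: cvgB; apply: ultra_cvg_oo => //; apply: step_count_cvg => //.
exact: le_trans tt.
Qed.

Lemma rho_lipschitz N f t t' : bdd N f -> 0 <= t -> t <= t' ->
  `|\int[rho t']_x f x - \int[rho t]_x f x| <= N * ((t' - t) * speed C M Th).
Proof.
move=> bf t0 tt; have t0' := le_trans t0 tt.
have c1 := ultra_cvg_Rintegral UU (rhoP t0) bf.
have c2 := ultra_cvg_Rintegral UU (rhoP t0') bf.
apply: ler_cvg_to (cvg_norm (cvgB c2 c1)) _ _.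
  apply: cvgM; first exact: cvg_cst.
  by apply: cvgM; [exact: elapsed_cvg|exact: cvg_cst].
apply: nearW => n; rewrite !fctE /approx_at -{1}(subnKC (step_count_le n t0 tt)).
exact: (euler_lipschitz (ge0_time_step n) (measurable_trunc_kernel n) (trunc_kernel_ge0 n)
  (trunc_kernel_bound n) mg g0 (trunc_kernel_gg n) C0 gC theta_weight (nuS n) (nuM n)).
Qed.

(** Each side of [euler_local] converges along the ultrafilter. The quadratic
term is the limit of integrals of a bounded function against triple products,
which is why the rate is truncated to a ball here. *)
Lemma rho_local N f r e (JR : R * (R * R) -> R) t t' : bdd N f -> 0 <= r -> 0 <= e ->
  (forall x, r <= `|x| -> g x <= e * weight x) ->
  (forall p, JR p = jump k f p * (\1_(ball0 r) p.1 * \1_(ball0 r) p.2.1)) ->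
  0 <= t -> t <= t' ->
  `|\int[rho t']_x f x - \int[rho t]_x f x -
     (t' - t) * \int[fprod (rho t) (fprod (rho t) theta)]_p JR p| <=
  (t' - t) * (e * (4 * N * (2 * (C * M ^+ 2 * Th))) +
     2 * (jump_bound C N r * (M * Th)) * speed C M Th * (t' - t)).
Proof.
move=> bf r0 e0 ge JRE t0 tt; have t0' := le_trans t0 tt.
have JRn n : r <= n%:R -> forall p, JR p = jump (trunc_kernel n) f p *
    (\1_(ball0 r) p.1 * \1_(ball0 r) p.2.1).
  by move=> rn p; rewrite trunc_jump.
have bJR : bdd (jump_bound C N r) JR.
  pose n := (Num.truncn r).+1.
  have rn : r <= n%:R by rewrite ltW// truncnS_gt.
  exact: (bdd_truncated_jump (measurable_trunc_kernel n) (trunc_kernel_ge0 n)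
    (trunc_kernel_bound n) g0 (trunc_kernel_gg n) C0 gC bf r0 (JRn n rn)).
have c1 := ultra_cvg_Rintegral UU (rhoP t0) bf.
have c2 := ultra_cvg_Rintegral UU (rhoP t0') bf.
have ce := elapsed_cvg t0 tt.
have cth A : measurable A -> fine (theta A) @[n --> U] --> fine (theta A).
  by move=> _; exact: cvg_cst.
pose L := Num.max M (Num.max Th (M * Th)).
have LM n : mass (approx_at t n) <= L by rewrite le_max approxM.
have LTh (n : nat) : mass theta <= L by rewrite !le_max thetaM orbT.
have LMT n : mass (fprod (approx_at t n) theta) <= L.
  by rewrite mass_fprod !le_max (ler_pM _ _ (approxM t n) thetaM) ?mass_ge0// !orbT.
have u1 := approx_uca t0.
have u2 := uca_fprod LM LTh u1 (uca_cst theta).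
have p1 := ultra_fprod LM LTh UU u1 (uca_cst theta) (rhoP t0) cth.
have p2 := ultra_fprod LM LMT UU u1 u2 (rhoP t0) p1.
have c3 := ultra_cvg_Rintegral UU p2 bJR.
apply: ler_cvg_to (cvg_norm (cvgB (cvgB c2 c1) (cvgM ce c3))) _ _.
  apply: cvgM; first exact: ce.
  apply: cvgD; first exact: cvg_cst.
  by apply: cvgM; [exact: cvg_cst|exact: ce].
apply: Uoo; exists (Num.truncn r).+1 => // n /= rn.
rewrite !fctE /approx_at -{1}(subnKC (step_count_le n t0 tt)).
apply: (euler_local (ge0_time_step n) (measurable_trunc_kernel n) (trunc_kernel_ge0 n)
  (trunc_kernel_bound n) mg g0 (trunc_kernel_gg n) C0 gC M0 Th0 theta_weight (nuS n) (nuM n)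
  _ _ bf r0 e0 ge).
by apply: JRn; rewrite (le_trans (ltW (truncnS_gt r)))// ler_nat.
Qed.

Definition exchange_rate f (t : R) : R :=
  \int[fprod (rho t) (fprod (rho t) theta)]_p jump k f p.

(** The truncation is removed at the price of an error proportional to [e],
and [increments_integral] applies. *)
Lemma rho_weak N f T : bdd N f -> 0 < T ->
  (@lebesgue_measure R).-integrable `[0, T] (EFin \o exchange_rate f) /\
  \int[@lebesgue_measure R]_(s in `[0, T]) exchange_rate f s =
    \int[rho T]_x f x - \int[rho 0]_x f x.
Proof.
move=> bf; move: T; apply: (@increments_integral R (fun t => \int[rho t]_x f x)) => e e0.
have N0 := bdd_ge0 bf.
pose c := 4 * N * (2 * (C * M ^+ 2 * Th)).
have c0 : 0 <= c by rewrite !mulr_ge0// sqr_ge0.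
(* 2 e' c <= e: the truncation error is made twice *)
pose e' := e / 2 / (1 + c).
have c1 : 0 < 1 + c by rewrite ltr_pwDl.
have e'0 : 0 < e' by rewrite divr_gt0// divr_gt0.
have e'c : e' * c <= e / 2.
  by rewrite /e' mulrAC ler_pdivrMr// ler_wpM2l ?lerDr// divr_ge0// ltW.
have [r1 h1] := g_sub e'0.
pose r := Num.max 0 r1.
have r0 : 0 <= r by rewrite le_max lexx.
have ge x : r <= `|x| -> g x <= e' * weight x.
  by move=> rx; apply: h1; apply: le_trans rx; rewrite le_max lexx orbT.
pose JR (p : R * (R * R)) := jump k f p * (\1_(ball0 r) p.1 * \1_(ball0 r) p.2.1).
pose n := (Num.truncn r).+1.
have rn : r <= n%:R by rewrite ltW// truncnS_gt.
have bJR : bdd (jump_bound C N r) JR.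
  apply: (bdd_truncated_jump (measurable_trunc_kernel n) (trunc_kernel_ge0 n)
    (trunc_kernel_bound n) g0 (trunc_kernel_gg n) C0 gC bf r0) => p.
  by rewrite trunc_jump.
pose Q t := \int[fprod (rho t) (fprod (rho t) theta)]_p JR p.
have mj : measurable_fun setT (jump k f) by have [mf _] := bf; rewrite /jump; mea.
have hQ t : 0 <= t -> `|exchange_rate f t - Q t| <= e' * c.
  move=> t0.
  apply: (truncation_error mg g0 C0 gC theta_weight (rho_moment t0) _ (ltW e'0) mj bJR.1 _ _ ge) => //.
    by rewrite mulr_ge0.
  by move=> p; exact: jump_le.
pose L := 2 * (jump_bound C N r * (M * Th)) * speed C M Th.
have s0 : 0 <= speed C M Th by exact: speed_ge0.
have B0 := bdd_ge0 bJR.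
have L0 : 0 <= L by apply: mulr_ge0 => //; apply: mulr_ge0 => //; apply: mulr_ge0 => //; exact: mulr_ge0.
exists L => // t t' t0 tt; have t0' := le_trans t0 tt.
have dt : 0 <= t' - t by rewrite subr_ge0.
have H1 := rho_local bf r0 (ltW e'0) ge (fun p => erefl (JR p)) t0 tt.
have H2 : `|Q t' - Q t| <= L * (t' - t).
  rewrite (_ : L * (t' - t) = 2 * (jump_bound C N r * (M * Th)) * ((t' - t) * speed C M Th)); last first.
    by rewrite /L; ring.
  apply: (triple_lipschitz bJR).
  - exact: mass_moment (rho_moment t0').
  - exact: mass_moment (rho_moment t0).
  - exact: thetaM.
  - by move=> N' f' bf'; exact: rho_lipschitz.
have q1 := hQ t t0; have q2 := hQ t' t0'; rewrite distrC in q1.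
split.
  have -> : \int[rho t']_x f x - \int[rho t]_x f x - (t' - t) * exchange_rate f t =
    (\int[rho t']_x f x - \int[rho t]_x f x - (t' - t) * Q t) +
    (t' - t) * (Q t - exchange_rate f t) by ring.
  apply: (le_trans (ler_normD _ _)); rewrite normrM (ger0_norm dt).
  apply: (le_trans (lerD H1 (ler_wpM2l dt q1))).
  by rewrite -mulrDr -/c -/L; apply: ler_wpM2l => //; rewrite addrAC lerD2r [leRHS](splitr e) lerD.
have -> : exchange_rate f t' - exchange_rate f t =
  (exchange_rate f t' - Q t') + (Q t' - Q t) + (Q t - exchange_rate f t) by ring.
apply: (le_trans (ler_normD _ _)); apply: (le_trans (lerD (ler_normD _ _) (lexx _))).
rewrite [leLHS]addrAC; apply: lerD H2; rewrite [leRHS](splitr e).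
by rewrite lerD// ?(le_trans q1)// (le_trans q2).
Qed.

End schemes.

Lemma measure_solution_exists :
  (forall e, 0 < e -> exists r0, forall x, r0 <= `|x| -> g x <= e * weight x) ->
  (forall e, 0 < e -> exists2 d, 0 < d & uac nu0 d e) ->
  exists rho : R -> {finite_measure set R -> \bar R},
  [/\ forall A, measurable A -> rho 0 A = nu0 A,
      forall t, 0 <= t -> rho t `<< @lebesgue_measure R,
      forall t, 0 <= t -> (moment (rho t) <= M%:E)%E,
      forall T e, 0 <= T -> 0 < e -> exists2 r, 0 <= r & forall t, 0 <= t <= T ->
        (\int[rho t]_x (excess r x)%:E <= e%:E)%E &
      forall N f, bdd N f ->
        (forall t t', 0 <= t -> t <= t' ->
           `|\int[rho t']_x f x - \int[rho t]_x f x| <= N * ((t' - t) * speed C M Th)) /\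
        forall T, 0 < T ->
          (@lebesgue_measure R).-integrable `[0, T] (EFin \o exchange_rate rho f) /\
          \int[@lebesgue_measure R]_(s in `[0, T]) exchange_rate rho f s =
            \int[rho T]_x f x - \int[rho 0]_x f x].
Proof.
move=> g_sub nu0_uac.
have [nu nuP] := schemes_exist.
have [U [UU Uoo]] := ultraFilterLemma (F := @eventually) _.
have [rho rhoP] := approx_limit nuP nu0_uac UU.
exists rho; split.
- by move=> A mA; exact: (rho0 nuP UU rhoP mA).
- move=> t t0; apply/null_content_dominatesP => A mA A0.
  exact: (rho_dominates nuP nu0_uac UU rhoP t0 mA A0).
- by move=> t t0; exact: (rho_moment nuP UU rhoP t0).
- by move=> T e T0 e0; exact: (rho_excess nuP g_sub UU rhoP T0 e0).
- move=> N f bf; split.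
    by move=> t t' t0 tt; exact: (rho_lipschitz nuP UU Uoo rhoP bf t0 tt).
  by move=> T T0; exact: (rho_weak nuP g_sub nu0_uac UU Uoo rhoP bf T0).
Qed.
End limit.

(** * Changes of variables and densities *)

Section transfer.
Context d1 d2 (T1 : measurableType d1) (T2 : measurableType d2) (R : realType).
Variables (m1 : {measure set T1 -> \bar R}) (m2 : {measure set T2 -> \bar R})
  (phi : T2 -> T1) (D : T2 -> R).
Hypotheses (mphi : measurable_fun setT phi) (mD : measurable_fun setT D) (D0 : forall y, 0 <= D y).
Hypothesis change : forall f : T1 -> R, measurable_fun setT f -> (forall x, 0 <= f x) ->
  (\int[m1]_x (f x)%:E = \int[m2]_y (f (phi y) * D y)%:E)%E.

(** Passage from nonnegative to integrable functions in a change of variables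
with image [phi] and density [D]. *)
Lemma transfer_integral (f : T1 -> R) : m1.-integrable setT (EFin \o f) ->
  m2.-integrable setT (EFin \o (fun y => f (phi y) * D y)) /\
  \int[m1]_x f x = \int[m2]_y (f (phi y) * D y).
Proof.
move=> f1; have mf : measurable_fun setT f by apply/measurable_EFinP; exact: measurable_int f1.
have mfp : measurable_fun setT (f \o phi) by exact: measurableT_comp.
split.
  apply/integrableP; split.
    by apply/measurable_EFinP; apply: measurable_funM.
  have := change (measurableT_comp (@normr_measurable _ setT) mf) (fun x => normr_ge0 _).
  move/integrableP : f1 => [_ +] E; rewrite (_ : \int[m1]_x _ = \int[m1]_x `|f x|%:E)%E; last first.
    by apply: eq_integral => x _.
  rewrite E; apply: le_lt_trans; rewrite le_eqVlt; apply/orP; left; apply/eqP.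
  by apply: eq_integral => y _ /=; rewrite normrM (ger0_norm (D0 y)).
rewrite /Rintegral; congr fine; rewrite integralE [RHS]integralE.
congr (_ - _)%E.
  transitivity (\int[m1]_x (Num.max (f x) 0)%:E)%E.
    by apply: eq_integral => x _; rewrite funeposE/= EFin_max.
  rewrite change; last 2 first.
    by mea.
    by move=> x; rewrite le_max lexx orbT.
  apply: eq_integral => y _; rewrite funeposE/=  -EFin_max; congr EFin.
  by rewrite maxr_pMl// mul0r.
transitivity (\int[m1]_x (Num.max (- f x) 0)%:E)%E.
  by apply: eq_integral => x _; rewrite funenegE/= EFin_max.
rewrite change; last 2 first.
  by mea.
  by move=> x; rewrite le_max lexx orbT.
apply: eq_integral => y _; rewrite funenegE/=  -EFin_max; congr EFin.
by rewrite maxr_pMl// mul0r mulNr.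
Qed.
End transfer.

Lemma ae_eq_integrable d (T : measurableType d) (R : realType) (m : {measure set T -> \bar R})
    (E : set T) (f g : T -> \bar R) : measurable E -> measurable_fun E g -> ae_eq m E g f ->
  m.-integrable E f -> m.-integrable E g.
Proof.
move=> mE mg gf /integrableP[mf foo]; apply/integrableP; split => //.
apply: le_lt_trans foo; rewrite le_eqVlt; apply/orP; left; apply/eqP.
apply: ae_eq_integral => //; [exact: measurableT_comp|exact: measurableT_comp|].
by apply: filterS gf => x h /h ->.
Qed.

Section Rfubini.
Context d1 d2 (T1 : measurableType d1) (T2 : measurableType d2) (R : realType).
Variables (m1 : {sigma_finite_measure set T1 -> \bar R})
  (m2 : {sigma_finite_measure set T2 -> \bar R}).

(** The inner integral is finite for almost every [x] only; elsewhere the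
real-valued integral takes a default value, which does not affect the outer
one. *)
Lemma Rfubini (f : T1 * T2 -> R) : (m1 \x m2)%E.-integrable setT (EFin \o f) ->
  m1.-integrable setT (fun x => (\int[m2]_y f (x, y))%:E) /\
  \int[m1]_x \int[m2]_y f (x, y) = \int[(m1 \x m2)%E]_p f p.
Proof.
move=> If.
have I1 := integrable_fubini_F If.
have E := integral12_prod_meas1 If.
have ae1 : {ae m1, forall x, [set: T1] x -> (\int[m2]_y f (x, y))%:E = fubini_F m2 (EFin \o f) x}.
  have := integrable_ae measurableT I1.
  by apply: filterS => x /(_ I) h _; rewrite /Rintegral fineK.
have mf1 := measurable_int _ I1.
have mF : measurable_fun setT (fun x => (\int[m2]_y f (x, y))%:E).
  rewrite (_ : (fun x => (\int[m2]_y f (x, y))%:E) = EFin \o (fine \o fubini_F m2 (EFin \o f)))//.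
  by apply/measurable_EFinP; apply: measurableT_comp mf1; exact: fine_measurable.
split.
  exact: ae_eq_integrable ae1 I1.
rewrite /Rintegral -E; congr fine; exact: ae_eq_integral ae1.
Qed.
End Rfubini.

Section sfprod.
Context d1 d2 (T1 : measurableType d1) (T2 : measurableType d2) (R : realType).
Variables (m1 : {sigma_finite_measure set T1 -> \bar R})
  (m2 : {sigma_finite_measure set T2 -> \bar R}).

(** An alias of the library product that carries the structure of
sigma-finite measure and can thus be iterated. *)
Definition sfprod : set (T1 * T2) -> \bar R := (m1 \x m2)%E.

HB.instance Definition _ := Measure.on sfprod.

Let sfprod_sigma_finite : sigma_finite setT sfprod.
Proof.
have /sigma_finiteP[F [TF ndF Foo]] := sigma_finiteT m1.
have /sigma_finiteP[G [TG ndG Goo]] := sigma_finiteT m2.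
exists (fun n => F n `*` G n).
  apply/seteqP; split => // -[x y] _.
  have : [set: T1] x by []. have : [set: T2] y by [].
  rewrite TF TG => -[k _ Gky] [n _ Fnx]; exists (maxn n k) => //; split.
  - by move: x Fnx; exact/subsetPset/ndF/leq_maxl.
  - by move: y Gky; exact/subsetPset/ndG/leq_maxr.
move=> k; have [mF Fk] := Foo k; have [mG Gk] := Goo k.
split; first exact: measurableX.
by rewrite /sfprod product_measure1E// lte_mul_pinfty// ge0_fin_numE.
Qed.

HB.instance Definition _ := Measure_isSigmaFinite.Build _ _ _ sfprod sfprod_sigma_finite.
End sfprod.

Section Fubini3.
Context d1 d2 d3 (T1 : measurableType d1) (T2 : measurableType d2) (T3 : measurableType d3)
  (R : realType).
Variables (m1 : {sigma_finite_measure set T1 -> \bar R})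
  (m2 : {sigma_finite_measure set T2 -> \bar R}) (m3 : {sigma_finite_measure set T3 -> \bar R}).

Lemma sigma_finite_tonelli3 (f : T1 * T2 * T3 -> \bar R) : measurable_fun setT f ->
  (forall p, (0 <= f p)%E) ->
  (\int[sfprod (sfprod m1 m2) m3]_p f p = \int[m1]_x \int[m2]_y \int[m3]_z f (x, y, z))%E.
Proof.
move=> mf f0; transitivity (\int[sfprod m1 m2]_p \int[m3]_z f (p, z))%E.
  exact: fubini_tonelli1.
transitivity (\int[m1]_x \int[m2]_y fubini_F m3 f (x, y))%E => //.
apply: fubini_tonelli1; first exact: measurable_fun_fubini_tonelli_F.
by move=> p; exact: integral_ge0.
Qed.

Lemma Rfubini3 (f : T1 * T2 * T3 -> R) :
  (sfprod (sfprod m1 m2) m3).-integrable setT (EFin \o f) ->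
  \int[m1]_x \int[m2]_y \int[m3]_z f (x, y, z) = \int[sfprod (sfprod m1 m2) m3]_p f p.
Proof.
by move=> If; have [I1 <-] := Rfubini If; have [_ <-] := Rfubini I1.
Qed.
End Fubini3.

Section Lebesgue3.
Context (R : realType).
Local Notation mu := (@lebesgue_measure R).

Lemma mu3_tonelli (f : R * R * R -> \bar R) : measurable_fun setT f ->
  (forall p, (0 <= f p)%E) ->
  (\int[mu3]_p f p = \int[mu]_x \int[mu]_y \int[mu]_z f (x, y, z))%E.
Proof. exact: (@sigma_finite_tonelli3 _ _ _ (measurableTypeR R) (measurableTypeR R) (measurableTypeR R)). Qed.

Lemma mu3_Rfubini (f : R * R * R -> R) : mu3.-integrable setT (EFin \o f) ->
  \int[mu]_x \int[mu]_y \int[mu]_z f (x, y, z) = \int[mu3]_p f p.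
Proof. exact: (@Rfubini3 _ _ _ (measurableTypeR R) (measurableTypeR R) (measurableTypeR R)). Qed.
End Lebesgue3.

Section densities.
Context (R : realType).
Local Notation mu := (@lebesgue_measure R).
Implicit Types (nu th : {finite_measure set R -> \bar R}) (u h : R -> R).

(** Stated through integrals of functions because [lebesgue_measure] is a
measure on the copy [measurableTypeR R] of the line, whereas [nu] is one on
[R]. *)
Definition has_density nu u :=
  [/\ measurable_fun setT u, (forall x, 0 <= u x) &
    forall f : R -> \bar R, measurable_fun setT f -> (forall x, (0 <= f x)%E) ->
      (\int[nu]_x f x = \int[mu]_x (f x * (u x)%:E))%E].

Lemma density_exists u : (forall x, 0 <= u x) -> mu.-integrable setT (EFin \o u) ->
  exists nu, has_density nu u.
Proof.
move=> u0 iu.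
have mid : measurable_fun [set: measurableTypeR R] (fun x : R => x) by exact: measurable_id.
have [nu nuE] := transport_measure (@density _ (measurableTypeR R) R mu u u0 iu) mid (bdd_cst (measurableTypeR R) (1 : R)) (fun=> ler01).
exists nu; split => //; first by apply/measurable_EFinP; exact: measurable_int iu.
move=> f mf f0; rewrite nuE//.
by under eq_integral do rewrite mule1; rewrite integral_density.
Qed.

(** The derivative is set to 0 on the negative half-line, so that later
integrals over (0, oo) and over the whole line agree. *)
Lemma Radon_Nikodym_density nu : nu `<< mu -> nu (~` posR) = 0%E ->
  exists2 u, has_density nu u & forall x, x <= 0 -> u x = 0.
Proof.
move=> num nu0.
have mid : measurable_fun [set: R] (fun x : R => x : measurableTypeR R) by exact: measurable_id.
have [nu' nuE] := transport_measure nu mid (bdd_cst R (1 : R)) (fun=> ler01).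
have nuA A : measurable A -> nu' A = nu A.
  move=> mA; transitivity (\int[nu']_x (\1_A x)%:E)%E.
    by rewrite integral_indic// setIT.
  rewrite nuE; last 2 first.
  - by apply/measurable_EFinP; exact: measurable_indic.
  - by move=> x; rewrite lee_fin indicE.
  transitivity (\int[nu]_x (\1_A x)%:E)%E; last by rewrite integral_indic// setIT.
  by apply: eq_integral => x _; rewrite mule1.
have num' : nu' `<< mu.
  apply/null_content_dominatesP => A mA A0; rewrite nuA//.
  by move/null_content_dominatesP : num; exact.
pose u x : R := \1_(@posR R) x * fine (Radon_Nikodym_SigmaFinite.f nu' mu x).
have mP : measurable (@posR R) by exact: measurable_itv.
have md := measurable_int _ (Radon_Nikodym_SigmaFinite.f_integrable num').
have d0 := Radon_Nikodym_SigmaFinite.f_ge0 num'.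
have df := Radon_Nikodym_SigmaFinite.f_fin_num num'.
exists u; last first.
  move=> x x0; rewrite /u indicE memNset ?mul0r// /posR/= in_itv/= andbT.
  by apply/negP; rewrite -leNgt.
split.
- apply: measurable_funM; first exact: measurable_indic.
  by apply: measurableT_comp md; exact: fine_measurable.
- by move=> x; rewrite mulr_ge0 ?fine_ge0// indicE.
move=> f mf f0.
transitivity (\int[nu']_x f x)%E.
  by rewrite nuE//; apply: eq_integral => x _; rewrite mule1.
transitivity (\int[nu']_(x in posR) f x)%E.
  have mPc : measurable (~` (@posR R)) by exact: measurableC.
  have nP : nu' (~` (@posR R)) = 0%E by apply: etrans (nuA _ mPc) nu0.
  rewrite -(setUv (@posR R)) ge0_integral_setU//=.
  - suff -> : (\int[nu']_(x in ~` posR) f x = 0)%E by rewrite adde0.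
    by apply: null_set_integral => //; exact: measurable_funTS.
  - exact: measurable_funTS.
  - by apply/disj_setPS => x [].
have mfP : measurable_fun (@posR R) f by exact: measurable_funTS.
have E := Radon_Nikodym_SigmaFinite.change_of_variables num' f0 mP mfP.
apply: (etrans (esym E)); rewrite integral_mkcond.
apply: eq_integral => x _; rewrite patchE /u indicE; case: ifPn => xP.
  by rewrite mul1r fineK.
by rewrite mul0r mule0.
Qed.

Lemma density_Rintegral nu u (f : R -> R) : has_density nu u -> nu.-integrable setT (EFin \o f) ->
  mu.-integrable setT (EFin \o (fun x => f x * u x)) /\ \int[nu]_x f x = \int[mu]_x (f x * u x).
Proof.
move=> [mu_ u0 hu] If.
have mid : measurable_fun [set: measurableTypeR R] (fun x : R => x) by exact: measurable_id.
apply: (transfer_integral mid mu_ u0 _ If) => g mg g0.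
have mg' : measurable_fun setT (EFin \o g) by mea.
have g0' x : (0 <= (EFin \o g) x)%E by rewrite lee_fin.
by rewrite (hu _ mg' g0'); apply: eq_integral => x _; rewrite EFinM.
Qed.

(** The triple products are bracketed as [nu \x (nu \x theta)] above and as
[(mu \x mu) \x mu] in [mu3]. *)
Definition assoc3 (p : R * R * R) : R * (R * R) := (p.1.1, (p.1.2, p.2)).

Lemma triple_density nu th u h : has_density nu u -> has_density th h ->
  forall F : R * (R * R) -> R, measurable_fun setT F -> (forall p, 0 <= F p) ->
  (\int[fprod nu (fprod nu th)]_p (F p)%:E =
   \int[mu3]_p (F (assoc3 p) * (u p.1.1 * (u p.1.2 * h p.2)))%:E)%E.
Proof.
move=> [mu_ u0 hu] [mh h0 hh] F mF F0.
have mG : measurable_fun setT (fun p : R * R * R => F (assoc3 p) * (u p.1.1 * (u p.1.2 * h p.2))).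
  apply: measurable_funM; last by mea.
  by apply: (measurableT_comp mF (g := assoc3)); rewrite /assoc3; mea.
have G0 (p : R * R * R) : 0 <= F (assoc3 p) * (u p.1.1 * (u p.1.2 * h p.2)).
  by rewrite !mulr_ge0.
have [mF3 F30] : measurable_fun setT (EFin \o F) /\ forall p, (0 <= (EFin \o F) p)%E.
  by split; [mea|move=> p; rewrite lee_fin].
have mG' : measurable_fun setT (fun p : R * R * R => (F (assoc3 p) * (u p.1.1 * (u p.1.2 * h p.2)))%:E).
  exact/measurable_EFinP.
rewrite (mu3_tonelli mG'); last by move=> p; rewrite lee_fin.
rewrite (tonelli2 _ _ mF3 F30) hu; last 2 first.
- by have := @measurable_fun_fubini_tonelli_F _ _ _ _ _ (fprod nu th) _ mF3 F30; exact.
- by move=> x; apply: integral_ge0 => z _; rewrite lee_fin.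
apply: eq_integral => x _.
have mFx : measurable_fun setT (fun q => (F (x, q))%:E) by mea.
have Fx0 q : (0 <= (F (x, q))%:E)%E by rewrite lee_fin.
rewrite (tonelli2 _ _ mFx Fx0) hu; last 2 first.
- by have := @measurable_fun_fubini_tonelli_F _ _ _ _ _ th _ mFx Fx0; exact.
- by move=> y; apply: integral_ge0 => z _; rewrite lee_fin.
have inner y : (\int[mu]_z (F (assoc3 (x, y, z)) * (u x * (u y * h z)))%:E =
    \int[th]_z (F (x, (y, z)))%:E * (u y)%:E * (u x)%:E)%E.
  have mFy : measurable_fun setT (fun z => (F (x, (y, z)))%:E) by mea.
  have Fy0 z : (0 <= (F (x, (y, z)))%:E)%E by rewrite lee_fin.
  rewrite (hh _ mFy Fy0) -muleA -EFinM -ge0_integralZr//=.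
  - by apply: eq_integral => z _; rewrite -!EFinM /assoc3/=; congr EFin; ring.
  - by apply: emeasurable_funM => //; mea.
  - by move=> z _; rewrite mule_ge0// lee_fin.
  - by rewrite lee_fin mulr_ge0.
under [RHS]eq_integral do rewrite /= inner.
have mI := @measurable_fun_fubini_tonelli_F _ _ _ _ _ th _ mFx Fx0.
rewrite ge0_integralZr//=.
- by apply: emeasurable_funM => //; mea.
- by move=> y _; rewrite mule_ge0 ?lee_fin//; apply: integral_ge0 => z _; rewrite lee_fin.
- by rewrite lee_fin.
Qed.
End densities.

Lemma triple_Rintegral (R : realType) (nu th : {finite_measure set R -> \bar R}) (u h : R -> R)
    (F : R * (R * R) -> R) : has_density nu u -> has_density th h ->
  (fprod nu (fprod nu th)).-integrable setT (EFin \o F) ->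
  mu3.-integrable setT
    (EFin \o (fun p : R * R * R => F (assoc3 p) * (u p.1.1 * (u p.1.2 * h p.2)))) /\
  \int[fprod nu (fprod nu th)]_p F p =
    \int[mu3]_p (F (assoc3 p) * (u p.1.1 * (u p.1.2 * h p.2))).
Proof.
move=> du dh IF; have [mu_ u0 _] := du; have [mh h0 _] := dh.
pose T := measurableTypeR R.
pose P := sfprod (sfprod (@lebesgue_measure R) (@lebesgue_measure R)) (@lebesgue_measure R).
have ma : measurable_fun [set: T * T * T] (fun p : T * T * T => (p.1.1 : R, (p.1.2 : R, p.2 : R))).
  by mea.
have mD : measurable_fun [set: T * T * T] (fun p : T * T * T => u p.1.1 * (u p.1.2 * h p.2)).
  have mu' : measurable_fun [set: T] u by exact: mu_.
  have mh' : measurable_fun [set: T] h by exact: mh.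
  by mea.
have D0 (p : T * T * T) : 0 <= u p.1.1 * (u p.1.2 * h p.2) by rewrite !mulr_ge0.
by apply: (@transfer_integral _ _ _ _ R (fprod nu (fprod nu th)) P _ _ ma mD D0 _ F IF) => f mf f0;
  exact: triple_density.
Qed.

(** * The exchange term *)

Definition swap3 (T1 T2 T3 : Type) (p : T1 * (T2 * T3)) : T2 * (T1 * T3) := (p.2.1, (p.1, p.2.2)).

Lemma integral_swap3 (R : realType) (nu th : {finite_measure set R -> \bar R})
    (F : R * (R * R) -> R) : (fprod nu (fprod nu th)).-integrable setT (EFin \o F) ->
  (fprod nu (fprod nu th)).-integrable setT (EFin \o (F \o @swap3 R R R)) /\
  \int[fprod nu (fprod nu th)]_p F p = \int[fprod nu (fprod nu th)]_p F (swap3 p).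
Proof.
move=> IF; have ms : measurable_fun setT (@swap3 R R R) by rewrite /swap3; mea.
have mD : measurable_fun [set: R * (R * R)] (fun=> 1 : R) by mea.
have change (f : R * (R * R) -> R) : measurable_fun setT f -> (forall p, 0 <= f p) ->
    (\int[fprod nu (fprod nu th)]_p (f p)%:E =
     \int[fprod nu (fprod nu th)]_p (f (swap3 p) * 1)%R%:E)%E.
  move=> mf f0; under [RHS]eq_integral do rewrite mulr1.
  have mf1 : measurable_fun setT (EFin \o f) by mea.
  have mf2 : measurable_fun setT (EFin \o (f \o @swap3 R R R)).
    by apply/measurable_EFinP; exact: measurableT_comp.
  have f01 p : (0 <= (EFin \o f) p)%E by rewrite lee_fin.
  rewrite (tonelli2 _ _ mf1 f01) [RHS](tonelli2 _ _ mf2 (fun p => f01 (swap3 p))).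
  pose G (p : R * R * R) := (f (p.1.1, (p.1.2, p.2)))%:E.
  have mG : measurable_fun setT G by rewrite /G; mea.
  have G0 p : (0 <= G p)%E by rewrite lee_fin.
  transitivity (\int[nu]_x \int[fprod nu th]_q G (x, q.1, q.2))%E.
    by apply: eq_integral => x _; apply: eq_integral => -[y z] _.
  rewrite (fprod_swap nu nu th mG G0).
  by apply: eq_integral => x _; apply: eq_integral => -[y z] _.
have [I1 I2] := transfer_integral ms mD (fun=> ler01) change IF.
split.
  by move: I1; congr (_.-integrable _ _); apply/funext => p /=; rewrite mulr1.
by rewrite I2; apply: eq_Rintegral => p _; rewrite mulr1.
Qed.

Section symmetrize.
Context (R : realType) (theta : {finite_measure set R -> \bar R}) (k : R * R * R -> R).
Hypotheses (mk : measurable_fun setT k) (k0 : forall p, 0 <= k p).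
Variables (g : R -> R) (C M Th : R).
Hypotheses (mg : measurable_fun setT g) (g0 : forall x, 0 <= g x)
  (kg : forall p, k p <= g p.1.1 * g p.1.2)
  (C0 : 0 <= C) (gC : forall x, g x <= C * weight x)
  (theta_weight : (\int[theta]_z (weight z)%:E <= Th%:E)%E).

(** In the term where the first cluster receives, the names of the two clusters
are exchanged; both terms then carry the same rate [k (x, y, z)]. *)
Lemma jump_symmetrize (nu : {finite_measure set R -> \bar R}) N f :
  (\int[nu]_x (weight x)%:E <= M%:E)%E -> bdd N f ->
  let T p := tilde f p.1 p.2.1 p.2.2 * k (p.1, p.2.1, p.2.2) in
  (fprod nu (fprod nu theta)).-integrable setT (EFin \o T) /\
  \int[fprod nu (fprod nu theta)]_p jump k f p = \int[fprod nu (fprod nu theta)]_p T p.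
Proof.
move=> nuM bf T; have [mf fN] := bf; have N0 := bdd_ge0 bf.
pose J1 (p : R * (R * R)) := (f (p.1 - p.2.2) - f p.1) * k (p.1, p.2.1, p.2.2).
pose J2 (p : R * (R * R)) := (f (p.1 + p.2.2) - f p.1) * k (p.2.1, p.1, p.2.2).
have i1 : (fprod nu (fprod nu theta)).-integrable setT (EFin \o J1).
  apply: (gg_integrable mg g0 C0 gC theta_weight (A := N + N) nuM); first by rewrite /J1; mea.
  by move=> p; rewrite normrM (ger0_norm (k0 _)) ler_pM//;
    rewrite ?(le_trans (ler_normB _ _))// ?lerD//; exact: (kg (_, _, _)).
have i2 : (fprod nu (fprod nu theta)).-integrable setT (EFin \o J2).
  apply: (gg_integrable mg g0 C0 gC theta_weight (A := N + N) nuM); first by rewrite /J2; mea.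
  by move=> p; rewrite normrM (ger0_norm (k0 _)) [g _ * _]mulrC ler_pM//;
    rewrite ?(le_trans (ler_normB _ _))// ?lerD//; exact: (kg (_, _, _)).
have [i2' E2] := integral_swap3 i2.
have TE : T = fun p => J1 p + J2 (swap3 p).
  by apply/funext => p; rewrite /T /J1 /J2 /tilde /swap3/=; ring.
split.
  rewrite TE (_ : _ \o _ = ((EFin \o J1) \+ (EFin \o (J2 \o @swap3 R R R)))%E)//.
  exact: integrableD.
rewrite TE [RHS](RintegralD measurableT i1 i2')//= -E2 -(RintegralD measurableT i1 i2)//.
Qed.

End symmetrize.

#[global] Instance mu3_ae_filter (R : realType) :
  Filter (almost_everywhere (mu3 : set (R * R * R) -> \bar R)).
Proof.
apply: (@ae_filter_ringOfSetsType _ _ _ (sfprod (sfprod (@lebesgue_measure R) (@lebesgue_measure R)) (@lebesgue_measure R))).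
Qed.

Section exchange_term.
Context (R : realType) (theta : {finite_measure set R -> \bar R}) (k : R * R * R -> R).
Hypotheses (mk : measurable_fun setT k) (k0 : forall p, 0 <= k p).
Hypothesis k_supp : forall p, k p != 0 -> [/\ 0 < p.2, p.2 < p.1.1 & 0 < p.1.2].
Variables (g : R -> R) (C M Th : R).
Hypotheses (mg : measurable_fun setT g) (g0 : forall x, 0 <= g x)
  (kg : forall p, k p <= g p.1.1 * g p.1.2)
  (C0 : 0 <= C) (gC : forall x, g x <= C * weight x)
  (theta_weight : (\int[theta]_z (weight z)%:E <= Th%:E)%E).
Local Notation mu := (@lebesgue_measure R).
Local Notation dom := (@octant R `&` [set p | p.2 < p.1.1]).
Variables (a : R * R * R -> R) (h : R -> R).
Hypotheses (a_meas : measurable_fun (@octant R) a) (thetah : has_density theta h)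
  (ak : {ae mu3, forall p : R * R * R, dom p -> a p = k p * h p.2}).

Lemma measurable_octant : measurable (@octant R).
Proof. by apply: measurableX; [apply: measurableX|]; exact: measurable_itv. Qed.

Lemma measurable_exchange_domain : measurable dom.
Proof.
apply: measurableI; first exact: measurable_octant.
rewrite -[X in measurable X]setTI; apply: measurable_fun_ltr => //; mea.
Qed.

(** The integrand extended by 0 agrees almost everywhere with the integrand on
the side of the measures, whose integrability is known; Fubini's theorem
identifies the integral over [mu3] with the iterated one. *)
Lemma exchange_jump (nu : {finite_measure set R -> \bar R}) (u w f : R -> R) N :
  (\int[nu]_x (weight x)%:E <= M%:E)%E -> has_density nu u -> bdd N f ->
  (forall x, 0 < x -> w x = f x) ->
  mu3.-integrable dom (fun p => (exchange_integrand a w u p.1.1 p.1.2 p.2)%:E) /\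
  exchange a w u = \int[fprod nu (fprod nu theta)]_p jump k f p.
Proof.
move=> nuM nuu bf wf.
have [IT ->] := jump_symmetrize mk k0 mg g0 kg C0 gC theta_weight nuM bf.
have [I3 ->] := triple_Rintegral nuu thetah IT.
move: I3; set G := (X in EFin \o X) => I3.
pose E p := exchange_integrand a w u p.1.1 p.1.2 p.2.
have [mu_ u0 _] := nuu; have [mh h0 _] := thetah; have [mf fN] := bf.
have mdom := measurable_exchange_domain.
have tildeE p : dom p -> tilde w p.1.1 p.1.2 p.2 = tilde f p.1.1 p.1.2 p.2.
  move=> [[[/= x0 y0] z0] /= zx]; move: x0 y0 z0; rewrite /posR/= !in_itv/= !andbT => x0 y0 z0.
  by rewrite /tilde !wf ?subr_gt0// addr_gt0.
have mE : measurable_fun dom E.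
  apply: (eq_measurable_fun (fun p => tilde f p.1.1 p.1.2 p.2 * a p * u p.1.1 * u p.1.2)).
    by move=> p; rewrite inE => pd; rewrite /E /exchange_integrand tildeE//; case: p {pd} => [[]].
  have ma : measurable_fun dom a.
    by apply: measurable_funS a_meas; [exact: measurable_octant|move=> p []].
  have mt : measurable_fun setT (fun p : R * R * R => tilde f p.1.1 p.1.2 p.2).
    by rewrite /tilde; mea.
  by apply: measurable_funM; [apply: measurable_funM; [apply: measurable_funM|]|] => //;
    apply: measurable_funTS; mea.
have EG : {ae mu3, forall p : R * R * R, setT p -> ((E \_ dom) p)%:E = (G p)%:E}.
  apply: filterS ak => p /= H _; rewrite patchE; case: ifPn => pd.
    move: pd; rewrite inE => pd; rewrite /E /G /exchange_integrand tildeE//.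
    have := H pd; case: p {H} pd => [[x y] z] pd /= ->; congr EFin; rewrite /tilde /assoc3/=; ring.
  rewrite /G /assoc3 /= (_ : k _ = 0) ?mulr0 ?mul0r//.
  apply/eqP; apply: contraNT pd => /k_supp /= [z0 zx y0]; rewrite inE; split => //.
  have x0 := lt_trans z0 zx.
  by split; [split|]; rewrite /posR/= in_itv/= andbT.
have mEd : measurable_fun setT (E \_ dom) by exact/(measurable_restrictT _ mdom).
have IEd : mu3.-integrable setT (EFin \o (E \_ dom)).
  apply: ae_eq_integrable EG I3 => //.
  exact/measurable_EFinP.
have IE : mu3.-integrable dom (EFin \o E).
  have IEd' : mu3.-integrable dom (EFin \o (E \_ dom)).
    by apply: integrableS IEd; [exact: measurableT|exact: mdom|].
  apply: eq_integrable IEd'; first exact: mdom.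
  by move=> p pd /=; rewrite patchE pd.
split => //.
transitivity (\int[mu3]_p (E \_ dom) p); last first.
  have EE : (\int[mu3]_p ((E \_ dom) p)%:E = \int[mu3]_p (G p)%:E)%E.
    apply: ae_eq_integral EG => //; [exact/measurable_EFinP|exact: measurable_int I3].
  by rewrite /Rintegral EE.
rewrite -(mu3_Rfubini IEd) /exchange.
have zero x y : ~ (0 < x /\ 0 < y) -> \int[mu]_z (E \_ dom) (x, y, z) = 0.
  move=> xy; under eq_Rintegral => z _.
    rewrite patchE memNset; last first.
      by move=> [[[/= x0 y0] _] _]; apply: xy; move: x0 y0; rewrite /posR/= !in_itv/= !andbT.
    over.
  by rewrite Rintegral_cst// mul0r.
rewrite Rintegral_mkcond; apply: eq_Rintegral => x _; rewrite patchE.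
case: ifPn => [|xP]; last first.
  under eq_Rintegral => y _.
    rewrite zero; last by move=> [x0 _]; move: xP; rewrite notin_setE /posR/= in_itv/= andbT.
    over.
  by rewrite Rintegral_cst// mul0r.
rewrite inE /posR/= in_itv/= andbT => x0.
rewrite Rintegral_mkcond; apply: eq_Rintegral => y _; rewrite patchE.
case: ifPn => [|yP]; last first.
  by rewrite zero// => -[_ y0]; move: yP; rewrite notin_setE /posR/= in_itv/= andbT.
rewrite inE /posR/= in_itv/= andbT => y0.
rewrite Rintegral_mkcond; apply: eq_Rintegral => z _; rewrite !patchE.
case: ifPn => zP.
  rewrite mem_set//; move: zP; rewrite inE/= in_itv/= => /andP[z0 zx].
  by split => //; split; [split|]; rewrite /posR/= in_itv/= andbT.
rewrite memNset// => -[[_ z0] /= zx]; move: z0 zP; rewrite notin_setE /posR/= !in_itv/= andbT => z0.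
by rewrite z0 zx.
Qed.
End exchange_term.

(** * Regularity of the densities in time *)

Lemma ge0_cvge0 (T : Type) (F : set_system T) (FF : Filter F) (R : realType) (f : T -> \bar R) :
  (forall x, (0 <= f x)%E) ->
  (forall e : R, 0 < e -> \forall x \near F, (f x <= e%:E)%E) -> f @ F --> 0%E.
Proof.
move=> f0 fe; apply/fine_cvgP; split.
  by apply: filterS (fe 1 ltr01) => x fx; rewrite ge0_fin_numE// (le_lt_trans fx)// ltry.
apply/cvgrPdist_le => e e0; apply: filterS (fe e e0) => x fx.
have ffin : f x \is a fin_num by rewrite ge0_fin_numE// (le_lt_trans fx)// ltry.
by rewrite sub0r normrN /= ger0_norm ?fine_ge0// -lee_fin fineK.
Qed.

Section regularity.
Context (R : realType).
Local Notation mu := (@lebesgue_measure R).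
Variables (rho : R -> {finite_measure set R -> \bar R}) (zeta : R -> R -> R) (M S : R).
Hypothesis rhoz : forall t, 0 <= t -> has_density (rho t) (zeta t).
Hypothesis zeta_neg : forall t x, x <= 0 -> zeta t x = 0.
Hypothesis rhoM : forall t, 0 <= t -> (\int[rho t]_x (weight x)%:E <= M%:E)%E.
Hypothesis rho_tail : forall T e, 0 <= T -> 0 < e -> exists2 r, 0 <= r & forall t, 0 <= t <= T ->
  (\int[rho t]_x (excess r x)%:E <= e%:E)%E.
Hypothesis S0 : 0 <= S.
Hypothesis rhoL : forall N f, bdd N f -> forall t t', 0 <= t -> t <= t' ->
  `|\int[rho t']_x f x - \int[rho t]_x f x| <= N * ((t' - t) * S).

Let mz t : 0 <= t -> measurable_fun setT (zeta t). Proof. by move=> /rhoz[]. Qed.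

Let z0 t x : 0 <= t -> 0 <= zeta t x. Proof. by move=> /rhoz[]. Qed.

Let mP : measurable (@posR R). Proof. exact: measurable_itv. Qed.

Let integral_posR (f : R -> R) : (forall x, x <= 0 -> f x = 0) ->
  (\int[mu]_(x in posR) (f x)%:E = \int[mu]_x (f x)%:E)%E.
Proof.
move=> f0; rewrite integral_mkcond; apply: eq_integral => x _.
rewrite patchE; case: ifPn => //; rewrite notin_setE /posR/= in_itv/= andbT => /negP.
by rewrite -leNgt => /f0 ->.
Qed.

Let norm_zeta t : 0 <= t -> (norm_L1_01 (zeta t) <= M%:E)%E.
Proof.
move=> t0; have [_ _ hz] := rhoz t0; apply: le_trans (rhoM t0).
rewrite hz; last 2 first.
- by apply/measurable_EFinP; exact: measurable_weight.
- by move=> x; rewrite lee_fin weight_ge0.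
rewrite /norm_L1_01 integral_posR; last by move=> x x0; rewrite zeta_neg// normr0 mulr0.
rewrite le_eqVlt; apply/orP; left; apply/eqP; apply: eq_integral => x _.
rewrite -EFinM ger0_norm ?z0//; congr EFin; have [x0|x0] := ltP 0 x.
  by rewrite /weight gtr0_norm.
by rewrite zeta_neg// !mulr0.
Qed.

Lemma density_L1_01 t : 0 <= t -> L1_01 (zeta t) /\ (norm_L1_01 (zeta t) <= M%:E)%E.
Proof.
move=> t0; split; last exact: norm_zeta.
apply/integrableP; split.
  apply/measurable_EFinP; apply: measurable_funTS; have := mz t0 => mzt; mea.
apply: le_lt_trans (ltry M); apply: le_trans (norm_zeta t0).
rewrite le_eqVlt; apply/orP; left; apply/eqP; apply: eq_integral => x.
rewrite inE /posR/= in_itv/= andbT => x0.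
by rewrite normrM (ger0_norm (_ : 0 <= 1 + x))// addr_ge0// ltW.
Qed.

Let integrable_zeta t : 0 <= t -> mu.-integrable setT (EFin \o zeta t).
Proof.
move=> t0.
have [] := @density_Rintegral _ (rho t) (zeta t) (fun=> 1) (rhoz t0).
  exact: bdd_integrable (bdd_cst _ _).
by move=> + _; congr (_.-integrable _ _); apply/funext => x /=; rewrite mul1r.
Qed.

Lemma density_L1 t : 0 <= t -> L1 (zeta t).
Proof. by move=> t0; apply: integrableS (integrable_zeta t0) => //; exact: mP. Qed.

(** Duality: the norm is attained at the sign of the difference, a bounded test
function. *)
Lemma norm_L1_lipschitz s t : 0 <= s -> 0 <= t ->
  (norm_L1 (fun x => zeta t x - zeta s x)%R <= (`|t - s| * S)%:E)%E.
Proof.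
move=> s0 t0.
have mzs := mz s0; have mzt := mz t0.
(* the sign of the difference of the densities *)
pose f x := if zeta s x <= zeta t x then 1 else -1 : R.
have bf : bdd 1 f.
  split; last by move=> x; rewrite /f; case: ifP; rewrite ?normrN normr1.
  apply: measurable_fun_ifT => //; exact: measurable_fun_ler.
have [it E1] := density_Rintegral (rhoz t0) (bdd_integrable (rho t) bf).
have [is_ E2] := density_Rintegral (rhoz s0) (bdd_integrable (rho s) bf).
have dz : {in setT, (fun x => f x * zeta t x - f x * zeta s x) =1 (fun x => `|zeta t x - zeta s x|)}.
  move=> x _; rewrite -mulrBr /f; case: ifPn => [zz|]; first by rewrite mul1r ger0_norm// subr_ge0.
  by rewrite -ltNge => zz; rewrite mulN1r ltr0_norm// subr_lt0.
rewrite /norm_L1 integral_posR; last by move=> x x0; rewrite !zeta_neg// subrr normr0.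
have D : mu.-integrable setT (EFin \o (fun x => `|zeta t x - zeta s x|)).
  have := integrableB measurableT it is_.
  by congr (_.-integrable _ _); apply/funext => x /=; rewrite -EFinB; congr EFin; apply: dz; rewrite in_setT.
have -> : (\int[mu]_x (`|zeta t x - zeta s x|)%:E = (\int[rho t]_x f x - \int[rho s]_x f x)%:E)%E.
  rewrite E1 E2 -RintegralB//.
  rewrite (@eq_Rintegral _ _ _ mu setT (fun x => `|zeta t x - zeta s x|) (fun x => f x * zeta t x - f x * zeta s x)); last exact: dz.
  by rewrite /Rintegral fineK//; exact: integrable_fin_num.
rewrite lee_fin (le_trans (ler_norm _))//.
have [st|/ltW ts] := leP s t.
  have -> : `|t - s| = t - s by rewrite ger0_norm// subr_ge0.
  by have := rhoL bf s0 st; rewrite mul1r.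
have -> : `|t - s| = s - t by rewrite distrC ger0_norm// subr_ge0.
by rewrite distrC; have := rhoL bf t0 ts; rewrite mul1r.
Qed.

(** For x > 0 one has [1 + x <= (1 + r) + excess r x]. The first part is
controlled by the L^1 norm, the second by the tails of both densities. *)
Lemma norm_L1_01_uniform T e : 0 <= T -> 0 < e -> exists2 d, 0 < d & forall s t,
  0 <= s <= T -> 0 <= t <= T -> `|t - s| <= d ->
  (norm_L1_01 (fun x => zeta t x - zeta s x)%R <= e%:E)%E.
Proof.
move=> T0 e0; have e3 : 0 < e / 3 by rewrite divr_gt0.
have [r r0 hr] := rho_tail T0 e3.
have rS : 0 < 1 + (1 + r) * S by rewrite ltr_pwDl// mulr_ge0// addr_ge0.
exists (e / 3 / (1 + (1 + r) * S)); first by rewrite divr_gt0.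
move=> s t sT tT; have /andP[s0 _] := sT; have /andP[t0 _] := tT.
rewrite ler_pdivlMr// => std.
have mzs := mz s0; have mzt := mz t0; have me := @measurable_excess R r.
have ze t' : 0 <= t' <= T -> (\int[mu]_x (excess r x * zeta t' x)%:E <= (e / 3)%:E)%E.
  move=> tT'; have /andP[t0' _] := tT'; have [_ _ hz] := rhoz t0'.
  apply: le_trans (hr _ tT'); rewrite hz.
  - by rewrite le_eqVlt; apply/orP; left; apply/eqP; apply: eq_integral => x _.
  - exact/measurable_EFinP.
  - by move=> x; rewrite lee_fin excess_ge0.
rewrite /norm_L1_01 integral_posR; last by move=> x x0; rewrite !zeta_neg// subrr normr0 mulr0.
have L := norm_L1_lipschitz s0 t0; rewrite /norm_L1 integral_posR in L; last first.
  by move=> x x0; rewrite !zeta_neg// subrr normr0.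
apply: (@le_trans _ _ (\int[mu]_x ((1 + r) * `|zeta t x - zeta s x| +
    (excess r x * zeta t x + excess r x * zeta s x))%:E)%E).
  have pw x : 0 <= (1 + x) * `|zeta t x - zeta s x| <= (1 + r) * `|zeta t x - zeta s x| +
      (excess r x * zeta t x + excess r x * zeta s x).
    have [x0|x0] := leP x 0; first by rewrite !zeta_neg// subrr normr0 !mulr0 !addr0 lexx.
    rewrite mulr_ge0 ?addr_ge0 ?(ltW x0)//=.
    have d : `|zeta t x - zeta s x| <= zeta t x + zeta s x.
      by rewrite (le_trans (ler_normB _ _))// !ger0_norm ?z0.
    have xr : 1 + x <= (1 + r) + excess r x.
      by rewrite -addrA lerD2l -lerBlDl /excess le_max (gtr0_norm x0) lexx orbT.
    rewrite (le_trans (ler_wpM2r (normr_ge0 _) xr))// mulrDl lerD2l -mulrDr.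
    by rewrite ler_wpM2l// excess_ge0.
  apply: ge0_le_integral_EFin => //; [by mea|by mea| |].
  - by move=> x; have /andP[] := pw x.
  - by move=> x; have /andP[] := pw x.
have E0 t' x : 0 <= t' -> 0 <= excess r x * zeta t' x by move=> t0'; rewrite mulr_ge0 ?z0// excess_ge0.
rewrite ge0_integral_EFinD; [|by mea|by mea| |]; last 2 first.
- by move=> x; rewrite mulr_ge0// addr_ge0.
- by move=> x; rewrite addr_ge0// E0.
rewrite ge0_integral_EFinD; [|by mea|by mea| |]; last 2 first.
- by move=> x; exact: E0.
- by move=> x; exact: E0.
rewrite ge0_integral_EFinZ; [|by mea|by []|by rewrite addr_ge0].
rewrite (_ : e = e / 3 + (e / 3 + e / 3)); last by field.
rewrite !EFinD; apply: leeD; last by apply: leeD; exact: ze.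
apply: (@le_trans _ _ ((1 + r)%:E * (`|t - s| * S)%:E)%E).
  by rewrite lee_wpmul2l// lee_fin addr_ge0.
rewrite -EFinM lee_fin (le_trans _ std)// mulrDr mulr1 mulrCA lerDr//.
Qed.

Lemma strong_continuity : C_L1_01 zeta.
Proof.
have nn (t : R) : nnegR t -> 0 <= t by rewrite /nnegR/= in_itv/= andbT.
split; first by move=> t /nn t0; have [] := density_L1_01 t0.
move=> s /nn s0; apply: ge0_cvge0.
  move=> t; apply: integral_ge0 => x; rewrite /posR/= in_itv/= andbT => x0.
  by rewrite lee_fin mulr_ge0// addr_ge0// ltW.
move=> e e0; have s1 : 0 <= s + 1 by rewrite addr_ge0.
have [d d0 hd] := norm_L1_01_uniform s1 e0.
have [N1 N2] : (\forall t \near nbhs s, `|s - t| < d) /\ (\forall t \near nbhs s, `|s - t| < 1).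
  by split; apply/nbhs_ballP; [exists d => //= t; exact|exists 1 => //= t; exact].
suff : \forall t \near nbhs s, nnegR t ->
  (norm_L1_01 (fun x => zeta t x - zeta s x)%R <= e%:E)%E by exact.
near=> t => /nn t0.
apply: hd; first by rewrite s0 lerDl ler01.
  have : `|s - t| < 1 by near: t.
  by rewrite t0 ltr_norml => /andP[h1 _] /=; lra.
by rewrite distrC ltW//; near: t.
Unshelve. all: by end_near. Qed.

Lemma weak_continuity : C_weak_L1 zeta.
Proof.
have nn (t : R) : nnegR t -> 0 <= t by rewrite /nnegR/= in_itv/= andbT.
split; first by move=> t /nn; exact: density_L1.
move=> l [lin [C lC]]; apply/subspace_continuousP => s /nn s0.
apply/cvgrPdist_le => e e0.
pose d := e / (1 + `|C| * S).
have CS : 0 < 1 + `|C| * S by rewrite ltr_pwDl// mulr_ge0.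
have d0 : 0 < d by rewrite divr_gt0.
have N1 : \forall t \near nbhs s, `|s - t| < d by apply/nbhs_ballP; exists d => //= t; exact.
suff : \forall t \near nbhs s, nnegR t -> `|l (zeta s) - l (zeta t)| <= e by exact.
near=> t => /nn t0.
have E : l (fun x => -1 * zeta t x + zeta s x) = l (zeta s) - l (zeta t).
  by rewrite lin; [rewrite mulN1r addrC|exact: density_L1|exact: density_L1].
have iz : L1 (fun x => -1 * zeta t x + zeta s x).
  have is_ : mu.-integrable posR (EFin \o zeta s) by exact: density_L1.
  have it : mu.-integrable posR (EFin \o zeta t) by exact: density_L1.
  have mP' : measurable (@posR R : set (measurableTypeR R)) by exact: mP.
  have := integrableB mP' is_ it; rewrite /L1.
  by congr (_.-integrable _ _); apply/funext => x /=; rewrite -EFinB mulN1r addrC.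
have := lC _ iz; rewrite E.
have -> : norm_L1 (fun x => -1 * zeta t x + zeta s x) = norm_L1 (fun x => zeta s x - zeta t x).
  by apply: eq_integral => x _; rewrite mulN1r addrC.
have nl := norm_L1_lipschitz t0 s0.
have n0 : (0 <= norm_L1 (fun x => zeta s x - zeta t x)%R)%E by apply: integral_ge0 => x _; rewrite lee_fin.
move=> h; rewrite -lee_fin; apply: (le_trans h).
apply: (@le_trans _ _ (`|C|%:E * (`|s - t| * S)%:E)%E).
  apply: (@le_trans _ _ (`|C|%:E * norm_L1 (fun x => zeta s x - zeta t x)%R)%E).
    by rewrite lee_wpmul2r// lee_fin ler_norm.
  by rewrite lee_wpmul2l.
rewrite -EFinM lee_fin mulrCA.
have td : `|s - t| < d by near: t.
rewrite (le_trans (ler_wpM2r (mulr_ge0 (normr_ge0 C) S0) (ltW td)))//.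
by rewrite /d mulrAC ler_pdivrMr// ler_wpM2l ?(ltW e0)// lerDr.
Unshelve. all: by end_near. Qed.

(** Strong measurability comes from the uniform continuity: the step functions
[zeta (i * T / (k + 1))] converge in norm at every time. *)
Lemma time_essentially_bounded T : 0 < T -> Linfty_L1_01 T zeta.
Proof.
move=> T0; split; last first.
  exists M; apply: aeW => t; rewrite in_itv/= => /andP[t0 _].
  exact: density_L1_01 (ltW t0).
pose step (k : nat) : R := T / k.+1%:R.
have st0 k : 0 < step k by rewrite divr_gt0.
exists (fun k => k.+1), (fun k i => `[i%:R * step k, i%:R * step k + step k[%classic),
  (fun k i => zeta (i%:R * step k)); split.
- by move=> k i; exact: measurable_itv.
- by move=> k i; have [] := density_L1_01 (mulr_ge0 (ler0n _ i) (ltW (st0 k))).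
apply: aeW => t; rewrite in_itv/= => /andP[t0 tT].
apply: ge0_cvge0.
  move=> k; apply: integral_ge0 => x; rewrite /posR/= in_itv/= andbT => x0.
  by rewrite lee_fin mulr_ge0// addr_ge0// ltW.
move=> e e0; have [d d0 hd] := norm_L1_01_uniform (ltW T0) e0.
exists (Num.truncn (T / d)) => // k /= kd.
pose j := Num.truncn (t / step k).
have /andP[j1 j2] : j%:R * step k <= t < j%:R * step k + step k.
  have := truncn_itv (divr_ge0 (ltW t0) (ltW (st0 k))); rewrite -/j.
  rewrite ler_pdivlMr// ltr_pdivrMr// => /andP[-> /=].
  by rewrite -natr1 mulrDl mul1r.
have jk : (j < k.+1)%N.
  rewrite -(ltr_nat R) -(ltr_pM2r (st0 k)) (le_lt_trans j1)//.
  by rewrite /step mulrC divfK// pnatr_eq0.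
have sd : step k <= d.
  rewrite /step ler_pdivrMr// mulrC -ler_pdivrMr// ltW//.
  by rewrite (lt_le_trans (truncnS_gt _))// ler_nat.
have -> : norm_L1_01 (fun x => zeta t x -
    \sum_(i < k.+1) \1_(`[i%:R * step k, i%:R * step k + step k[%classic) t * zeta (i%:R * step k) x) =
  norm_L1_01 (fun x => zeta t x - zeta (j%:R * step k) x).
  apply: eq_integral => x _; congr (_ * `| _ - _|)%:E.
  rewrite (bigD1 (Ordinal jk))//= big1 ?addr0.
    by rewrite indicE mem_set ?mul1r//= in_itv/= j1 j2.
  move=> i ij; rewrite indicE memNset ?mul0r//= in_itv/= => /andP[i1 i2].
  move/eqP: ij; apply; apply: val_inj => /=.
  rewrite /j; apply/esym/truncn_def.
  rewrite ler_pdivlMr// i1 ltr_pdivrMr//= -natr1 mulrDl mul1r//.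
have js : 0 <= j%:R * step k by rewrite mulr_ge0// ltW.
apply: hd; first by rewrite js (le_trans j1)// ltW.
  by rewrite !ltW.
by rewrite ger0_norm ?subr_ge0// lerBlDl (le_trans (ltW j2))// lerD2l.
Qed.
End regularity.

(** * The envelope of the kernel and the data *)

Lemma measurable_inv_ge0 d (T : measurableType d) (R : realType) (h : T -> R) :
  measurable_fun setT h -> (forall x, 0 <= h x) -> measurable_fun setT (fun x => (h x)^-1).
Proof.
move=> mh h0.
have mi : measurable_fun setT ((fun y : R => y^-1) \_ `]0, +oo[).
  apply/(measurable_restrictT _ _).1; first exact: measurable_itv.
  apply: open_continuous_measurable_fun; first exact: interval_open.
  move=> x; rewrite inE/= in_itv/= andbT => x0.
  by apply: inv_continuous; rewrite gt_eqF.
rewrite (_ : (fun x => _) = ((fun y : R => y^-1) \_ `]0, +oo[) \o h); first exact: measurableT_comp.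
apply/funext => x /=; rewrite patchE; case: ifPn => //.
rewrite notin_setE/= in_itv/= andbT => /negP; rewrite -leNgt => hx.
by have -> : h x = 0 by [apply: le_anti; rewrite hx h0]; rewrite invr0.
Qed.

(** The supremum of [eta y / (1 + y)] over y >= max(1, |x|) is nonincreasing in
|x|, hence measurable whatever [eta] is, and it tends to 0 at infinity. It is
multiplied by the weight and increased by 1 to cover sizes below 1. *)
Lemma sublinear_envelope (R : realType) (eta : R -> R) :
  (forall x, 0 < x -> 1 <= eta x) ->
  has_ubound [set eta x / (1 + x) | x in `[1, +oo[] ->
  eta x / x @[x --> +oo] --> 0 ->
  exists (g : R -> R) (C : R), [/\ measurable_fun setT g, forall x, 1 <= g x,
    forall x, 1 <= x -> eta x <= g x, 0 <= C /\ forall x, g x <= C * weight x &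
    forall e, 0 < e -> exists r0, forall x, r0 <= `|x| -> g x <= e * weight x].
Proof.
move=> eta1 [S Sub] lim0.
pose E r := [set eta x / (1 + x) | x in `[Num.max 1 r, +oo[].
have E1 r x : Num.max 1 r <= x -> E r (eta x / (1 + x)).
  by move=> rx; exists x => //=; rewrite in_itv/= andbT.
have ubE r : ubound (E r) S.
  move=> _ [x + <-]; rewrite /= in_itv/= andbT ge_max => /andP[x1 _].
  by apply: Sub; exists x => //=; rewrite in_itv/= andbT.
have supE r : has_sup (E r) by split; [exists (eta (Num.max 1 r) / (1 + Num.max 1 r)); exact: E1|exists S].
pose s r := sup (E r).
have s0 r : 0 <= s r.
  apply: (@le_trans _ _ (eta (Num.max 1 r) / (1 + Num.max 1 r))).
    have r0 : 0 < Num.max 1 r by rewrite lt_max ltr01.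
    by rewrite divr_ge0// ?(le_trans ler01 (eta1 _ r0))// addr_ge0// ltW.
  by apply: ub_le_sup; [case: (supE r)|exact: E1].
have sS r : s r <= S by apply: ge_sup; [case: (supE r)|exact: ubE].
have sdec : nonincreasing_fun s.
  move=> x y xy; apply: ge_sup; first by case: (supE y).
  move=> _ [z + <-]; rewrite /= in_itv/= andbT => xz; apply: ub_le_sup; first by case: (supE x).
  apply: E1; apply: le_trans xz; rewrite ge_max !le_max lexx/= xy orbT//.
have ms : measurable_fun setT s by exact: nonincreasing_measurable.
have S0 : 0 <= S := le_trans (s0 0) (sS 0).
exists (fun x => 1 + s `|x| * weight x), (1 + S); split.
- by have := @measurable_weight R => mW; mea.
- by move=> x; rewrite lerDl mulr_ge0// weight_ge0.
- move=> x x1; have x0 : 0 < x := lt_le_trans ltr01 x1.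
  rewrite /weight gtr0_norm// -[leLHS]add0r lerD// -ler_pdivrMr ?addr_gt0//.
  by apply: ub_le_sup; [case: (supE x)|apply: E1; rewrite ge_max x1 lexx].
- split; first by rewrite addr_ge0.
  by move=> x; rewrite mulrDl mul1r lerD ?weight_ge1// ler_wpM2r// weight_ge0.
move=> e e0; have e2 : 0 < e / 2 by rewrite divr_gt0.
move/cvgrPdist_le : lim0 => /(_ _ e2) [r [_ hr]].
(* for |x| >= 2 / e the constant 1 is at most e / 2 times the weight *)
pose r0 := Num.max (2 / e) (Num.max 0 r + 1).
exists r0 => x; rewrite ge_max => /andP[x1 x2].
have sx : s `|x| <= e / 2.
  apply: ge_sup; first by case: (supE `|x|).
  move=> _ [y + <-]; rewrite /= in_itv/= andbT ge_max => /andP[y1 xy].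
  have y0 : 0 < y := lt_le_trans ltr01 y1.
  have ry : r < y.
    apply: (lt_le_trans _ (le_trans x2 xy)); rewrite ltr_pwDr// le_max lexx orbT//.
  have := hr _ ry; rewrite sub0r normrN; apply: le_trans; rewrite (le_trans _ (ler_norm _))//.
  apply: ler_wpM2l; first exact: le_trans ler01 (eta1 _ y0).
  by rewrite lef_pV2 ?posrE ?addr_gt0// lerDr.
rewrite (splitr e) mulrDl lerD//; last by rewrite ler_wpM2r// weight_ge0.
rewrite mulrC -ler_pdivrMr// -[_ / _]mulrC mulr1 invf_div (le_trans x1)// lerDr//.
Qed.

(** The kernel is replaced by its minimum with the bound, which changes it on
a null set only, so that the bound holds everywhere; where [h] vanishes the
bound forces the kernel to vanish as well. *)
Lemma kernel_factorization (R : realType) (a : R * R * R -> R) (g h : R -> R) :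
  measurable_fun (@octant R) a -> (forall p, octant p -> 0 <= a p) ->
  measurable_fun setT g -> (forall x, 0 <= g x) ->
  measurable_fun setT h -> (forall x, 0 <= h x) ->
  {ae mu3, forall p : R * R * R, octant p -> a p <= g p.1.1 * g p.1.2 * h p.2} ->
  exists k : R * R * R -> R, [/\ measurable_fun setT k, forall p, 0 <= k p,
    forall p, k p != 0 -> [/\ 0 < p.2, p.2 < p.1.1 & 0 < p.1.2],
    forall p, k p <= g p.1.1 * g p.1.2 &
    {ae mu3, forall p : R * R * R, (octant `&` [set p | p.2 < p.1.1]) p -> a p = k p * h p.2}].
Proof.
move=> ma a0 mg g0 mh h0 agh.
pose D := @octant R `&` [set p | p.2 < p.1.1].
have mD : measurable D by exact: measurable_exchange_domain.
pose K := (fun p => Num.min (a p) (g p.1.1 * g p.1.2 * h p.2)) \_ D.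
have mK : measurable_fun setT K.
  rewrite /K; apply/(measurable_restrictT _ mD); apply: measurable_minr.
    by apply: measurable_funS ma; [exact: measurable_octant|move=> p []].
  by apply: measurable_funTS; mea.
have gg0 p : 0 <= g p.1.1 * g p.1.2 * h p.2 :> R by rewrite !mulr_ge0.
have K0 p : 0 <= K p.
  rewrite /K patchE; case: ifPn => //; rewrite inE => -[pO _].
  by rewrite le_min gg0 a0.
have KD p : K p != 0 -> D p.
  by rewrite /K patchE; case: ifPn; [rewrite inE|rewrite eqxx].
exists (fun p => K p * (h p.2)^-1); split.
- apply: measurable_funM => //.
  by apply: (measurable_inv_ge0 (h := fun p => h p.2)) => //; mea.
- by move=> p; rewrite mulr_ge0// invr_ge0.
- move=> p; rewrite mulf_eq0 negb_or => /andP[/KD [[[/= x0 y0] z0] /= zx] _].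
  by move: x0 y0 z0; rewrite /posR/= !in_itv/= !andbT.
- move=> p; have [hp|hp] := eqVneq (h p.2) 0; first by rewrite hp invr0 mulr0 mulr_ge0.
  rewrite ler_pdivrMr; last by rewrite lt_neqAle eq_sym hp h0.
  by rewrite /K patchE; case: ifPn => _; [rewrite ge_min lexx orbT|exact: gg0].
apply: filterS agh => p /= agp pD.
have pO : octant p by case: pD.
rewrite /K patchE mem_set// min_l; last exact: agp.
have [hp|hp] := eqVneq (h p.2) 0; last by rewrite mulfVK.
rewrite hp mulr0; apply/eqP; rewrite eq_le a0// andbT.
by have := agp pO; rewrite hp mulr0.
Qed.

Lemma sfprod_null d1 d2 (T1 : measurableType d1) (T2 : measurableType d2) (R : realType)
    (m1 : {sigma_finite_measure set T1 -> \bar R}) (m2 : {sigma_finite_measure set T2 -> \bar R})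
    (A : set T1) (B : set T2) : measurable A -> measurable B -> m1 A = 0%E \/ m2 B = 0%E ->
  sfprod m1 m2 (A `*` B) = 0%E.
Proof.
move=> mA mB h; transitivity (m1 A * m2 B)%E; first exact: product_measure1E.
by case: h => ->; rewrite ?mul0e ?mule0.
Qed.

Lemma ae_coordinates_neq (R : realType) (c : R) :
  {ae mu3, forall p : R * R * R, p.1.1 != c /\ p.1.2 != c}.
Proof.
pose m := @lebesgue_measure R.
pose P := sfprod (sfprod m m) m.
have mc : measurable [set c] by exact: measurable_set1.
have c0 : m [set c] = 0%E by exact: lebesgue_measure_set1.
have P1 : P ([set c] `*` setT `*` setT) = 0%E.
  apply: sfprod_null; first exact: measurableX.
  - exact: measurableT.
  by left; apply: sfprod_null => //; left.
have P2 : P (setT `*` [set c] `*` setT) = 0%E.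
  apply: sfprod_null => //; first exact: measurableX.
  by left; apply: sfprod_null => //; right.
have mX (A B : set R) : measurable A -> measurable B -> measurable (A `*` B `*` [set: R]).
  by move=> mA mB; apply: (measurableX _ measurableT); exact: measurableX.
have h1 : {ae P, forall p : R * R * R, p.1.1 != c}.
  exists ([set c] `*` setT `*` setT); split; [exact: mX| by []|].
  by move=> p /= /negP; rewrite negbK => /eqP.
have h2 : {ae P, forall p : R * R * R, p.1.2 != c}.
  exists (setT `*` [set c] `*` setT); split; [exact: mX| by []|].
  by move=> p /= /negP; rewrite negbK => /eqP.
by apply: filterS2 h1 h2 => p.
Qed.

(** The initial datum enters the estimates only through this property and its
first moment. *)
Lemma density_uac (R : realType) (nu : {finite_measure set R -> \bar R}) (u : R -> R) :
  has_density nu u -> forall e, 0 < e -> exists2 d, 0 < d & uac nu d e.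
Proof.
move=> nuu e e0; have [mu_ u0 hu] := nuu.
have [iu _] := @density_Rintegral _ nu u (fun=> 1) nuu (bdd_integrable _ (bdd_cst _ _)).
have iu' : (@lebesgue_measure R).-integrable setT (EFin \o u).
  by move: iu; congr (_.-integrable _ _); apply/funext => x /=; rewrite mul1r.
have [d [d0 hd]] := integral_normr_continuous iu' e0.
exists (d / 2); first by rewrite divr_gt0.
move=> E mE Ed.
have h : \int[@lebesgue_measure R]_(x in E) `|u x| < e.
  apply: hd => //; apply: (le_lt_trans Ed); rewrite lte_fin ltr_pdivrMr// mulr_natr mulr2n.
  by rewrite ltrDl.
have iE : (@lebesgue_measure R).-integrable E (EFin \o u) by apply: integrableS iu'.
rewrite (_ : nu E = (\int[@lebesgue_measure R]_(x in E) `|u x|)%:E); first by rewrite lee_fin ltW.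
transitivity (\int[nu]_x (\1_E x)%:E)%E; first by rewrite integral_indic// setIT.
rewrite hu; last 2 first.
- by apply/measurable_EFinP; exact: measurable_indic.
- by move=> x; rewrite lee_fin indicE.
rewrite /Rintegral fineK; last first.
  apply: integrable_fin_num => //; exact: integrable_norm iE.
rewrite [RHS]integral_mkcond; apply: eq_integral => x _; rewrite patchE indicE.
by case: ifPn => xE; rewrite ?mul1e ?mul0e ?ger0_norm.
Qed.

(** Nonnegative extension by 0 of a function that is only meaningful on
(0, oo). *)
Lemma L1_01_extension (R : realType) (f : R -> R) : L1_01 f ->
  let h x := if 0 < x then `|f x| else 0 in
  exists (nu : {finite_measure set R -> \bar R}) (M : R),
    [/\ has_density nu h, 0 <= M & (\int[nu]_x (weight x)%:E <= M%:E)%E].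
Proof.
move=> f1 h.
have h0 x : 0 <= h x by rewrite /h; case: ifP.
have mP : measurable (@posR R) by exact: measurable_itv.
have pE x : (x \in @posR R) = (0 < x).
  by apply/idP/idP; rewrite inE /posR/= in_itv/= andbT.
have hw : (fun x => weight x * h x) = (fun x => `|(1 + x) * f x|) \_ (@posR R).
  apply/funext => x; rewrite patchE /h pE; case: ifPn => x0; last by rewrite mulr0.
  by rewrite normrM /weight (gtr0_norm x0) (ger0_norm (_ : 0 <= 1 + x))// addr_ge0// ltW.
move/integrableP : f1 => [mf foo].
have wh0 x : 0 <= weight x * h x by rewrite mulr_ge0// weight_ge0.
have mw : measurable_fun setT (fun x => weight x * h x).
  rewrite hw; apply/(measurable_restrictT _ mP).
  by apply: measurableT_comp; [exact: normr_measurable|exact/measurable_EFinP].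
have iw : (@lebesgue_measure R).-integrable setT (EFin \o (fun x => weight x * h x)).
  apply/integrableP; split; first exact/measurable_EFinP.
  apply: le_lt_trans foo; rewrite [leRHS]integral_mkcond le_eqVlt; apply/orP; left; apply/eqP.
  apply: eq_integral => x _; rewrite patchE pE /= ger0_norm// /h.
  case: ifPn => x0; last by rewrite mulr0.
  by rewrite normrM /weight (gtr0_norm x0) (ger0_norm (_ : 0 <= 1 + x))// addr_ge0// ltW.
have mW := @measurable_weight R.
have mh : measurable_fun setT h.
  rewrite (_ : h = (fun x => (weight x)^-1 * (weight x * h x))).
    by apply: measurable_funM => //; apply: measurable_inv_ge0 => //; exact: weight_ge0.
  by apply/funext => x; rewrite mulKf// gt_eqF// (lt_le_trans _ (weight_ge1 x)).
have ih : (@lebesgue_measure R).-integrable setT (EFin \o h).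
  apply: le_integrable iw => //; first exact/measurable_EFinP.
  move=> x _ /=; rewrite lee_fin ger0_norm// ger0_norm ?mulr_ge0 ?weight_ge0//.
  by rewrite ler_peMl// weight_ge1.
have [nu nuh] := density_exists h0 ih.
exists nu, (\int[@lebesgue_measure R]_x (weight x * h x)); split => //.
  by apply: Rintegral_ge0 => x _; rewrite mulr_ge0// weight_ge0.
have [_ _ hn] := nuh; rewrite hn; last 2 first.
- exact/measurable_EFinP.
- by move=> x; rewrite lee_fin weight_ge0.
by rewrite /Rintegral fineK//; exact: integrable_fin_num.
Qed.

(** A smooth function is continuous on (0, oo), so that its essential bound
holds everywhere there. *)
Lemma smooth_Linfty_bdd (R : realType) (w : R -> R) : smooth_pos w -> Linfty w ->
  exists (N : R) (f : R -> R), bdd N f /\ forall x, 0 < x -> w x = f x.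
Proof.
move=> sw [mw [N wN]]; exists (Num.max 0 N), (w \_ (@posR R)).
have mP : measurable (@posR R) by exact: measurable_itv.
have pE (x : R) : posR x = (0 < x) by rewrite /posR/= in_itv/= andbT.
split; last by move=> x x0; rewrite patchE mem_set// pE.
split; first exact/(measurable_restrictT _ mP).
move=> x; rewrite patchE; case: ifPn => xP; last by rewrite normr0 le_max lexx.
rewrite le_max; apply/orP; right; rewrite leNgt; apply/negP => Nx.
move: xP; rewrite inE pE => x0.
have cw : {for x, continuous w}.
  apply: differentiable_continuous; apply/derivable1_diffP.
  by apply: (sw 0%N); rewrite pE.
(* a point above the essential bound has a neighbourhood of such points *)
have n1 : \forall y \near nbhs x, N < `|w y|.
  have cn : `|w y| @[y --> x] --> `|w x| by apply: cvg_norm; exact: cw.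
  exact: (cvgr_gt _ cn).
have n2 : \forall y \near nbhs x, 0 < y by exact: lt_nbhsr.
have [e e0 be] : exists2 e : R, 0 < e & ball x e `<=` [set y | N < `|w y| /\ 0 < y].
  by apply/nbhs_ballP; apply: filterS2 n1 n2 => y.
have [A [mA A0 wA]] := wN.
have : (@lebesgue_measure R (ball x e) <= 0)%E.
  rewrite -A0; apply: le_measure; rewrite ?inE//; first exact: measurable_ball.
  move=> y /be[/= Ny y0]; apply: wA => /= /(_ _).
  by rewrite pE => /(_ y0); rewrite leNgt Ny.
rewrite lebesgue_measure_ball ?(ltW e0)// lee_fin leNgt.
by rewrite mulr2n addr_gt0.
Qed.

(** The absolute value in the initial measure is removed thanks to the sign of
the initial datum. *)
Lemma integral_difference (R : realType) (m m0 : {finite_measure set R -> \bar R})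
    (z zin w f : R -> R) (N : R) :
  has_density m z -> (forall x, x <= 0 -> z x = 0) ->
  has_density m0 (fun x => if 0 < x then `|zin x| else 0) -> L1_01 zin ->
  {ae @lebesgue_measure R, forall x, 0 < x -> 0 <= zin x} ->
  measurable_fun (@posR R) w -> bdd N f -> (forall x, 0 < x -> w x = f x) ->
  \int[@lebesgue_measure R]_(x in posR) (w x * (z x - zin x)) =
    \int[m]_x f x - \int[m0]_x f x.
Proof.
move=> mz z0 mh zin1 zin0 mw bf wf.
have [I1 ->] := density_Rintegral mz (bdd_integrable m bf).
have [I2 ->] := density_Rintegral mh (bdd_integrable m0 bf).
have mP : measurable (@posR R) by exact: measurable_itv.
have pE x : (x \in @posR R) = (0 < x).
  by apply/idP/idP; rewrite inE /posR/= in_itv/= andbT.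
have pP x : posR x -> 0 < x :> R by rewrite /posR/= in_itv/= andbT.
set h := fun x => if 0 < x then `|zin x| else 0 in mh I2 *.
rewrite -RintegralB//.
transitivity (\int[@lebesgue_measure R]_(x in posR) (f x * z x - f x * h x)); last first.
  rewrite Rintegral_mkcond; apply: eq_Rintegral => x _; rewrite patchE pE.
  rewrite /h; have [x0|x0] := ltP 0 x; first by [].
  by rewrite (z0 _ x0) !mulr0 subrr.
have mf : measurable_fun setT f by case: bf.
have mzz : measurable_fun setT z by case: mz.
have mhh : measurable_fun setT h by case: mh.
have mzin : measurable_fun (@posR R) zin.
  have m1 : measurable_fun (@posR R) (fun x => (1 + x) * zin x).
    by apply/measurable_EFinP; exact: measurable_int zin1.
  have mW := @measurable_weight R.
  apply: (eq_measurable_fun (fun x => (weight x)^-1 * ((1 + x) * zin x))).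
    move=> x; rewrite pE => x0; rewrite /weight gtr0_norm// mulKf//.
    by rewrite gt_eqF// addr_gt0.
  apply: measurable_funM => //; apply: measurable_funTS.
  by apply: measurable_inv_ge0 => //; exact: weight_ge0.
rewrite /Rintegral; congr fine; apply: ae_eq_integral => //.
- apply/measurable_EFinP; apply: measurable_funM => //; apply: measurable_funB => //.
  exact: measurable_funTS.
- apply/measurable_EFinP; apply: measurable_funTS; mea.
have FF : Filter (almost_everywhere (@lebesgue_measure R)).
  exact: (@ae_filter_ringOfSetsType _ (measurableTypeR R)).
apply: filterS zin0 => x h0 /pP x0.
by rewrite wf// -mulrBr /h x0 ger0_norm// h0.
Qed.

(** No jump enters or leaves the negative half-line; so the limit measures stay
supported on (0, oo). *)
Lemma jump_negative_half (R : realType) (k : R * R * R -> R) :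
  (forall p, k p != 0 -> [/\ 0 < p.2, p.2 < p.1.1 & 0 < p.1.2]) ->
  forall p, jump k (\1_(~` @posR R)) p = 0.
Proof.
move=> k_supp [x [y z]]; rewrite /jump/=.
have one (t : R) : 0 < t -> \1_(~` @posR R) t = 0 :> R.
  by move=> t0; rewrite indicE memNset// => -[]; rewrite /posR/= in_itv/= andbT.
have [->|/k_supp/= [z0 zx y0]] := eqVneq (k (x, y, z)) 0.
  have [->|/k_supp/= [z0 zy x0]] := eqVneq (k (y, x, z)) 0; first by rewrite !mulr0 addr0.
  by rewrite (one (x + z)) ?addr_gt0// (one x x0) subrr mul0r mulr0 addr0.
have x0 := lt_trans z0 zx.
have xz : 0 < x - z by rewrite subr_gt0.
have xz' : 0 < x + z by rewrite addr_gt0.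
by rewrite (one _ xz) (one _ xz') (one x x0) subrr !mul0r addr0.
Qed.

(** The four regimes together. The lines x = 1 and y = 1, which they leave out,
are null sets. *)
Lemma kernel_bound (R : realType) (phi eta : R -> R) (a : R * R * R -> R) (A : R) (env : R -> R) :
  0 <= A -> (forall x, 1 <= env x) -> (forall x, 1 <= x -> eta x <= env x) ->
  (forall x, 0 < x -> 1 <= eta x) ->
  {ae mu3, forall p : R * R * R, octant p ->
    p.1.1 < 1 -> p.1.2 < 1 -> a p <= A * phi p.2} ->
  {ae mu3, forall p : R * R * R, octant p ->
    p.1.1 < 1 -> 1 < p.1.2 -> a p <= A * eta p.1.2 * phi p.2} ->
  {ae mu3, forall p : R * R * R, octant p ->
    1 < p.1.1 -> p.1.2 < 1 -> a p <= A * eta p.1.1 * phi p.2} ->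
  {ae mu3, forall p : R * R * R, octant p ->
    1 < p.1.1 -> 1 < p.1.2 -> a p <= A * eta p.1.1 * eta p.1.2 * phi p.2} ->
  {ae mu3, forall p : R * R * R, octant p ->
    a p <= ((1 + A) * env p.1.1) * ((1 + A) * env p.1.2) * (if 0 < p.2 then `|phi p.2| else 0)}.
Proof.
move=> A0 env1 envE eta1 h1 h2 h3 h4.
have env0 x : 0 <= env x := le_trans ler01 (env1 x).
have bound (b c : R) x y z : 0 <= b -> b <= env x -> 0 <= c -> c <= env y ->
    A * b * c * phi z <= ((1 + A) * env x) * ((1 + A) * env y) * `|phi z|.
  move=> b0 bx c0 cy.
  apply: (@le_trans _ _ (A * b * c * `|phi z|)).
    by rewrite ler_wpM2l ?ler_norm// !mulr_ge0.
  apply: ler_wpM2r => //; apply: ler_pM; rewrite ?mulr_ge0//.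
    by apply: ler_pM => //; rewrite lerDr.
  by rewrite (le_trans cy)// ler_peMl// lerDl.
near=> p.
have k1 : octant p -> p.1.1 < 1 -> p.1.2 < 1 -> a p <= A * phi p.2 by near: p; exact: h1.
have k2 : octant p -> p.1.1 < 1 -> 1 < p.1.2 -> a p <= A * eta p.1.2 * phi p.2.
  by near: p; exact: h2.
have k3 : octant p -> 1 < p.1.1 -> p.1.2 < 1 -> a p <= A * eta p.1.1 * phi p.2.
  by near: p; exact: h3.
have k4 : octant p -> 1 < p.1.1 -> 1 < p.1.2 -> a p <= A * eta p.1.1 * eta p.1.2 * phi p.2.
  by near: p; exact: h4.
have [x1 y1] : p.1.1 != 1 /\ p.1.2 != 1 by near: p; exact: ae_coordinates_neq.
move=> pO; have [[_ _]] := pO; rewrite /posR/= in_itv/= andbT => z0; rewrite z0.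
have et t : 1 < t -> 0 <= eta t by move=> t1; rewrite (le_trans ler01)// eta1// (lt_trans ltr01).
case: (ltgtP p.1.1 1) x1 => // x1 _; case: (ltgtP p.1.2 1) y1 => // y1 _.
- apply: (le_trans (k1 pO x1 y1)).
  by have := bound 1 1 p.1.1 p.1.2 p.2; rewrite !mulr1; apply.
- apply: (le_trans (k2 pO x1 y1)).
  have := bound 1 (eta p.1.2) p.1.1 p.1.2 p.2; rewrite mulr1; apply => //; first exact: et.
  by apply: envE; exact: ltW.
- apply: (le_trans (k3 pO x1 y1)).
  have := bound (eta p.1.1) 1 p.1.1 p.1.2 p.2; rewrite mulr1; apply => //; first exact: et.
  by apply: envE; exact: ltW.
- apply: (le_trans (k4 pO x1 y1)); apply: bound; rewrite ?et//.
    by apply: envE; exact: ltW.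
  by apply: envE; exact: ltW.
Unshelve. all: by end_near. Qed.

(** * Existence of a weak solution *)

Theorem theorem2p4 (R : realType) (zetain phi eta : R -> R)
    (a : R * R * R -> R) (A : R)
    (zetain_L1 : L1_01 zetain)
    (zetain_ge0 : {ae @lebesgue_measure R, forall x, 0 < x -> 0 <= zetain x})
    (phi_L1 : L1_01 phi)
    (a_ge0 : forall x y z, 0 < x -> 0 < y -> 0 < z -> 0 <= a (x, y, z))
    (a_meas : measurable_fun octant a)
    (a_supp : forall x y z, 0 < x -> 0 < y -> 0 < z -> x < z ->
      a (x, y, z) = 0)
    (eta_ge1 : forall x, 0 < x -> 1 <= eta x)
    (eta_bound : has_ubound [set eta x / (1 + x) | x in `[1, +oo[])
    (eta_lim : eta x / x @[x --> +oo] --> 0)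
    (A_ge0 : 0 <= A)
    (a_small_small : {ae mu3, forall p : R * R * R, octant p ->
      p.1.1 < 1 -> p.1.2 < 1 -> a p <= A * phi p.2})
    (a_small_large : {ae mu3, forall p : R * R * R, octant p ->
      p.1.1 < 1 -> 1 < p.1.2 -> a p <= A * eta p.1.2 * phi p.2})
    (a_large_small : {ae mu3, forall p : R * R * R, octant p ->
      1 < p.1.1 -> p.1.2 < 1 -> a p <= A * eta p.1.1 * phi p.2})
    (a_large_large : {ae mu3, forall p : R * R * R, octant p ->
      1 < p.1.1 -> 1 < p.1.2 -> a p <= A * eta p.1.1 * eta p.1.2 * phi p.2})
    (a_W1infty : W1infty_loc a)
    (a_dx : exists2 ax, weak_derivative dir_x a ax &
      {ae mu3, forall p : R * R * R, octant p ->
        ax p <= A * (1 + p.1.2) * phi p.2})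
    (a_dy : exists2 ay, weak_derivative dir_y a ay &
      {ae mu3, forall p : R * R * R, octant p ->
        ay p <= A * (1 + p.1.1) * phi p.2}) :
  exists zeta : R -> R -> R,
    [/\ weak_solution a zetain zeta,
        C_L1_01 zeta &
        forall T : R, 0 < T -> Linfty_L1_01 T zeta].
Proof.
Proof.
have [env [C [menv env1 envE [C0 envC] env_sub]]] := sublinear_envelope eta_ge1 eta_bound eta_lim.
have A1 : 0 <= 1 + A by rewrite addr_ge0.
(* A <= (1 + A)^2, so the constant can be shared between the two factors *)
pose g x := (1 + A) * env x.
have g0 x : 0 <= g x by rewrite mulr_ge0// (le_trans ler01).
have mg : measurable_fun setT g by rewrite /g; mea.
have gC x : g x <= (1 + A) * C * weight x by rewrite -mulrA ler_wpM2l.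
have C10 : 0 <= (1 + A) * C by rewrite mulr_ge0.
have g_sub e : 0 < e -> exists r0, forall x, r0 <= `|x| -> g x <= e * weight x.
  move=> e0; have A1' : 0 < 1 + A by rewrite ltr_pwDl.
  have [r hr] := env_sub _ (divr_gt0 e0 A1'); exists r => x /hr h.
  by rewrite /g mulrC -ler_pdivlMr// mulrAC.
have [nu0 [M [nu0h M0 nu0M]]] := L1_01_extension zetain_L1.
have [theta [Th [thetah Th0 thetaM]]] := L1_01_extension phi_L1.
have agh := kernel_bound A_ge0 env1 envE eta_ge1 a_small_small a_small_large
  a_large_small a_large_large.
have aO p : octant p -> 0 <= a p.
  case: p => -[x y] z [[/=]]; rewrite /posR/= !in_itv/= !andbT; exact: a_ge0.
have [mh h0 _] := thetah.
have [k [mk k0 k_supp kg ak]] := kernel_factorization a_meas aO mg g0 mh h0 agh.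
have [rho [rho0 rho_ac rhoM rho_tail rhoP]] := measure_solution_exists mk k0 k_supp mg g0 kg
  C10 gC M0 Th0 thetaM nu0M g_sub (density_uac nu0h).
have rho00 N f : bdd N f -> \int[rho 0]_x f x = \int[nu0]_x f x.
  move=> bf; congr fine; apply: eq_measure_integral => E mE _; exact: rho0.
have mP : measurable (@posR R) by exact: measurable_itv.
(* the equation tested against the indicator of the negative half-line *)
have rho_pos t : 0 <= t -> rho t (~` posR) = 0%E.
  move=> t0; have bf : bdd 1 (\1_(~` @posR R) : R -> R) by apply: bdd_indic; exact: measurableC.
  have z0 : \int[rho 0]_x \1_(~` @posR R) x = 0.
    have [_] := density_Rintegral nu0h (bdd_integrable nu0 bf).
    rewrite (rho00 _ _ bf) => ->.
    under eq_Rintegral => x _.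
      rewrite (_ : _ * _ = 0); first over.
      rewrite indicE in_setC; case: ifPn => x0; last by rewrite mulr0.
      by rewrite mem_set ?mul0r// /posR/= in_itv/= andbT.
    by rewrite Rintegral_cst// mul0r.
  have zt : \int[rho t]_x \1_(~` @posR R) x = 0.
    have [t1|t1] := leP t 0.
      by rewrite (_ : t = 0)//; apply: le_anti; rewrite t1 t0.
    have [_ /(_ t t1)[_]] := rhoP _ _ bf.
    rewrite z0 subr0 => <-; under eq_Rintegral => s _.
      rewrite /exchange_rate; under eq_Rintegral do rewrite jump_negative_half//.
      rewrite Rintegral_cstT mul0r; over.
    by rewrite Rintegral_cst// mul0r.
  rewrite Rintegral_indicT in zt; last exact: measurableC.
  by rewrite -[LHS]fineK ?zt// fin_num_measure//; exact: measurableC.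
have /choice[zeta zetaP] : forall t, exists u : R -> R,
    (0 <= t -> has_density (rho t) u) /\ forall x, x <= 0 -> u x = 0.
  move=> t; have [t0|t0] := leP 0 t; last by exists (fun=> 0); split => //.
  by have [u ru u0] := Radon_Nikodym_density (rho_ac t t0) (rho_pos t t0); exists u.
have rhoz t : 0 <= t -> has_density (rho t) (zeta t) by have [] := zetaP t.
have zeta_neg t x : x <= 0 -> zeta t x = 0 by have [_] := zetaP t; exact.
have rhoL N f : bdd N f -> forall t t', 0 <= t -> t <= t' ->
  `|\int[rho t']_x f x - \int[rho t]_x f x| <= N * ((t' - t) * speed ((1 + A) * C) M Th).
  by move=> bf; have [] := rhoP _ _ bf.
have S0 : 0 <= speed ((1 + A) * C) M Th by exact: speed_ge0.
have strong := strong_continuity rhoz zeta_neg rhoM rho_tail S0 rhoL.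
have weak := weak_continuity rhoz zeta_neg S0 rhoL.
have bounded := time_essentially_bounded rhoz zeta_neg rhoM rho_tail S0 rhoL.
have nn (t : R) : nnegR t -> 0 <= t by rewrite /nnegR/= in_itv/= andbT.
exists zeta; split => //; split => //.
  by move=> t /nn /rhoz[_ z0 _]; apply: aeW => x _; exact: z0.
move=> t w t0 sw wL.
have [N [f [bf wf]]] := smooth_Linfty_bdd sw wL.
have ex s : 0 <= s -> _ /\ exchange a w (zeta s) = exchange_rate theta k rho f s :=
  fun s0 => exchange_jump mk k0 k_supp mg g0 kg C10 gC thetaM a_meas thetah ak (rhoM s s0)
    (rhoz s s0) bf wf.
have [_ wk] := rhoP _ _ bf.
have lhs := integral_difference (rhoz t t0) (zeta_neg t) nu0h zetain_L1 zetain_ge0 (proj1 wL) bf wf.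
rewrite lhs -(rho00 _ _ bf).
have ae_int : {ae @lebesgue_measure R, forall s, s \in `]0, t[ ->
    mu3.-integrable (octant `&` [set p | p.2 < p.1.1])
      (fun p => (exchange_integrand a w (zeta s) p.1.1 p.1.2 p.2)%:E)}.
  by apply: aeW => s; rewrite in_itv/= => /andP[s0 _]; have [] := ex s (ltW s0).
have [t1|t1] := leP t 0.
  have tE : t = 0 by apply: le_anti; rewrite t1 t0.
  have e0 : `]0, t[%classic = set0 :> set R by rewrite tE set_itv_ge// bnd_simp ltxx.
  split; first by split => //; rewrite e0; exact: integrable_set0.
  by rewrite e0 Rintegral_set0 tE subrr.
have [It <-] := wk t t1.
have Io : (@lebesgue_measure R).-integrable `]0, t[ (EFin \o exchange_rate theta k rho f).
  by apply: integrableS It; [exact: measurable_itv|exact: measurable_itv|exact: subset_itv_oo_cc].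
have exE : {in (`]0, t[%classic : set R), (fun s => exchange a w (zeta s)) =1 exchange_rate theta k rho f}.
  move=> s; rewrite inE/= in_itv/= => /andP[s0 _]; have [_ ->//] := ex s (ltW s0).
split.
  split => //; apply: eq_integrable Io; first exact: measurable_itv.
  by move=> s sI /=; rewrite exE.
transitivity (\int[@lebesgue_measure R]_(s in `]0, t[) exchange_rate theta k rho f s); last first.
  by apply: eq_Rintegral => s sI; rewrite exE.
rewrite /Rintegral; congr fine; apply: integral_itv_bndoo.
exact: measurable_int Io.
Qed.
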